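(* Let $\theta$ be a fixed positive irrational number, let $\tau$ be a character on $\mathcal L_{\mathbb T}$ with $\tau(P_{\mathbb T})\neq 0$, and let $\Omega_{\mathbb T^2}=(\mathcal L_{\mathbb T^2},F_{\mathbb T^2},\mathrm{tr}_{\mathbb T^2})$ be the indicial triple for $C(\mathbb T^2)$ defined from $\theta$ and $\tau$ in the context. Let $\varphi\in C(\mathbb T^2)$. Then the Toeplitz element $T_\varphi$ associated to $\Omega_{\mathbb T^2}$ is an $\Omega_{\mathbb T^2}$-Fredholm element if and only if $\varphi\in\mathrm{Inv}(C(\mathbb T^2))$.
   Context: $\mathbb T$ is the unit circle in $\mathbb C$, and $z:\mathbb T\to\mathbb C$ is the inclusion function. $C(\mathbb T^2)=C(\mathbb T)\otimes C(\mathbb T)$. $\mathrm{Inv}(A)$ is the group of invertible elements of $A$. Tensor products of $C^*$-algebras are spatial. A character is a non-zero multiplicative linear functional. Traces: a trace on a $C^*$-algebra $A$ is a map $\mathrm{tr}:A^+\to[0,+\infty]$ that is additive, positively homogeneous and satisfies $\mathrm{tr}(a^*a)=\mathrm{tr}(aa^* )$. $\mathcal M_{\mathrm{tr}}$ is the linear span of $\{a\in A^+:\mathrm{tr}(a)<\infty\}$ (on which $\mathrm{tr}$ extends linearly), and $\mathcal K_{\mathrm{tr}}$ is its norm closure. Indicial triple for a unital $C^*$-algebra $C$: a triple $\Omega=(\mathcal L,F,\mathrm{tr})$ where $\mathcal L$ is a unital $C^*$-algebra containing $C$ as a unital $C^*$-subalgebra, $F\in\mathcal L$ is a self-adjoint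 unitary, $\mathrm{tr}$ is a lower semicontinuous trace on $\mathcal L$, and $\{\varphi\in C:[F,\varphi]\in\mathcal M_{\mathrm{tr}}\}$ is dense in $C$. Put $P=(F+1)/2$. For $\varphi\in C$, $T_\varphi=P\varphi P$ is the Toeplitz element; the Toeplitz algebra $\mathcal A$ is the $C^*$-algebra generated by all $T_\varphi$, with unit $P$; $\mathrm{Tr}$ is the restriction of $\mathrm{tr}$ to $\mathcal A$. An element $a\in\mathcal A$ is $\Omega$-Fredholm if there is $b\in\mathcal A$ with $P-ab,\ P-ba\in\mathcal M_{\mathrm{Tr}}$. Circle: $P_{\mathbb T}$ is the orthogonal projection of $L^2(\mathbb T)$ (normalized Lebesgue measure) onto the Hardy space $H^2(\mathbb T)$, the closed span of $\{z^m: m\ge 0\}$. $\mathcal L_{\mathbb T}$ is the unital $C^*$-subalgebra of $\mathbf B(L^2(\mathbb T))$ generated by $C(\mathbb T)$ (acting by multiplication) and $P_{\mathbb T}$. $\mathrm{tr}_{\mathbb T}$ is the restriction to $\mathcal L_{\mathbb T}$ of the canonical trace on $\mathbf B(L^2(\mathbb T))$. Torus: $\mathcal L_{\mathbb T^2}=\mathcal L_{\mathbb T}\otimes\mathcal L_{\mathbb T}\subseteq\mathbf B(L^2(\mathbb T^2))$, $P_{\mathbb T^2}=P_{\mathbb T}\otimes P_{\mathbb T}$, $F_{\mathbb T^2}=2P_{\mathbb T^2}-1$. With $\iota$ the identity map, put $(\tau\otimes\mathrm{tr}_{\mathbb T})(a)=\mathrm{tr}_{\mathbb T}((\tau\otimes\iota)(a))$,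 $(\mathrm{tr}_{\mathbb T}\otimes\tau)(a)=\mathrm{tr}_{\mathbb T}((\iota\otimes\tau)(a))$, and $\mathrm{tr}_1(a)=(\tau\otimes\mathrm{tr}_{\mathbb T})(a)+\theta(\mathrm{tr}_{\mathbb T}\otimes\tau)(a)$ for $a\in\mathcal L_{\mathbb T^2}^+$. Let $I=\mathcal L_{\mathbb T}\otimes\mathcal K_{\mathrm{tr}_{\mathbb T}}+\mathcal K_{\mathrm{tr}_{\mathbb T}}\otimes\mathcal L_{\mathbb T}$, a closed ideal of $\mathcal L_{\mathbb T^2}$, and define $\mathrm{tr}_{\mathbb T^2}(a)=\mathrm{tr}_1(a)$ if $a\in I^+$ and $\mathrm{tr}_{\mathbb T^2}(a)=+\infty$ if $a\in\mathcal L_{\mathbb T^2}^+\setminus I^+$. Then $\Omega_{\mathbb T^2}=(\mathcal L_{\mathbb T^2},F_{\mathbb T^2},\mathrm{tr}_{\mathbb T^2})$ is an indicial triple for $C(\mathbb T^2)$ (acting by multiplication on $L^2(\mathbb T^2)$). *)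

(* Defs.v *)
From HB Require Import structures.
From mathcomp Require Import all_boot all_order all_algebra.
From mathcomp Require Import complex ring.
From mathcomp Require Import all_classical all_reals all_analysis measurable_realfun.

Set Implicit Arguments.
Unset Strict Implicit.
Unset Printing Implicit Defensive.

Import Order.TTheory GRing.Theory Num.Theory.
Import numFieldNormedType.Exports.

Local Open Scope classical_set_scope.
Local Open Scope ring_scope.
Local Open Scope complex_scope.
Local Open Scope quotient_scope.

(* The complex numbers, presented through their numFieldType structure so that
   the norm topology of normed_module.v is found. *)
Notation Cx R := (Num.NumField.sort (R[i] : numFieldType)).

Section square_integrable.
Context d (X : measurableType d) (R : realType) (mu : {measure set X -> \bar R}).

Definition sqnorm (z : Cx R) : R := complex.Re z ^+ 2 + complex.Im z ^+ 2.

Definition cmeasurable (f : X -> Cx R) :=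
  measurable_fun setT (fun x => complex.Re (f x)) /\
  measurable_fun setT (fun x => complex.Im (f x)).

Definition sqintegrable : {pred X -> Cx R} :=
  mem [set f | cmeasurable f /\ (\int[mu]_x (sqnorm (f x))%:E < +oo)%E].

Lemma sqnorm_ge0 z : 0 <= sqnorm z.
Proof. by rewrite addr_ge0 ?sqr_ge0. Qed.

Lemma measurable_sqnorm f : cmeasurable f ->
  measurable_fun setT (fun x => sqnorm (f x)).
Proof.
by move=> [mr mi]; apply: measurable_funD; apply: measurable_funX.
Qed.

Lemma cmeasurableZB k f g : cmeasurable f -> cmeasurable g ->
  cmeasurable (fun x => k * f x - g x).
Proof.
move=> [fr fi] [gr gi]; case: k => a b; split.
- rewrite (_ : (fun x => _) = fun x => a * complex.Re (f x) - b * complex.Im (f x) - complex.Re (g x)).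
    by do ?[apply: measurable_funB|apply: measurable_funM].
  by apply/funext => x; case: (f x) (g x) => [? ?] [? ?].
- rewrite (_ : (fun x => _) = fun x => a * complex.Im (f x) + b * complex.Re (f x) - complex.Im (g x)).
    by do ?[apply: measurable_funB|apply: measurable_funD|apply: measurable_funM].
  by apply/funext => x; case: (f x) (g x) => [? ?] [? ?].
Qed.

Lemma sqnormZB_le k (z w : Cx R) :
  sqnorm (k * z - w) <= 2 * sqnorm k * sqnorm z + 2 * sqnorm w.
Proof.
case: k z w => [a b] [c e] [u v]; rewrite /sqnorm /= -subr_ge0.
have -> : 2 * (a ^+ 2 + b ^+ 2) * (c ^+ 2 + e ^+ 2) + 2 * (u ^+ 2 + v ^+ 2) -
    ((a * c - b * e - u) ^+ 2 + (a * e + b * c - v) ^+ 2) =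
    (a * c - b * e + u) ^+ 2 + (a * e + b * c + v) ^+ 2 by ring.
by rewrite addr_ge0 ?sqr_ge0.
Qed.

Lemma sqintegrableZB k f g : f \in sqintegrable -> g \in sqintegrable ->
  (fun x => k * f x - g x) \in sqintegrable.
Proof.
rewrite !inE /= => -[mf foo] [mg goo]; split; first exact: cmeasurableZB.
have kge0 : 0 <= 2 * sqnorm k by rewrite mulr_ge0 ?sqnorm_ge0.
apply: (@le_lt_trans _ _ (\int[mu]_x ((2 * sqnorm k)%:E * (sqnorm (f x))%:E
    + 2%:E * (sqnorm (g x))%:E))%E).
  apply: ge0_le_integral => //.
  - by move=> x _; rewrite lee_fin sqnorm_ge0.
  - by apply/measurable_EFinP; exact/measurable_sqnorm/cmeasurableZB.
  - apply: emeasurable_funD; apply: measurable_funeM;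
      by apply/measurable_EFinP; exact: measurable_sqnorm.
  - by move=> x _; rewrite -!EFinM -EFinD lee_fin sqnormZB_le.
rewrite ge0_integralD //; first last.
- by apply: measurable_funeM; apply/measurable_EFinP; exact: measurable_sqnorm.
- by move=> x _; rewrite -EFinM lee_fin mulr_ge0 ?sqnorm_ge0.
- by apply: measurable_funeM; apply/measurable_EFinP; exact: measurable_sqnorm.
- by move=> x _; rewrite -EFinM lee_fin mulr_ge0 ?sqnorm_ge0.
rewrite !ge0_integralZl //; first last.
- by move=> x _; rewrite lee_fin sqnorm_ge0.
- by apply/measurable_EFinP; exact: measurable_sqnorm.
- by move=> x _; rewrite lee_fin sqnorm_ge0.
- by apply/measurable_EFinP; exact: measurable_sqnorm.
by rewrite lte_add_pinfty // lte_mul_pinfty.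
Qed.

Lemma sqintegrable0 : (0 : X -> Cx R) \in sqintegrable.
Proof.
rewrite inE; split; first by split; exact: measurable_cst.
under eq_integral do rewrite /sqnorm /= expr0n addr0.
by rewrite integral0.
Qed.

Lemma sqintegrable_zmod_closed : zmod_closed sqintegrable.
Proof.
split=> [|f g fP gP]; first exact: sqintegrable0.
rewrite (_ : f - g = fun x => 1 * f x - g x); first exact: sqintegrableZB.
by apply/funext => x; rewrite mul1r.
Qed.

HB.instance Definition _ :=
  GRing.isZmodClosed.Build _ sqintegrable sqintegrable_zmod_closed.

Definition sqfun := {f : X -> Cx R | f \in sqintegrable}.
HB.instance Definition _ := SubType.on sqfun.
HB.instance Definition _ := Choice.on sqfun.
HB.instance Definition _ := [SubChoice_isSubZmodule of sqfun by <:].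

Definition ae_zero : {pred sqfun} :=
  mem [set f | {ae mu, forall x, sval f x = 0}].

Lemma ae_zero_zmod_closed : zmod_closed ae_zero.
Proof.
split=> [|f g]; first by rewrite inE; exact: aeW.
rewrite !inE /=; apply: filterS2 => x fx gx.
by rewrite -[LHS]/(sval f x - sval g x) fx gx subrr.
Qed.

HB.instance Definition _ :=
  GRing.isZmodClosed.Build _ ae_zero ae_zero_zmod_closed.

Definition L2 := Quotient.quot ae_zero.
HB.instance Definition _ := Choice.on L2.
HB.instance Definition _ := GRing.Zmodule.on L2.
HB.instance Definition _ := ZmodQuotient.on L2.

Lemma sqscale_subproof k (f : sqfun) : (fun x => k * sval f x) \in sqintegrable.
Proof.
rewrite (_ : (fun x => _) = fun x => k * sval f x - (0 : X -> Cx R) x).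
  by apply: sqintegrableZB sqintegrable0; exact: valP.
by apply/funext => x; rewrite subr0.
Qed.

Definition sqscale k (f : sqfun) : sqfun :=
  exist (fun g => g \in sqintegrable) _ (sqscale_subproof k f).

Definition L2_scale (k : Cx R) (u : L2) : L2 := \pi_L2 (sqscale k (repr u)).

Lemma sqfun_eqP (f g : sqfun) : (forall x, sval f x = sval g x) -> f = g.
Proof. by move=> fg; apply/val_inj/funext. Qed.

Lemma L2_eqP (f g : sqfun) :
  \pi_L2 f = \pi_L2 g <-> {ae mu, forall x, sval f x = sval g x}.
Proof.
split.
- move=> /eqP; rewrite -Quotient.idealrBE inE /=; apply: filterS => x /=.
  by rewrite -[LHS]/(sval f x - sval g x) => /eqP; rewrite subr_eq0 => /eqP.
- move=> fg; apply/eqP; rewrite -Quotient.idealrBE inE /=.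
  apply: filterS fg => x /= fg.
  by rewrite -[LHS]/(sval f x - sval g x) fg subrr.
Qed.

Lemma ae_repr (f : sqfun) : {ae mu, forall x, sval (repr (\pi_L2 f)) x = sval f x}.
Proof. by apply/L2_eqP; rewrite reprK. Qed.

Lemma pi_scale k f : \pi_L2 (sqscale k f) = L2_scale k (\pi_L2 f).
Proof.
apply/L2_eqP; have := ae_repr f; apply: filterS => x /= ->; by [].
Qed.

Let pi_addr : {morph \pi_L2 : f g / f + g}.
Proof. by move=> f g; rewrite !piE. Qed.

Lemma L2_scaleA a b u : L2_scale a (L2_scale b u) = L2_scale (a * b) u.
Proof.
elim/quotW: u => f; rewrite -(pi_scale b f) -!pi_scale; congr (\pi_L2 _).
by apply: sqfun_eqP => x /=; rewrite mulrA.
Qed.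

Lemma L2_scale1 : left_id 1 L2_scale.
Proof.
elim/quotW => f; rewrite -pi_scale; congr (\pi_L2 _).
by apply: sqfun_eqP => x /=; rewrite mul1r.
Qed.

Lemma L2_scaleDr : right_distributive L2_scale +%R.
Proof.
move=> a; elim/quotW => f; elim/quotW => g.
rewrite -!pi_scale -[\pi_L2 f + \pi_L2 g]pi_addr -pi_scale -pi_addr.
congr (\pi_L2 _); apply: sqfun_eqP => x.
by rewrite -[LHS]/(a * (sval f x + sval g x)) mulrDr.
Qed.

Lemma L2_scaleDl u : {morph L2_scale^~ u : a b / a + b}.
Proof.
elim/quotW: u => f a b; rewrite -!pi_scale -pi_addr.
congr (\pi_L2 _); apply: sqfun_eqP => x.
by rewrite -[LHS]/((a + b) * sval f x) mulrDl.
Qed.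

HB.instance Definition _ := GRing.Zmodule_isLmodule.Build (Cx R) L2
  L2_scaleA L2_scale1 L2_scaleDr L2_scaleDl.

(* The class of f, with the value 0 when f is not square integrable. *)
Definition L2_class (f : X -> Cx R) : L2 := \pi_L2 (insubd (0 : sqfun) f).

Definition inner (u v : L2) : Cx R :=
  let h x := sval (repr u) x * conjc (sval (repr v) x) in
  (\int[mu]_x complex.Re (h x)) +i* (\int[mu]_x complex.Im (h x)).

Definition hnorm (u : L2) : R := Num.sqrt (complex.Re (inner u u)).

Definition mulop (phi : X -> Cx R) (u : L2) : L2 :=
  L2_class (fun x => phi x * sval (repr u) x).

End square_integrable.

Section subspace.
Context (R : realType) (V : lmodType (Cx R)).

Definition lin_subspace (S : set V) :=
  S 0 /\ forall (k : Cx R) u v, S u -> S v -> S (k *: u + v).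

Definition lin_span (S : set V) : set V := smallest lin_subspace S.

End subspace.

(* Operators on L2 mu are bare functions; every algebra of operators below is
   contained in bounded_op. *)
Section operators.
Context d (X : measurableType d) (R : realType) (mu : {measure set X -> \bar R}).
Local Notation op := (L2 mu -> L2 mu).
Implicit Types (a b c : op) (A S : set op) (V : set (L2 mu)).

Definition L2_closure V : set (L2 mu) :=
  [set u | forall e : R, 0 < e -> exists2 v, V v & hnorm (u - v) < e].

Definition bounded_op : set op :=
  [set a | linear a /\
           exists M : R, forall u, hnorm (a u) <= M * hnorm u].

Definition opnorm a : \bar R :=
  ereal_sup [set (hnorm (a u))%:E | u in [set u | hnorm u <= 1]].

Definition op_closure S : set op :=
  [set a | bounded_op a /\
           forall e : R, 0 < e -> exists2 b, S b & (opnorm (a - b)%R < e%:E)%E].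

Definition is_adjoint a b := forall u v, inner (a u) v = inner u (b v).

Definition positive_op a := bounded_op a /\ forall u, 0 <= inner (a u) u.

Definition cstar_subalgebra A :=
  [/\ A `<=` bounded_op,
      lin_subspace A,
      forall a b, A a -> A b -> A (a \o b),
      forall a b, A a -> bounded_op b -> is_adjoint a b -> A b
    & op_closure A `<=` A].

Definition cstar_generated S : set op := smallest cstar_subalgebra S.

Definition orthogonal_projection V : op :=
  xget 0 [set p | forall u, V (p u) /\
                            forall v, V v -> inner (u - p u) v = 0].

(* Positive elements of a concrete C*-algebra A are the positive operators
   in A; a trace is only ever evaluated on those. *)
Definition trace_span A (tr : op -> \bar R) : set op :=
  lin_span [set a | [/\ A a, positive_op a & (tr a < +oo)%E]].

Definition trace_closure A (tr : op -> \bar R) : set op :=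
  op_closure (trace_span A tr).

Definition is_character A (tau : op -> Cx R) :=
  [/\ forall (k : Cx R) a b, A a -> A b -> tau (k *: a + b) = k * tau a + tau b,
      forall a b, A a -> A b -> tau (a \o b) = tau a * tau b
    & exists2 a, A a & tau a != 0].

(* The data of an indicial triple whose algebra acts on L2 mu; Toeplitz elements
   and Fredholmness depend on nothing else. *)
Record indicial_data := IndicialData {
  ind_alg : set op;
  ind_sym : op;
  ind_tr : op -> \bar R }.

Implicit Types (Omega : indicial_data) (C : set op).

Definition ind_proj Omega : op := 2^-1 *: (ind_sym Omega + idfun).

Definition toeplitz Omega c : op := ind_proj Omega \o c \o ind_proj Omega.

Definition toeplitz_algebra Omega C : set op :=
  cstar_generated [set toeplitz Omega c | c in C].

Definition fredholm Omega C a :=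
  let A := toeplitz_algebra Omega C in
  let M := trace_span A (ind_tr Omega) in
  let P := ind_proj Omega in
  A a /\ exists b, [/\ A b, M (P - (a \o b)) & M (P - (b \o a))].

End operators.

Section circle.
Context (R : realType).

Definition circle := set_type [set z : Cx R | `|z| = 1].
HB.instance Definition _ := Topological.on circle.

Lemma circle1_subproof : (1 : Cx R) \in [set z : Cx R | `|z| = 1].
Proof. by rewrite inE /= normr1. Qed.

HB.instance Definition _ := isPointed.Build circle (exist _ 1 circle1_subproof).

HB.instance Definition _ :=
  Measurable.copy circle (g_sigma_algebraType (@open circle)).

Lemma circle_param_subproof (t : R) :
  (cos (2 * pi * t) +i* sin (2 * pi * t) : Cx R)
    \in [set z : Cx R | `|z| = 1].
Proof. by rewrite inE /= normc_def /= cos2Dsin2 sqrtr1. Qed.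

Definition circle_param (t : measurableTypeR R) : circle :=
  exist (fun z => z \in [set z : Cx R | `|z| = 1]) _ (circle_param_subproof t).

Lemma continuous_real_complex : continuous (fun t : R => t%:C : Cx R).
Proof.
move=> t; apply/cvgrPdist_lt => e; rewrite ltcE /= => /andP[/eqP ei er].
near=> s; rewrite -rmorphB /= normc_def /= expr0n addr0 sqrtr_sqr ltcE /= ei eqxx /=.
near: s; exact: (@cvgr_dist_lt _ R^o _ _ _ id t cvg_id).
Unshelve. all: by end_near. Qed.

Lemma continuous_circle_param : continuous (circle_param : R -> circle).
Proof.
have valc : continuous (fun t : R => sval (circle_param t) : Cx R).
  rewrite (_ : (fun t => _) =
    fun t => (cos (2 * pi * t))%:C + 'i * (sin (2 * pi * t))%:C).
    move=> t; have lin : {for t, continuous (fun t : R => 2 * pi * t)}.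
      by apply: cvgM; [exact: cvg_cst|exact: cvg_id].
    apply: (@cvgD _ (Cx R)^o).
      apply: (continuous_comp (g := fun t : R => t%:C : Cx R)); last exact: continuous_real_complex.
      by apply: continuous_comp lin _; exact: continuous_cos.
    apply: cvgM; first exact: cvg_cst.
    apply: (continuous_comp (g := fun t : R => t%:C : Cx R)); last exact: continuous_real_complex.
    by apply: continuous_comp lin _; exact: continuous_sin.
  by apply/funext => t; apply/eqP; rewrite eq_complex /=; apply/andP; split; apply/eqP; ring.
by apply/continuousP => _ [V oV <-]; move/continuousP: valc => /(_ V oV).
Qed.

Lemma measurable_circle_param : measurable_fun setT circle_param.
Proof.
apply: measurability => //.
move=> _ [U oU <-].
rewrite setTI; apply: open_measurable.
by apply: open_comp oU => t _; exact: continuous_circle_param.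
Qed.

HB.instance Definition _ := isMeasurableFun.Build _ _ _ _ circle_param measurable_circle_param.

(* Normalized Lebesgue measure. *)
Definition circle_measure := distribution (uniform_prob (@ltr01 R)) circle_param.
HB.instance Definition _ := Probability.on circle_measure.

Definition torus_measure := (circle_measure \x circle_measure)%E.
HB.instance Definition _ := Measure.on torus_measure.

End circle.

Arguments circle_measure R : clear implicits.
Arguments torus_measure R : clear implicits.

Section circle_operators.
Context (R : realType).
Local Notation T := (circle R).
Local Notation mu := (circle_measure R).
Local Notation op := (L2 mu -> L2 mu).

Definition zpow (m : int) : L2 mu := L2_class mu (fun x : T => sval x ^ m).

Definition hardy : set (L2 mu) :=
  L2_closure (lin_span [set zpow m%:Z | m in [set: nat]]).

Definition PT : op := orthogonal_projection hardy.

Definition LT : set op :=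
  cstar_generated
    ([set mulop phi | phi in [set phi : T -> Cx R | continuous phi]]
       `|` [set PT]).

(* The canonical trace of B(L2), computed in the orthonormal basis z^m. *)
Definition trT (a : op) : \bar R :=
  \esum_(m in [set: int]) (complex.Re (inner (a (zpow m)) (zpow m)))%:E.

Definition KT : set op := trace_closure LT trT.

End circle_operators.

Section torus_operators.
Context (R : realType).
Local Notation T := (circle R).
Local Notation mu := (circle_measure R).
Local Notation mu2 := (torus_measure R).
Local Notation op := (L2 mu -> L2 mu).
Local Notation op2 := (L2 mu2 -> L2 mu2).

Definition tensor (u v : L2 mu) : L2 mu2 :=
  L2_class mu2 (fun x : T * T => sval (repr u) x.1 * sval (repr v) x.2).

Definition op_tensor (a b : op) : op2 :=
  xget 0 [set c | bounded_op c /\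
                  forall u v, c (tensor u v) = tensor (a u) (b v)].

(* For C*-algebras A and B this is their spatial tensor product. *)
Definition tensor_closure (A B : set op) : set op2 :=
  op_closure (lin_span [set op_tensor a b | a in A & b in B]).

Definition LT2 : set op2 := tensor_closure (@LT R) (@LT R).

Definition PT2 : op2 := op_tensor (@PT R) (@PT R).

Definition FT2 : op2 := 2 *: PT2 - idfun.

Definition CT2 : set op2 :=
  [set mulop phi | phi in [set phi : T * T -> Cx R | continuous phi]].

Definition bounded_linear_map (S : op2 -> op) :=
  [/\ forall a, LT2 a -> LT (S a),
      forall (k : Cx R) a b, LT2 a -> LT2 b -> S (k *: a + b) = k *: S a + S b
    & exists M : R, forall a, LT2 a -> (opnorm (S a) <= M%:E * opnorm a)%E].

(* tau tensor iota, and iota tensor tau below; only the values on LT2 are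
   meaningful. *)
Definition slicel (tau : op -> Cx R) : op2 -> op :=
  xget (fun=> 0) [set S | bounded_linear_map S /\
    forall a b, LT a -> LT b -> S (op_tensor a b) = tau a *: b].

Definition slicer (tau : op -> Cx R) : op2 -> op :=
  xget (fun=> 0) [set S | bounded_linear_map S /\
    forall a b, LT a -> LT b -> S (op_tensor a b) = tau b *: a].

Definition tr1 (theta : R) (tau : op -> Cx R) (a : op2) : \bar R :=
  (trT (slicel tau a) + theta%:E * trT (slicer tau a))%E.

Definition IT2 : set op2 :=
  [set a + b | a in tensor_closure (@LT R) (@KT R)
             & b in tensor_closure (@KT R) (@LT R)].

Definition trT2 (theta : R) (tau : op -> Cx R) (a : op2) : \bar R :=
  if `[< IT2 a >] then tr1 theta tau a else +oo%E.

Definition OmegaT2 (theta : R) (tau : op -> Cx R) : indicial_data mu2 :=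
  IndicialData LT2 FT2 (trT2 theta tau).

Definition invertible_CT2 (phi : T * T -> Cx R) :=
  exists2 psi : T * T -> Cx R, continuous psi & forall x, phi x * psi x = 1.

End torus_operators.

(* Main.v *)
Require Import Defs.
From HB Require Import structures.
From mathcomp Require Import all_boot all_order all_algebra.
From mathcomp Require Import complex.
From mathcomp Require Import all_classical all_reals all_analysis.
From mathcomp Require Import measurable_realfun ring lra zify.

Set Implicit Arguments.
Unset Strict Implicit.
Unset Printing Implicit Defensive.

Import Order.TTheory GRing.Theory Num.Theory.
Import numFieldNormedType.Exports.

Local Open Scope classical_set_scope.
Local Open Scope ring_scope.

Local Open Scope complex_scope.
Local Open Scope quotient_scope.

(** Write Q for the tensor square of the Hardy projection P, so that the Toeplitz element of phi is
    T_phi = Q phi Q.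

    Fredholm implies invertible. Suppose that phi vanishes at a point x. The unit vectors
    [fejer_tensor x n] lie in the Hardy space of the torus, and their squared moduli are products of
    Fejer kernels centred at x, so phi times these vectors tends to 0 ([annihilates_mulop]). Their
    frequencies go to infinity, so every element of the ideal I tends to 0 along them
    ([IT2_annihilates]); in one variable this says that a positive operator of finite trace does so
    along the Fejer vectors ([annihilates_trace_class]). Elements of finite trace belong to I by the
    definition of the trace. If Q - b T_phi is a combination of such elements, it tends to 0 along
    the vectors, and so does b T_phi; but Q fixes them and they have norm 1, a contradiction
    ([fredholm_invertible]).

    Invertible implies Fredholm. By Fejer averages ([trig_approximation]) there is a trigonometric
    polynomial q, of degree at most N in each variable, with |1 - phi q| <= 1/2, and then T_{phi q}
    is inverted in the Toeplitz algebra by a Neumann series ([neumann_adjointable]). It remains to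
    compare T_{phi q} with T_phi T_q. Since q times (z1 z2)^N is analytic, the difference vanishes
    on the range of T_{(z1 z2)^N}; hence it is unchanged by right multiplication with [gap N] = Q -
    p_N (x) p_N, where p_N is the projection onto z^N H^2 ([semi_commutator_gap]). The same holds on
    the left for T_{q phi} - T_q T_phi ([gap_semi_commutator]). All errors of the parametrix are
    therefore combinations of products x gap y with x and y in the Toeplitz algebra ([parametrix]).

    Such products have finite trace. Indeed [gap N] = E_N (x) P + p_N (x) E_N, where E_N = P - p_N
    has finite rank, so x gap y lies in I ([IT2_gap]). As tau is a character with tau(P) != 0, it
    takes the value 1 at P and at p_N, and 0 at E_N. So both slice maps send [gap N] to E_N; they
    are multiplicative on the closed span of the elementary tensors ([slice_comp]), which contains
    the Toeplitz algebra, and hence send x gap y to an operator of finite rank ([slicel_trT],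
    [slicer_trT]). Membership in the span of the positive elements of finite trace then follows by
    polarization from the positive products y* gap y ([trace_span_gap]).

    The Hardy projection, tensors of operators and slice maps are chosen objects with default value
    0. The hypothesis tau(P) != 0 excludes the default for P ([PT_spec]), the tensors that occur are
    constructed, and a slice map equal to its default gives trace 0. *)

(** * Squared moduli of complex numbers *)

Section complex_scalars.
Context (R : realType).
Implicit Types z w : Cx R.

Lemma cx_eqP z w :
  complex.Re z = complex.Re w -> complex.Im z = complex.Im w -> z = w.
Proof. by case: z w => [a b] [c e] /= -> ->. Qed.

Lemma sqnormM z w : sqnorm (z * w) = sqnorm z * sqnorm w.
Proof. by case: z w => [a b] [c e]; rewrite /sqnorm /=; ring. Qed.

Lemma sqnormJ z : sqnorm (conjc z) = sqnorm z.
Proof. by case: z => a b; rewrite /sqnorm /= sqrrN. Qed.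

Lemma sqnormN z : sqnorm (- z) = sqnorm z.
Proof. by case: z => a b; rewrite /sqnorm /= !sqrrN. Qed.

Lemma sqnorm0 : sqnorm (0 : Cx R) = 0.
Proof. by rewrite /sqnorm /= expr0n addr0. Qed.

Lemma sqnorm1 : sqnorm (1 : Cx R) = 1.
Proof. by rewrite /sqnorm /= expr0n addr0 expr1n. Qed.

Lemma sqnorm_real (r : R) : sqnorm (r%:C : Cx R) = r ^+ 2.
Proof. by rewrite /sqnorm /= expr0n addr0. Qed.

Lemma mulcJ z : z * conjc z = (sqnorm z)%:C.
Proof. by case: z => a b; apply: cx_eqP; rewrite /sqnorm /=; ring. Qed.

Lemma sqnorm_eq0 z : sqnorm z = 0 -> z = 0.
Proof.
case: z => a b; rewrite /sqnorm /= => /eqP.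
by rewrite paddr_eq0 ?sqr_ge0// !sqrf_eq0 => /andP[/eqP -> /eqP ->].
Qed.

Lemma sqnorm_gt0 z : z != 0 -> 0 < sqnorm z.
Proof.
by move=> z0; rewrite lt_def sqnorm_ge0 andbT; apply: contra_neq z0; exact: sqnorm_eq0.
Qed.

Lemma normc_sqnorm z : `|z| = (Num.sqrt (sqnorm z))%:C.
Proof. by rewrite normc_def. Qed.

Lemma unitc_sqnorm z : `|z| = 1 -> sqnorm z = 1.
Proof.
rewrite normc_sqnorm => /(congr1 (@complex.Re R)) /= h.
by rewrite -[LHS]sqr_sqrtr ?sqnorm_ge0// h expr1n.
Qed.

(** Cauchy-Schwarz against a constant family, by induction; the slack in the two-term inequality is
    the squared modulus of n x - y. *)
Lemma sqnorm_sum_le n (F : 'I_n -> Cx R) :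
  sqnorm (\sum_(i < n) F i) <= n%:R * \sum_(i < n) sqnorm (F i).
Proof.
elim: n F => [|n IHn] F; first by rewrite !big_ord0 sqnorm0 mulr0.
rewrite !big_ord_recl.
set x := F ord0; set y := \sum_(i < n) F (lift ord0 i).
move: (IHn (fun i => F (lift ord0 i))); rewrite -/y => hy.
set s := \sum_(i < n) _ in hy *.
have [n0|n0] := posnP n.
  rewrite /y /s; subst n; rewrite !big_ord0 !addr0 mul1r //.
have nR : (0 : R) < n%:R by rewrite ltr0n.
suff : n%:R * sqnorm (x + y) <= n%:R * (n.+1%:R * (sqnorm x + s)).
  by rewrite ler_pM2l.
have : n%:R * sqnorm (x + y) <= n.+1%:R * (n%:R * sqnorm x + sqnorm y).
  move: nR; rewrite -natr1; set m := n%:R; clearbody x y => mp.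
  case: x y {hy} => [a b] [c e]; rewrite /sqnorm /= -subr_ge0.
  have -> : (m + 1) * (m * (a ^+ 2 + b ^+ 2) + (c ^+ 2 + e ^+ 2)) -
     m * ((a + c) ^+ 2 + (b + e) ^+ 2) =
     (m * a - c) ^+ 2 + (m * b - e) ^+ 2 by ring.
  by rewrite addr_ge0 ?sqr_ge0.
move=> h; apply: le_trans h _; rewrite [leRHS]mulrCA ler_pM2l ?ltr0n//.
by rewrite [leRHS]mulrDr lerD2l.
Qed.

Lemma sqnormD_le z w : sqnorm (z + w) <= 2 * sqnorm z + 2 * sqnorm w.
Proof.
by have := sqnormZB_le 1 z (- w); rewrite mul1r opprK sqnorm1 sqnormN mulr1.
Qed.

End complex_scalars.

(** * Integration of complex-valued functions *)

Section complex_integral.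
Context d (X : measurableType d) (R : realType) (mu : {measure set X -> \bar R}).
Implicit Types f g h : X -> Cx R.

Definition cintegrable h :=
  mu.-integrable setT (EFin \o (fun x => complex.Re (h x))) /\
  mu.-integrable setT (EFin \o (fun x => complex.Im (h x))).

Definition cint h : Cx R :=
  (\int[mu]_x complex.Re (h x)) +i* (\int[mu]_x complex.Im (h x)).

Lemma cintegrable_measurable h : cintegrable h -> cmeasurable h.
Proof.
by move=> [/integrableP[/measurable_EFinP ? _] /integrableP[/measurable_EFinP ? _]].
Qed.

Lemma cmeasurableM f g : cmeasurable f -> cmeasurable g ->
  cmeasurable (fun x => f x * g x).
Proof.
move=> [fr fi] [gr gi]; split.
- rewrite (_ : (fun x => _) = fun x => complex.Re (f x) * complex.Re (g x) -
    complex.Im (f x) * complex.Im (g x)).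
    by apply: measurable_funB; apply: measurable_funM.
  by apply/funext => x; case: (f x) (g x) => [? ?] [? ?].
- rewrite (_ : (fun x => _) = fun x => complex.Re (f x) * complex.Im (g x) +
    complex.Im (f x) * complex.Re (g x)).
    by apply: measurable_funD; apply: measurable_funM.
  by apply/funext => x; case: (f x) (g x) => [? ?] [? ?].
Qed.

Lemma cmeasurableJ f : cmeasurable f -> cmeasurable (fun x => conjc (f x)).
Proof.
move=> [fr fi]; split.
- by rewrite (_ : (fun x => _) = fun x => complex.Re (f x))//; apply/funext => x; case: (f x).
- rewrite (_ : (fun x => _) = fun x => - complex.Im (f x)).
    exact: measurableT_comp.
  by apply/funext => x; case: (f x).
Qed.

Lemma cmeasurable_cst (k : Cx R) : cmeasurable (fun _ : X => k).
Proof. by split; exact: measurable_cst. Qed.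

Lemma cmeasurableD f g : cmeasurable f -> cmeasurable g ->
  cmeasurable (fun x => f x + g x).
Proof.
move=> mf mg; have /cmeasurableZB := mf; move=> /(_ 1 (fun x => - g x)).
rewrite (_ : (fun x => 1 * f x - - g x) = fun x => f x + g x); last first.
  by apply/funext => x; rewrite mul1r opprK.
apply; have := cmeasurableZB 0 mg mg.
by rewrite (_ : (fun x => 0 * g x - g x) = fun x => - g x)//; apply/funext => x; rewrite mul0r sub0r.
Qed.

Lemma cmeasurable_sum n (F : 'I_n -> X -> Cx R) :
  (forall i, cmeasurable (F i)) -> cmeasurable (fun x => \sum_(i < n) F i x).
Proof.
elim: n F => [|n IHn] F mF.
  rewrite (_ : (fun x => _) = fun=> 0); first exact: cmeasurable_cst.
  by apply/funext => x; rewrite big_ord0.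
rewrite (_ : (fun x => _) = fun x => F ord0 x + \sum_(i < n) F (lift ord0 i) x).
  by apply: cmeasurableD => //; apply: IHn.
by apply/funext => x; rewrite big_ord_recl.
Qed.

Lemma cintegrable_le h (g : X -> R) : cmeasurable h ->
  mu.-integrable setT (EFin \o g) -> (forall x, sqnorm (h x) <= g x ^+ 2) ->
  cintegrable h.
Proof.
move=> [hr hi] ig hg; split; apply: le_integrable ig => //; try exact/measurable_EFinP.
- move=> x _ /=; rewrite lee_fin -ler_sqr ?nnegrE// -!normrX !ger0_norm ?sqr_ge0//.
  by apply: le_trans (hg x); rewrite /sqnorm lerDl sqr_ge0.
- move=> x _ /=; rewrite lee_fin -ler_sqr ?nnegrE// -!normrX !ger0_norm ?sqr_ge0//.
  by apply: le_trans (hg x); rewrite /sqnorm lerDr sqr_ge0.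
Qed.

Lemma cintegrableZD (k : Cx R) f g : cintegrable f -> cintegrable g ->
  cintegrable (fun x => k * f x + g x).
Proof.
move=> [fr fi] [gr gi]; split.
- rewrite (_ : EFin \o _ = ((fun x => (complex.Re k)%:E * (complex.Re (f x))%:E) \+
    (fun x => (- complex.Im k)%:E * (complex.Im (f x))%:E)) \+
    (EFin \o (fun x => complex.Re (g x))))%E.
    by apply: integrableD => //; apply: integrableD => //; apply: integrableZl.
  apply/funext => x /=; rewrite -!EFinM -!EFinD.
  by case: k (f x) (g x) => [? ?] [? ?] [? ?] /=; congr EFin; ring.
- rewrite (_ : EFin \o _ = ((fun x => (complex.Re k)%:E * (complex.Im (f x))%:E) \+
    (fun x => (complex.Im k)%:E * (complex.Re (f x))%:E)) \+
    (EFin \o (fun x => complex.Im (g x))))%E.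
    by apply: integrableD => //; apply: integrableD => //; apply: integrableZl.
  apply/funext => x /=; rewrite -!EFinM -!EFinD.
  by case: k (f x) (g x) => [? ?] [? ?] [? ?] /=; congr EFin; ring.
Qed.

Lemma cintZD (k : Cx R) f g : cintegrable f -> cintegrable g ->
  cint (fun x => k * f x + g x) = k * cint f + cint g.
Proof.
move=> [fr fi] [gr gi].
have iZ (r : R) (p : X -> R) : mu.-integrable setT (EFin \o p) ->
    mu.-integrable setT (EFin \o (fun x => r * p x)).
  move=> ip; rewrite (_ : EFin \o _ = (fun x => r%:E * (EFin \o p) x)%E).
    exact: integrableZl.
  by apply/funext => x /=; rewrite EFinM.
have iD (p q : X -> R) : mu.-integrable setT (EFin \o p) ->
    mu.-integrable setT (EFin \o q) ->
    mu.-integrable setT (EFin \o (fun x => p x + q x)).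
  move=> ip iq; rewrite (_ : EFin \o _ = ((EFin \o p) \+ (EFin \o q))%E).
    exact: integrableD.
  by apply/funext => x /=; rewrite EFinD.
apply: cx_eqP => /=.
- transitivity (\int[mu]_x ((complex.Re k * complex.Re (f x) +
      (- complex.Im k) * complex.Im (f x)) + complex.Re (g x))).
    congr (fine _); apply: eq_integral => x _.
    by case: k (f x) (g x) => [? ?] [? ?] [? ?] /=; congr EFin; ring.
  rewrite !RintegralD ?RintegralZl//; try by repeat (apply: iD || apply: iZ).
  case: k => a b /=; ring.
- transitivity (\int[mu]_x ((complex.Re k * complex.Im (f x) +
      complex.Im k * complex.Re (f x)) + complex.Im (g x))).
    congr (fine _); apply: eq_integral => x _.
    by case: k (f x) (g x) => [? ?] [? ?] [? ?] /=; congr EFin; ring.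
  rewrite !RintegralD ?RintegralZl//; try by repeat (apply: iD || apply: iZ).
  case: k => a b /=; ring.
Qed.

Lemma cintJ h : cintegrable h -> cint (fun x => conjc (h x)) = conjc (cint h).
Proof.
move=> [hr hi]; apply: cx_eqP => /=.
- by congr (fine _); apply: eq_integral => x _; case: (h x).
- rewrite -mulN1r -RintegralZl//.
  by congr (fine _); apply: eq_integral => x _; case: (h x) => ? ? /=; rewrite mulN1r.
Qed.

Lemma ae_eq_cint f g : cmeasurable f -> cmeasurable g ->
  {ae mu, forall x, f x = g x} -> cint f = cint g.
Proof.
move=> [fr fi] [gr gi] fg; apply: cx_eqP => /=; congr (fine _);
  apply: ae_eq_integral => //; try exact/measurable_EFinP;
  by apply: filterS fg => x /= -> _.
Qed.

End complex_integral.

(** * The inner product of L2 and its norm *)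

Section inner_product.
Context d (X : measurableType d) (R : realType) (mu : {measure set X -> \bar R}).
Local Notation H := (L2 mu).
Implicit Types (f g : sqfun mu) (u v w : H) (k : Cx R).

Definition sqn u : R := complex.Re (inner u u).

Lemma sqfunP f : cmeasurable (sval f) /\ (\int[mu]_x (sqnorm (sval f x))%:E < +oo)%E.
Proof. by case: f => f /=; rewrite inE. Qed.

Lemma sq_integrable f : mu.-integrable setT (EFin \o (fun x => sqnorm (sval f x))).
Proof.
have [mf foo] := sqfunP f; apply/integrableP; split.
  by apply/measurable_EFinP; exact: measurable_sqnorm.
apply: le_lt_trans foo; apply: ge0_le_integral => //.
- apply/measurable_EFinP; apply: measurableT_comp => //; exact: measurable_sqnorm.
- by apply/measurable_EFinP; exact: measurable_sqnorm.
- by move=> x _ /=; rewrite lee_fin ger0_norm ?sqnorm_ge0.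
Qed.

(** The product is dominated by the sum of the two squared moduli, since a b is at most (a + b)^2
    for non-negative a and b. *)
Lemma inner_integrable f g : cintegrable mu (fun x => sval f x * conjc (sval g x)).
Proof.
have [mf _] := sqfunP f; have [mg _] := sqfunP g.
apply: (@cintegrable_le _ _ _ _ _ (fun x => sqnorm (sval f x) + sqnorm (sval g x))).
- by apply: cmeasurableM => //; exact: cmeasurableJ.
- rewrite (_ : EFin \o _ = ((EFin \o (fun x => sqnorm (sval f x))) \+
    (EFin \o (fun x => sqnorm (sval g x))))%E); last first.
    by apply/funext => x /=; rewrite EFinD.
  by apply: integrableD => //; exact: sq_integrable.
- move=> x; rewrite sqnormM sqnormJ.
  have := sqnorm_ge0 (sval f x); have := sqnorm_ge0 (sval g x).
  by set a := sqnorm _; set b := sqnorm _ => a0 b0; nra.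
Qed.

Lemma inner_pi f g :
  inner (\pi_(L2 mu) f) (\pi_(L2 mu) g) = cint mu (fun x => sval f x * conjc (sval g x)).
Proof.
apply: ae_eq_cint.
- by apply: (@cintegrable_measurable _ _ _ mu); exact: inner_integrable.
- by apply: (@cintegrable_measurable _ _ _ mu); exact: inner_integrable.
- by have := ae_repr f; have := ae_repr g; apply: filterS2 => x -> ->.
Qed.

Lemma pi_ZD k f g : \pi_(L2 mu) (sqscale k f + g) = k *: \pi_(L2 mu) f + \pi_(L2 mu) g.
Proof. by rewrite -[k *: _]/(L2_scale _ _) -pi_scale !piE. Qed.

Lemma innerZDl k u v w : inner (k *: u + v) w = k * inner u w + inner v w.
Proof.
elim/quotW: u => f; elim/quotW: v => g; elim/quotW: w => h.
rewrite -pi_ZD !inner_pi -cintZD; try exact: inner_integrable.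
congr cint; apply/funext => x.
by rewrite -[sval (sqscale k f + g : sqfun mu) x]/(k * sval f x + sval g x) mulrDl mulrA.
Qed.

Lemma innerC u v : inner v u = conjc (inner u v).
Proof.
elim/quotW: u => f; elim/quotW: v => g.
rewrite !inner_pi -cintJ; last exact: inner_integrable.
by congr cint; apply/funext => x; rewrite rmorphM /= conjcK mulrC.
Qed.

Lemma innerDl u v w : inner (u + v) w = inner u w + inner v w.
Proof. by rewrite -[u]scale1r innerZDl mul1r scale1r. Qed.

Lemma inner0l w : inner 0 w = 0.
Proof. by have := innerDl 0 0 w; rewrite addr0 => /eqP; rewrite -subr_eq0 opprD addNKr oppr_eq0 => /eqP. Qed.

Lemma innerZl k u w : inner (k *: u) w = k * inner u w.
Proof. by have := innerZDl k u 0 w; rewrite !addr0 inner0l addr0. Qed.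

Lemma innerNl u w : inner (- u) w = - inner u w.
Proof. by rewrite -scaleN1r innerZl mulN1r. Qed.

Lemma innerBl u v w : inner (u - v) w = inner u w - inner v w.
Proof. by rewrite innerDl innerNl. Qed.

Lemma innerDr u v w : inner w (u + v) = inner w u + inner w v.
Proof. by rewrite (innerC (u + v)) (innerC u) (innerC v) innerDl rmorphD. Qed.

Lemma innerZr k u w : inner w (k *: u) = conjc k * inner w u.
Proof. by rewrite (innerC (k *: u)) (innerC u) innerZl rmorphM. Qed.

Lemma innerNr u w : inner w (- u) = - inner w u.
Proof. by rewrite (innerC (- u)) (innerC u) innerNl rmorphN. Qed.

Lemma innerBr u v w : inner w (u - v) = inner w u - inner w v.
Proof. by rewrite innerDr innerNr. Qed.

Lemma inner0r w : inner w 0 = 0.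
Proof. by rewrite innerC inner0l conjc0. Qed.

Lemma inner_suml I (r : seq I) (P : pred I) (F : I -> H) w :
  inner (\sum_(i <- r | P i) F i) w = \sum_(i <- r | P i) inner (F i) w.
Proof. exact: (big_morph (fun u => inner u w) (fun u v => innerDl u v w) (inner0l w)). Qed.

Lemma inner_sumr I (r : seq I) (P : pred I) (F : I -> H) w :
  inner w (\sum_(i <- r | P i) F i) = \sum_(i <- r | P i) inner w (F i).
Proof. exact: (big_morph (inner w) (fun u v => innerDr u v w) (inner0r w)). Qed.

Lemma sqn_pi f : sqn (\pi_(L2 mu) f) = \int[mu]_x sqnorm (sval f x).
Proof.
rewrite /sqn inner_pi /=; congr (fine _); apply: eq_integral => x _.
by rewrite mulcJ.
Qed.

Lemma sqn_ge0 u : 0 <= sqn u.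
Proof. by elim/quotW: u => f; rewrite sqn_pi; apply: Rintegral_ge0 => x _; exact: sqnorm_ge0. Qed.

Lemma inner_sqn u : inner u u = (sqn u)%:C.
Proof.
have := innerC u u; rewrite /sqn; case: (inner u u) => a b /(congr1 (@complex.Im R)) /= h.
by apply: cx_eqP => //=; lra.
Qed.

Lemma hnorm_ge0 u : 0 <= hnorm u.
Proof. exact: sqrtr_ge0. Qed.

Lemma hnorm2 u : hnorm u ^+ 2 = sqn u.
Proof. by rewrite sqr_sqrtr// sqn_ge0. Qed.

Lemma hnorm_leP u (e : R) : 0 <= e -> (hnorm u <= e) = (sqn u <= e ^+ 2).
Proof. by move=> e0; rewrite -hnorm2 ler_sqr ?nnegrE// hnorm_ge0. Qed.

Lemma sqnZ k u : sqn (k *: u) = sqnorm k * sqn u.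
Proof.
rewrite {1}/sqn innerZl innerZr mulrA mulcJ inner_sqn.
by rewrite -rmorphM.
Qed.

Lemma hnormZ k u : hnorm (k *: u) = Num.sqrt (sqnorm k) * hnorm u.
Proof. by rewrite /hnorm -!/(sqn _) sqnZ sqrtrM ?sqnorm_ge0. Qed.

Lemma hnormN u : hnorm (- u) = hnorm u.
Proof. by rewrite -scaleN1r hnormZ sqnormN sqnorm1 sqrtr1 mul1r. Qed.

Lemma hnormBC u v : hnorm (u - v) = hnorm (v - u).
Proof. by rewrite -hnormN opprB. Qed.

Lemma hnorm0 : hnorm (0 : H) = 0.
Proof. by rewrite /hnorm inner0l /= sqrtr0. Qed.

(** A non-negative function of zero integral vanishes almost everywhere, and [L2] is the quotient by
    null functions. *)
Lemma hnorm_eq0 u : hnorm u = 0 -> u = 0.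
Proof.
move=> /(congr1 (fun x => x ^+ 2)); rewrite hnorm2 expr0n /=.
elim/quotW: u => f; rewrite sqn_pi => h.
rewrite (_ : 0 = \pi_(L2 mu) (0 : sqfun mu)); last by rewrite !piE.
apply/L2_eqP.
have [mf foo] := sqfunP f.
have i0 : (\int[mu]_x `|(sqnorm (sval f x))%:E| = 0)%E.
  under eq_integral do rewrite gee0_abs ?lee_fin ?sqnorm_ge0//.
  rewrite -[LHS]fineK; first by rewrite -/(Rintegral _ _ _) h.
  apply/fin_numPlt/andP; split=> //; apply: lt_le_trans (ltNye_eq 0 ) _ => //.
  by apply: integral_ge0 => x _; rewrite lee_fin sqnorm_ge0.
have /ae_eq_integral_abs : measurable_fun setT (fun x => (sqnorm (sval f x))%:E).
  by apply/measurable_EFinP; exact: measurable_sqnorm.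
move=> /(_ mu measurableT)[/(_ i0) h0 _].
by apply: filterS h0 => x /(_ I)[] /sqnorm_eq0.
Qed.

(** The squared norm of |v|^2 u - <u,v> v equals |v|^2 times the defect of the inequality. *)
Lemma cauchy_schwarz u v : sqnorm (inner u v) <= sqn u * sqn v.
Proof.
have [v0|v0] := eqVneq (sqn v) 0.
  have -> : v = 0 by apply: hnorm_eq0; rewrite /hnorm -/(sqn v) v0 sqrtr0.
  by rewrite inner0r sqnorm0 mulr_ge0 ?sqn_ge0.
have vp : 0 < sqn v by rewrite lt_def v0 sqn_ge0.
have := sqn_ge0 ((sqn v)%:C *: u - inner u v *: v).
set c := inner u v.
have -> : sqn ((sqn v)%:C *: u - c *: v) = sqn v * (sqn u * sqn v - sqnorm c).
  rewrite {1}/sqn !(innerBl, innerBr, innerZl, innerZr) (innerC u v) -/c.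
  rewrite !inner_sqn; case: c => a b; rewrite /sqnorm /=; ring.
by rewrite pmulr_rge0// subr_ge0.
Qed.

Lemma sqrt_inner_le u v : Num.sqrt (sqnorm (inner u v)) <= hnorm u * hnorm v.
Proof.
rewrite -[leRHS]ger0_norm ?mulr_ge0 ?hnorm_ge0// -sqrtr_sqr ler_wsqrtr//.
by rewrite exprMn !hnorm2 cauchy_schwarz.
Qed.

Lemma hnormD u v : hnorm (u + v) <= hnorm u + hnorm v.
Proof.
rewrite hnorm_leP ?addr_ge0 ?hnorm_ge0//.
rewrite {1}/sqn innerDl !innerDr (innerC u v) !inner_sqn.
have := sqrt_inner_le u v.
have : complex.Re (inner u v) <= Num.sqrt (sqnorm (inner u v)).
  apply: le_trans (ler_norm _) _; rewrite -sqrtr_sqr ler_wsqrtr//.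
  by rewrite /sqnorm lerDl sqr_ge0.
rewrite sqrrD !hnorm2; case: (inner u v) => a b /=; lra.
Qed.

Lemma hnormB_tri w u v : hnorm (u - v) <= hnorm (u - w) + hnorm (w - v).
Proof. by rewrite -[u - v](subrKA w) hnormD. Qed.

Lemma hnorm_sum I (r : seq I) (P : pred I) (F : I -> H) :
  hnorm (\sum_(i <- r | P i) F i) <= \sum_(i <- r | P i) hnorm (F i).
Proof.
elim/big_ind2: _ => [|x u y v xu yv|//]; first by rewrite hnorm0.
by apply: le_trans (hnormD _ _) _; rewrite lerD.
Qed.

(** The form in which equalities of vectors are obtained by approximation: the error is an arbitrary
    e times a constant fixed in advance. *)
Lemma hnorm_small u (M : R) : (forall e, 0 < e -> hnorm u <= e * M) -> u = 0.
Proof.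
move=> h; apply: hnorm_eq0; apply/eqP; rewrite eq_le hnorm_ge0 andbT.
have M0 : 0 <= M by have := h 1 ltr01; rewrite mul1r; exact: le_trans (hnorm_ge0 _).
apply/ler_addgt0Pr => e e0; rewrite add0r.
(* [M + 1] is positive even when [M] is 0. *)
have := h (e / (M + 1)) (divr_gt0 e0 (ltr_wpDl M0 ltr01)).
move=> /le_trans; apply; rewrite mulrAC ler_pdivrMr ?ltr_wpDl//.
by rewrite ler_pM2l// lerDl.
Qed.

Lemma sqnD_orth u v : inner u v = 0 -> sqn (u + v) = sqn u + sqn v.
Proof.
move=> uv; rewrite {1}/sqn innerDl !innerDr (innerC u v) uv conjc0 addr0 add0r.
by rewrite !inner_sqn.
Qed.

Lemma sqnB u v : sqn (u - v) = sqn u + sqn v - 2 * complex.Re (inner u v).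
Proof.
rewrite {1}/sqn innerBl !innerBr (innerC u v) !inner_sqn.
by case: (inner u v) => a b /=; ring.
Qed.

End inner_product.

(** * Completeness of L2 *)

Lemma expN2_small (R : realType) (c e : R) : 0 < e -> exists k, c / 2 ^+ k < e.
Proof.
move=> e0; have [n hn] : exists n : nat, c / e < n%:R.
  by exists (Num.truncn `|c / e|).+1; apply: le_lt_trans (ler_norm _) (truncnS_gt _).
exists n; rewrite ltr_pdivrMr ?exprn_gt0// mulrC -ltr_pdivrMr//.
apply: lt_trans hn _; rewrite -natrX ltr_nat; exact: ltn_expl.
Qed.

Lemma cauchy_real (R : realType) (r : nat -> R) :
  (forall e, 0 < e -> exists k, forall m, (k <= m)%N -> `|r k - r m| < e) ->
  cvgn r.
Proof.
move=> h; apply: cauchy_cvg; apply/cauchy_exP => e /h[k hk].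
by exists (r k); exists k => // m /= /hk; rewrite /ball /=.
Qed.

Section completeness.
Context d (X : measurableType d) (R : realType) (mu : {measure set X -> \bar R}).
Local Notation H := (L2 mu).

(* The weights [2 ^ k] let Cauchy-Schwarz bound [|f_m - f_k|^2] pointwise by
   [2 * 2 ^ - k * h] with [h] integrable, so that no domination is needed. *)
Lemma telescope_sqnorm (a : nat -> Cx R) k n :
  sqnorm (a (k + n)%N - a k) <=
  2 / 2 ^+ k * \sum_(k <= j < k + n) 2 ^+ j * sqnorm (a j.+1 - a j).
Proof.
elim: n k => [|n IHn] k; first by rewrite addn0 subrr sqnorm0 big_geq// mulr0.
have /le_trans : sqnorm (a (k + n.+1)%N - a k) <=
   2 * sqnorm (a (k.+1 + n)%N - a k.+1) + 2 * sqnorm (a k.+1 - a k).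
  by rewrite -addSnnS -[_ - a k](subrKA (a k.+1)) sqnormD_le.
apply; rewrite big_ltn; last by rewrite addnS ltnS leq_addr.
have /(ler_wpM2l (ler0n R 2)) := IHn k.+1.
rewrite addSnnS exprS => h.
rewrite [leRHS]mulrDr [leRHS]addrC lerD//.
  apply: le_trans h _; rewrite le_eqVlt; apply/orP; left; apply/eqP.
  by field; rewrite expf_neq0.
by rewrite mulrA divfK ?expf_neq0.
Qed.

(** Let h be the sum of 2^j |f_{j+1} - f_j|^2. Its integral is at most the sum of the 2^-j, that is
    2, so h is finite almost everywhere. Where it is finite, f_k converges to some F with |F -
    f_k|^2 at most 2 h / 2^k, and integrating gives the bound 4 / 2^k. *)
Lemma L2_rapid_cvg (u : nat -> H) :
  (forall k, sqn (u k.+1 - u k) <= (4 ^+ k)^-1) ->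
  exists v, forall k, sqn (u k - v) <= 4 / 2 ^+ k.
Proof.
move=> hu; pose s k := repr (u k); pose f k := sval (s k).
have us k : u k = \pi_H (s k) by rewrite reprK.
have mf k : cmeasurable (f k) by have [] := sqfunP (s k).
pose g j x := sqnorm (f j.+1 x - f j x).
have subE j k x : f j x - f k x = sval (s j - s k : sqfun mu) x by [].
have mg j : measurable_fun setT (g j).
  by have [/measurable_sqnorm + _] := sqfunP (s j.+1 - s j).
have ig j : (\int[mu]_x (2 ^+ j * g j x)%:E <= ((2 ^+ j)^-1)%:E)%E.
  under eq_integral do rewrite EFinM.
  rewrite ge0_integralZl//; first last.
  - by move=> x _; rewrite lee_fin sqnorm_ge0.
  - exact/measurable_EFinP.
  have : (\int[mu]_x (g j x)%:E = (sqn (u j.+1 - u j))%:E)%E.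
    rewrite !us (_ : \pi_H (s j.+1) - _ = \pi_H (s j.+1 - s j)); last by rewrite !piE.
    rewrite sqn_pi /Rintegral fineK//; have [_] := sqfunP (s j.+1 - s j).
    by move=> h; rewrite ge0_fin_numE//; apply: integral_ge0 => x _; rewrite lee_fin sqnorm_ge0.
  move=> ->; rewrite -EFinM lee_fin; have := hu j; rewrite -(ler_pM2l (exprn_gt0 j (ltr0n R 2))).
  move=> /le_trans; apply; rewrite (_ : 4 ^+ j = 2 ^+ j * 2 ^+ j :> R); last by rewrite -exprMn -natrM.
  by rewrite invfM mulrA divff ?mul1r ?expf_neq0.
pose h x := (\sum_(j <oo) (2 ^+ j * g j x)%:E)%E.
have h0 x : (0 <= h x)%E.
  by apply: nneseries_ge0 => j _ _; rewrite lee_fin mulr_ge0 ?sqnorm_ge0// exprn_ge0.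
have mtg j : measurable_fun setT (fun x => (2 ^+ j * g j x)%:E).
  by apply/measurable_EFinP; apply: measurable_funM.
have mh : measurable_fun setT h.
  apply: ge0_emeasurable_sum => // k x _ _; rewrite lee_fin mulr_ge0 ?sqnorm_ge0//.
have ih : (\int[mu]_x h x <= 2%:E)%E.
  rewrite integral_nneseries//; last first.
    by move=> n x _; rewrite lee_fin mulr_ge0 ?sqnorm_ge0// exprn_ge0.
  apply: lime_le.
    apply: is_cvg_nneseries => n _ _; apply: integral_ge0 => x _.
    by rewrite lee_fin mulr_ge0 ?sqnorm_ge0// exprn_ge0.
  apply: nearW => n; apply: le_trans (lee_sum _ (fun i _ => ig i)) _.
  rewrite sumEFin lee_fin big_mkord.
  suff -> : \sum_(i < n) (2 ^+ i)^-1 = 2 - 2 / 2 ^+ n :> R.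
    by rewrite gerBl divr_ge0// exprn_ge0.
  elim: n => [|n IHn]; first by rewrite big_ord0 expr0 divr1 subrr.
  by rewrite big_ord_recr /= IHn exprS; field; rewrite expf_neq0.
(* The complement of [E] is null because [h] is integrable; the limit is set to 0 there. *)
pose E := [set x | h x \is a fin_num].
have mE : measurable E.
  by have := emeasurable_fin_num measurableT mh; rewrite setTI.
have hE : {ae mu, forall x, E x}.
  have ihh : mu.-integrable setT h.
    apply/integrableP; split => //; under eq_integral do rewrite gee0_abs//.
    by apply: le_lt_trans ih _; rewrite ltry.
  by apply: filterS (integrable_ae measurableT ihh) => x /(_ I).
have tail x k n : E x -> sqnorm (f (k + n)%N x - f k x) <= 2 / 2 ^+ k * fine (h x).
  move=> Ex; apply: le_trans (telescope_sqnorm (f ^~ x) k n) _.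
  rewrite ler_wpM2l ?divr_ge0 ?exprn_ge0// -lee_fin fineK// -sumEFin.
  apply: le_trans (@nneseries_lim_ge _ _ xpredT 0%N (k + n)%N _); last first.
    by move=> j _ _; rewrite lee_fin mulr_ge0 ?sqnorm_ge0// exprn_ge0.
  rewrite !sumEFin lee_fin [leRHS](@big_cat_nat _ _ _ k)//= ?leq_addr// lerDr.
  by apply: sumr_ge0 => j _; rewrite mulr_ge0 ?sqnorm_ge0// exprn_ge0.
have cv (p : Cx R -> R) x : (forall z w, p z - p w = p (z - w)) ->
    (forall z, p z ^+ 2 <= sqnorm z) -> E x -> cvgn (fun k => p (f k x)).
  move=> pB psq Ex; apply: cauchy_real => e e0.
  have [k hk] := expN2_small (2 * fine (h x)) (exprn_gt0 2 e0).
  exists k => m km; rewrite -(subnKC km) distrC pB -ltr_sqr ?nnegrE ?(ltW e0)//.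
  rewrite -normrX ger0_norm ?sqr_ge0//; apply: le_lt_trans (psq _) _.
  by apply: le_lt_trans (tail x k _ Ex) _; rewrite mulrAC.
have cvre x : E x -> cvgn (fun k => complex.Re (f k x)).
  by apply: cv => [[? ?] [? ?]|[? ?]] //=; rewrite /sqnorm /= lerDl sqr_ge0.
have cvim x : E x -> cvgn (fun k => complex.Im (f k x)).
  by apply: cv => [[? ?] [? ?]|[? ?]] //=; rewrite /sqnorm /= lerDr sqr_ge0.
pose F x : Cx R := if `[< E x >] then limn (fun k => complex.Re (f k x)) +i*
   limn (fun k => complex.Im (f k x)) else 0.
have mF : cmeasurable F.
  split.
  (* Multiplying by the indicator of [E] makes the sequence converge at every point. *)
  - apply: (@measurable_fun_cvg _ _ _ _ (fun k x => \1_E x * complex.Re (f k x))).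
      by move=> k; apply: measurable_funM => //; have [] := mf k.
    move=> x _; rewrite /F; case: asboolP => Ex /=.
      under eq_fun do rewrite indicE mem_set// mul1r; exact: cvre.
    by under eq_fun do rewrite indicE memNset// mul0r; exact: cvg_cst.
  - apply: (@measurable_fun_cvg _ _ _ _ (fun k x => \1_E x * complex.Im (f k x))).
      by move=> k; apply: measurable_funM => //; have [] := mf k.
    move=> x _; rewrite /F; case: asboolP => Ex /=.
      under eq_fun do rewrite indicE mem_set// mul1r; exact: cvim.
    by under eq_fun do rewrite indicE memNset// mul0r; exact: cvg_cst.
have Fk x k : E x -> sqnorm (F x - f k x) <= 2 / 2 ^+ k * fine (h x).
  move=> Ex; rewrite /F; case: asboolP => // _.
  have cD (p : nat -> R) c : cvgn p -> (fun n => (p n - c) ^+ 2) @ \oo --> (limn p - c) ^+ 2.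
    by move=> cp; rewrite expr2; under eq_fun do rewrite expr2; apply: cvgM;
      apply: cvgB => //; exact: cvg_cst.
  set l : Cx R := _ +i* _.
  have cvs : (fun n => sqnorm (f n x - f k x)) @ \oo --> sqnorm (l - f k x).
    rewrite (_ : (fun n => _) = fun n => (complex.Re (f n x) - complex.Re (f k x)) ^+ 2 +
       (complex.Im (f n x) - complex.Im (f k x)) ^+ 2); last first.
      by apply/funext => n; case: (f n x) (f k x) => [? ?] [? ?].
    rewrite (_ : sqnorm (l - f k x) = (complex.Re l - complex.Re (f k x)) ^+ 2 +
       (complex.Im l - complex.Im (f k x)) ^+ 2); last by case: (f k x).
    by apply: cvgD; apply: cD; [exact: cvre|exact: cvim].
  rewrite -(cvg_lim (@Rhausdorff R) cvs); apply: limr_le.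
    by apply/cvg_ex; eexists; exact: cvs.
  by exists k => // n /= kn; rewrite -(subnKC kn); exact: tail.
have mFB k : cmeasurable (fun x => F x - f k x).
  have := cmeasurableZB 1 mF (mf k).
  by rewrite (_ : (fun x => 1 * F x - f k x) = (fun x => F x - f k x))//;
    apply/funext => x; rewrite mul1r.
have mFk k : measurable_fun setT (fun x => (sqnorm (F x - f k x))%:E).
  by apply/measurable_EFinP; exact: measurable_sqnorm.
have iFk k : (\int[mu]_x (sqnorm (F x - f k x))%:E <= (4 / 2 ^+ k)%:E)%E.
  apply: (@le_trans _ _ (\int[mu]_x ((2 / 2 ^+ k)%:E * h x))%E).
    apply: ae_ge0_le_integral => //.
    - by move=> x _; rewrite lee_fin sqnorm_ge0.
    - by move=> x _; rewrite mule_ge0.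
    - exact: measurable_funeM.
    - by apply: filterS hE => x Ex _; rewrite -(fineK Ex) -EFinM lee_fin; exact: Fk.
  rewrite ge0_integralZl//.
  apply: le_trans (lee_wpmul2l _ ih) _; first by rewrite lee_fin divr_ge0// exprn_ge0.
  by rewrite -EFinM lee_fin mulrAC -natrM.
have FP : F \in sqintegrable mu.
  have FP0 : (fun x => F x - f 0%N x) \in sqintegrable mu.
    rewrite inE; split; first exact: mFB.
    by apply: le_lt_trans (iFk 0%N) _; rewrite ltry.
  rewrite (_ : F = (fun x => F x - f 0%N x) + f 0%N); last first.
    by apply/funext => x; rewrite -[RHS]/(F x - f 0%N x + f 0%N x) subrK.
  by rewrite rpredD//; exact: (valP (s 0%N)).
pose G : sqfun mu := exist (fun g => g \in sqintegrable mu) F FP.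
exists (\pi_H G) => k; rewrite -hnorm2 hnormBC hnorm2 us.
rewrite (_ : \pi_H G - \pi_H (s k) = \pi_H (G - s k)); last by rewrite !piE.
rewrite sqn_pi -lee_fin /Rintegral fineK; first exact: iFk.
rewrite ge0_fin_numE; first by apply: le_lt_trans (iFk k) _; rewrite ltry.
by apply: integral_ge0 => x _; rewrite lee_fin sqnorm_ge0.
Qed.

(** A Cauchy sequence has a subsequence whose squared increments are at most 4^-k, to which
    [L2_rapid_cvg] applies; the whole sequence then has the same limit. *)
Theorem L2_complete (u : nat -> H) :
  (forall e : R, 0 < e -> exists N, forall n, (N <= n)%N -> hnorm (u n - u N) <= e) ->
  exists v, forall e : R, 0 < e -> exists N, forall n, (N <= n)%N -> hnorm (u n - v) <= e.
Proof.
move=> cu.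
have pos k : (0 : R) < (2 ^+ k)^-1 by rewrite invr_gt0 exprn_gt0.
have /choice[N hN] : forall k, exists N, forall m n, (N <= m)%N -> (N <= n)%N ->
    hnorm (u n - u m) <= (2 ^+ k)^-1.
  move=> k; have [N hN] := cu _ (pos k.+1); exists N => m n Nm Nn.
  apply: le_trans (hnormB_tri (u N) _ _) _.
  rewrite (splitr (2 ^+ k)^-1) lerD// -invfM -exprSr ?hN// hnormBC hN//.
(* The maximum of the first thresholds makes the indices of the subsequence monotone. *)
pose M k := \max_(i < k.+1) N i.
have NM k : (N k <= M k)%N by apply: (leq_bigmax (ord_max : 'I_k.+1)).
have MM k : (M k <= M k.+1)%N by rewrite /M [in leqRHS]big_ord_recr/= leq_maxl.
have [|v hv] := @L2_rapid_cvg (fun k => u (M k)).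
  move=> k; rewrite -hnorm2; apply: le_trans (_ : ((2 ^+ k)^-1) ^+ 2 <= _).
    rewrite ler_sqr ?nnegrE ?hnorm_ge0 ?(ltW (pos _))//; apply: hN => //.
    exact: leq_trans (NM k) (MM k).
  by rewrite exprVn -exprM mulnC exprM -natrX.
exists v => e e0.
(* Asking that 4 / 2^m be at most (e / 2)^2 amounts to 16 / 2^m <= e^2. *)
have [k hk] := expN2_small 16 (exprn_gt0 2 e0).
have [j hj] := expN2_small 2 e0.
pose m := maxn k j.
exists (N m) => n Nn; apply: le_trans (hnormB_tri (u (M m)) _ _) _.
rewrite (splitr e) lerD//.
- apply: le_trans (hN m _ _ (NM m) Nn) _.
  rewrite ler_pdivlMr// mulrC; apply: le_trans (ltW hj).
  by rewrite ler_pM2l// lef_pV2 ?posrE ?exprn_gt0// ler_weXn2l ?ler1n// leq_maxr.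
- rewrite hnorm_leP ?divr_ge0 ?(ltW e0)//; apply: le_trans (hv m) _.
  rewrite expr_div_n ler_pdivlMr ?exprn_gt0// mulrAC.
  rewrite (_ : 4 * 2 ^+ 2 = 16 :> R); last by rewrite -natrX -natrM.
  apply: le_trans (ltW hk); rewrite ler_pM2l ?ltr0n//.
  by rewrite lef_pV2 ?posrE ?exprn_gt0// ler_weXn2l ?ler1n// leq_maxl.
Qed.

End completeness.

(** * Linear subspaces and spans *)

Section linear_subspaces.
Context (R : realType) (V : lmodType (Cx R)).
Implicit Types S B : set V.

Lemma lin_subspaceD S u v : lin_subspace S -> S u -> S v -> S (u + v).
Proof. by move=> [_ SL] Su Sv; rewrite -[u]scale1r; exact: SL. Qed.

Lemma lin_subspaceZ S (k : Cx R) u : lin_subspace S -> S u -> S (k *: u).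
Proof. by move=> [S0 SL] Su; rewrite -[_ *: _]addr0; exact: SL. Qed.

Lemma lin_subspaceB S u v : lin_subspace S -> S u -> S v -> S (u - v).
Proof.
move=> SL Su Sv; apply: lin_subspaceD => //; rewrite -scaleN1r; exact: lin_subspaceZ.
Qed.

Lemma lin_subspace_sum S I (r : seq I) (F : I -> V) :
  lin_subspace S -> (forall i, S (F i)) -> S (\sum_(i <- r) F i).
Proof.
move=> SL SF; elim/big_ind: _ => [|u v|i _]; [by case: SL| |exact: SF].
exact: lin_subspaceD.
Qed.

Lemma sub_lin_span S : S `<=` lin_span S.
Proof. by move=> a Sa B [_ SB]; exact: SB. Qed.

Lemma lin_span_subspace S : lin_subspace (lin_span S).
Proof.
split=> [B [[B0 _] _]//|k u v Su Sv B [[B0 BL] SB]].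
have BB : lin_subspace B /\ S `<=` B by [].
by apply: BL; [exact: Su BB|exact: Sv BB].
Qed.

Lemma lin_span_min S B : lin_subspace B -> S `<=` B -> lin_span S `<=` B.
Proof. by move=> BL SB u Su; exact: (Su B (conj BL SB)). Qed.

End linear_subspaces.

(** * Bounded operators, adjoints, C*-algebras and the Neumann series *)

Section operator_theory.
Context d (X : measurableType d) (R : realType) (mu : {measure set X -> \bar R}).
Local Notation H := (L2 mu).
Local Notation op := (H -> H).
Implicit Types (a b c T P : op) (A B D S : set op) (u v w : H) (k : Cx R).

(** Turns identities between vectors into identities between scalars, which [ring] can settle. *)
Lemma inner_ext u v : (forall w, inner u w = inner v w) -> u = v.
Proof.
move=> h; apply/eqP; rewrite -subr_eq0; apply/eqP/hnorm_eq0.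
by rewrite /hnorm innerBl h subrr /= sqrtr0.
Qed.

Lemma linear_opD a u v : linear a -> a (u + v) = a u + a v.
Proof. by move=> la; have := la 1 u v; rewrite !scale1r. Qed.

Lemma linear_op0 a : linear a -> a 0 = 0.
Proof.
move=> la; have /eqP := linear_opD 0 0 la.
by rewrite addr0 -subr_eq0 opprD addNKr oppr_eq0 => /eqP.
Qed.

Lemma linear_opZ a k u : linear a -> a (k *: u) = k *: a u.
Proof. by move=> la; have := la k u 0; rewrite !addr0 linear_op0// addr0. Qed.

Lemma linear_opB a u v : linear a -> a (u - v) = a u - a v.
Proof. by move=> la; rewrite linear_opD// -scaleN1r linear_opZ// scaleN1r. Qed.

Lemma linear_op_sum a I (r : seq I) (F : I -> H) : linear a ->
  a (\sum_(i <- r) F i) = \sum_(i <- r) a (F i).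
Proof.
by move=> la; apply: (big_morph a) => [u v|]; [exact: linear_opD|exact: linear_op0].
Qed.

(** A strictly positive bound, so that tolerances can be divided by it. *)
Lemma bounded_opP a : bounded_op a ->
  exists2 M : R, 0 < M & forall u, hnorm (a u) <= M * hnorm u.
Proof.
move=> [_ [M aM]]; exists (Num.max 1 M); first by rewrite lt_max ltr01.
by move=> u; apply: le_trans (aM u) _; rewrite ler_wpM2r ?hnorm_ge0// le_max lexx orbT.
Qed.

Lemma opnorm_le a (e : R) : 0 <= e -> (forall u, hnorm (a u) <= e * hnorm u) ->
  (opnorm a <= e%:E)%E.
Proof.
move=> e0 ae; apply: ge_ereal_sup => _ [u /= u1 <-]; rewrite lee_fin.
by apply: le_trans (ae u) _; rewrite ler_piMr.
Qed.

Lemma le_opnorm a (e : R) : linear a -> (opnorm a <= e%:E)%E ->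
  forall u, hnorm (a u) <= e * hnorm u.
Proof.
move=> la ae u; have [u0|u0] := eqVneq (hnorm u) 0.
  by rewrite (hnorm_eq0 u0) linear_op0// hnorm0 mulr0.
have up : 0 < hnorm u by rewrite lt_def u0 hnorm_ge0.
pose k : Cx R := ((hnorm u)^-1)%:C.
have hk v : hnorm (k *: v) = (hnorm u)^-1 * hnorm v.
  by rewrite hnormZ sqnorm_real sqrtr_sqr ger0_norm ?invr_ge0 ?ltW.
suff : hnorm (a (k *: u)) <= e.
  by rewrite linear_opZ// hk mulrC ler_pdivrMr.
rewrite -lee_fin; apply: le_trans ae; apply: ereal_sup_ubound.
by exists (k *: u) => //=; rewrite hk mulVf.
Qed.

Lemma bounded_op_lin k a b : bounded_op a -> bounded_op b -> bounded_op (k *: a + b).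
Proof.
move=> ba bb; have [la _] := ba; have [lb _] := bb; split.
  move=> c u v; rewrite -![(k *: a + b) _]/(k *: a _ + b _).
  rewrite la lb; apply: inner_ext => w; rewrite !(innerDl, innerZl); ring.
have [M M0 aM] := bounded_opP ba; have [N N0 bN] := bounded_opP bb.
exists (Num.sqrt (sqnorm k) * M + N) => u.
apply: le_trans (hnormD _ _) _; rewrite mulrDl lerD//.
by rewrite -[(k *: a) u]/(k *: a u) hnormZ -mulrA ler_wpM2l ?sqrtr_ge0.
Qed.

Lemma bounded_op0 : bounded_op (0 : op).
Proof.
split=> [k u v|]; first by rewrite -![(0 : op) _]/(0 : H) scaler0 addr0.
by exists 0 => u; rewrite mul0r -[(0 : op) u]/(0 : H) hnorm0.
Qed.

Lemma bounded_op_id : bounded_op (idfun : op).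
Proof. by split => //; exists 1 => u; rewrite mul1r. Qed.

Lemma bounded_op_subspace : lin_subspace (@bounded_op _ _ _ mu).
Proof. by split=> [|k a b]; [exact: bounded_op0|exact: bounded_op_lin]. Qed.

Lemma bounded_op_comp a b : bounded_op a -> bounded_op b -> bounded_op (a \o b).
Proof.
move=> ba bb; have [la _] := ba; have [lb _] := bb; split.
  by move=> c u v /=; rewrite lb la.
have [M M0 aM] := bounded_opP ba; have [N N0 bN] := bounded_opP bb.
exists (M * N) => u /=; apply: le_trans (aM _) _.
by rewrite -mulrA ler_wpM2l// ltW.
Qed.

Lemma bounded_opB a b : bounded_op a -> bounded_op b -> bounded_op (a - b).
Proof. exact: (lin_subspaceB bounded_op_subspace). Qed.

(** Together with [approx_op_closure], it trades the extended-real operator norm for estimates at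
    each vector. *)
Lemma op_closure_approx S a (e : R) : S `<=` @bounded_op _ _ _ mu -> op_closure S a ->
  0 < e -> exists2 b, S b & forall u, hnorm (a u - b u) <= e * hnorm u.
Proof.
move=> SB [ba aS] e0; have [b Sb abe] := aS _ e0; exists b => //.
have [l _] : bounded_op (a - b).
  exact: (bounded_opB ba (SB _ Sb)).
exact: (le_opnorm l (ltW abe)).
Qed.

Lemma approx_op_closure S a : bounded_op a ->
  (forall e : R, 0 < e -> exists2 b, S b & forall u, hnorm (a u - b u) <= e * hnorm u) ->
  op_closure S a.
Proof.
move=> ba h; split=> // e e0; have [b Sb hb] := h (e / 2) (divr_gt0 e0 (ltr0Sn _ 1)).
exists b => //; apply: (@le_lt_trans _ _ (e / 2)%:E).
  by apply: opnorm_le => //; rewrite divr_ge0 ?ltW.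
by rewrite lte_fin gtr_pMr// invf_lt1// ltr1n.
Qed.

Lemma sub_op_closure S : S `<=` @bounded_op _ _ _ mu -> S `<=` op_closure S.
Proof.
move=> SB a Sa; apply: approx_op_closure => [|e e0]; first exact: SB.
by exists a => // u; rewrite subrr hnorm0 mulr_ge0 ?hnorm_ge0 ?ltW.
Qed.

Lemma op_closureS S S' : S `<=` S' -> op_closure S `<=` op_closure S'.
Proof.
by move=> SS a [ba h]; split=> // e /h[b /SS Sb abe]; exists b.
Qed.

Lemma op_closure_bounded S : op_closure S `<=` @bounded_op _ _ _ mu.
Proof. by move=> a []. Qed.

Lemma op_closure_idem S : S `<=` @bounded_op _ _ _ mu ->
  op_closure (op_closure S) `<=` op_closure S.
Proof.
move=> SB a aS; apply: approx_op_closure => [|e e0]; first by case: aS.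
have e2 : 0 < e / 2 by rewrite divr_gt0.
have [b bS ab] := op_closure_approx (@op_closure_bounded S) aS e2.
have [c Sc bc] := op_closure_approx SB bS e2.
exists c => // u; apply: le_trans (hnormB_tri (b u) _ _) _.
by rewrite (splitr e) mulrDl lerD.
Qed.

Lemma op_closure_subspace S : S `<=` @bounded_op _ _ _ mu -> lin_subspace S ->
  lin_subspace (op_closure S).
Proof.
move=> SB [S0 SL]; split; first by apply: sub_op_closure.
move=> k a b aS bS; apply: approx_op_closure => [|e e0].
  by apply: bounded_op_lin; [case: aS|case: bS].
pose s := Num.sqrt (sqnorm k) + 1.
have s0 : 0 < s by rewrite ltr_wpDl ?sqrtr_ge0.
have e2 : 0 < e / 2 by rewrite divr_gt0.
have [a' Sa aa'] := op_closure_approx SB aS (divr_gt0 e2 s0).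
have [b' Sb bb'] := op_closure_approx SB bS e2.
exists (k *: a' + b'); first exact: SL.
move=> u; rewrite -[(k *: a + b) u]/(k *: a u + b u).
rewrite -[(k *: a' + b') u]/(k *: a' u + b' u).
rewrite opprD addrACA -scalerBr; apply: le_trans (hnormD _ _) _.
rewrite (splitr e) mulrDl lerD// hnormZ.
apply: (@le_trans _ _ (s * hnorm (a u - a' u))).
  by rewrite ler_wpM2r ?hnorm_ge0// lerDl.
by rewrite -ler_pdivlMl// mulrA [s^-1 * _]mulrC.
Qed.

Lemma op_closure_comp S : S `<=` @bounded_op _ _ _ mu ->
  (forall a b, S a -> S b -> S (a \o b)) ->
  forall a b, op_closure S a -> op_closure S b -> op_closure S (a \o b).
Proof.
move=> SB SM a b aS bS; have ba : bounded_op a by case: aS.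
have bb : bounded_op b by case: bS.
apply: approx_op_closure => [|e e0]; first exact: bounded_op_comp.
have e2 : 0 < e / 2 by rewrite divr_gt0.
have [M M0 aM] := bounded_opP ba.
have [b' Sb bb'] := op_closure_approx SB bS (divr_gt0 e2 M0).
(* As a b - a' b' = a (b - b') + (a - a') b', the tolerance for [a'] depends on the bound of [b'],
   which is chosen first. *)
have [N N0 bN] := bounded_opP (SB _ Sb).
have [a' Sa aa'] := op_closure_approx SB aS (divr_gt0 e2 N0).
exists (a' \o b'); first exact: SM.
move=> u /=; apply: le_trans (hnormB_tri (a (b' u)) _ _) _.
rewrite (splitr e) mulrDl lerD//.
- have [la _] := ba; rewrite -(linear_opB _ _ la); apply: le_trans (aM _) _.
  by rewrite -ler_pdivlMl// mulrA [M^-1 * _]mulrC.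
- apply: le_trans (aa' _) _; rewrite -ler_pdivlMl ?divr_gt0//.
  rewrite [leRHS](_ : _ = N * hnorm u); first exact: bN.
  by field; rewrite !gt_eqF.
Qed.

Lemma adjointC a b : is_adjoint a b -> is_adjoint b a.
Proof. by move=> ab u v; rewrite innerC -ab -innerC. Qed.

Lemma adjoint_lin k a b a' b' : is_adjoint a a' -> is_adjoint b b' ->
  is_adjoint (k *: a + b) (conjc k *: a' + b').
Proof.
move=> aa bb u v; rewrite -[(k *: a + b) u]/(k *: a u + b u).
rewrite -[(conjc k *: a' + b') v]/(conjc k *: a' v + b' v).
by rewrite innerDl innerDr innerZl innerZr conjcK aa bb.
Qed.

Lemma adjoint_comp a b a' b' : is_adjoint a a' -> is_adjoint b b' ->
  is_adjoint (a \o b) (b' \o a').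
Proof. by move=> aa bb u v /=; rewrite aa bb. Qed.

Lemma adjoint0 : is_adjoint (0 : op) 0.
Proof. by move=> u v; rewrite -![(0 : op) _]/(0 : H) inner0l inner0r. Qed.

(** By Cauchy-Schwarz, |a' u|^2 = <a a' u, u> is at most M |a' u| |u|. *)
Lemma adjoint_bound a a' (M : R) : 0 <= M -> is_adjoint a a' ->
  (forall u, hnorm (a u) <= M * hnorm u) -> forall u, hnorm (a' u) <= M * hnorm u.
Proof.
move=> M0 aa aM u; have [->|w0] := eqVneq (hnorm (a' u)) 0.
  by rewrite mulr_ge0 ?hnorm_ge0.
have wp : 0 < hnorm (a' u) by rewrite lt_def w0 hnorm_ge0.
rewrite -(ler_pM2l wp) -expr2.
have := sqrt_inner_le (a (a' u)) u; rewrite aa inner_sqn sqnorm_real sqrtr_sqr.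
rewrite ger0_norm ?sqn_ge0// -hnorm2 => /le_trans; apply.
by rewrite mulrCA mulrA ler_wpM2r ?hnorm_ge0// mulrC mulrC aM.
Qed.

(** [cstar_subalgebra] keeps an adjoint once one is given; here every element must come with one.
    Adjoints are exhibited explicitly throughout. *)
Definition star_alg D :=
  [/\ D `<=` @bounded_op _ _ _ mu, lin_subspace D,
      forall a b, D a -> D b -> D (a \o b) &
      forall a, D a -> exists2 a', D a' & is_adjoint a a'].

(** If [c] in [D] is close to [a], its adjoint [c'] is equally close to the adjoint of [a], by
    [adjoint_bound] applied to the difference. *)
Lemma star_alg_closure D : star_alg D -> cstar_subalgebra (op_closure D).
Proof.
move=> [DB DL DM DJ]; split.
- exact: op_closure_bounded.
- exact: op_closure_subspace.
- exact: op_closure_comp.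
- move=> a b aD bb ab; apply: approx_op_closure => // e e0.
  have [c Dc ac] := op_closure_approx DB aD e0; have [c' Dc' cc'] := DJ _ Dc.
  exists c' => //; apply: (@adjoint_bound (a - c) (b - c')) => //; first exact: ltW.
  move=> u v; rewrite -[(a - c) u]/(a u - c u) -[(b - c') v]/(b v - c' v).
  by rewrite innerBl innerBr ab cc'.
- exact: op_closure_idem.
Qed.

(** Isolates the elements whose adjoint is at hand, to which [polarization] applies. *)
Lemma cstar_adjointable A : cstar_subalgebra A ->
  star_alg [set a | A a /\ exists2 a', A a' & is_adjoint a a'].
Proof.
move=> [AB AL AM AJ AC]; split.
- by move=> a [/AB].
- split; first by split; [case: AL|exists 0; [case: AL|exact: adjoint0]].
  move=> k a b [Aa [a' Aa' aa]] [Ab [b' Ab' bb]]; split; first by case: AL => _; apply.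
  by exists (conjc k *: a' + b'); [case: AL => _; apply|exact: adjoint_lin].
- move=> a b [Aa [a' Aa' aa]] [Ab [b' Ab' bb]]; split; first exact: AM.
  by exists (b' \o a'); [exact: AM|exact: adjoint_comp].
- by move=> a [Aa [a' Aa' aa]]; exists a' => //; split=> //; exists a => //; exact: adjointC.
Qed.

Lemma bounded_cstar : cstar_subalgebra (@bounded_op _ _ _ mu).
Proof.
split => //; [exact: bounded_op_subspace|exact: bounded_op_comp|exact: op_closure_bounded].
Qed.

(** As [S] is bounded, the algebra of all bounded operators is among those intersected, which keeps
    the intersection bounded. *)
Lemma cstar_generated_cstar S : S `<=` @bounded_op _ _ _ mu ->
  cstar_subalgebra (cstar_generated S).
Proof.
move=> SB; split.
- by move=> a /(_ _ (conj bounded_cstar SB)).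
- split=> [B [[_ [B0 _] _ _ _]] //|k a b aS bS B CB].
  by have [[_ [_ BL] _ _ _] _] := CB; apply: BL; [exact: aS|exact: bS].
- move=> a b aS bS B CB; have [[_ _ BM _ _] _] := CB.
  by apply: BM; [exact: aS|exact: bS].
- move=> a b aS bb ab B CB; have [[_ _ _ BJ _] _] := CB.
  by apply: (BJ a) => //; exact: aS.
- move=> a aS B CB; have [[_ _ _ _ BC] _] := CB; apply: BC.
  by apply: op_closureS aS => c; apply.
Qed.

Lemma sub_cstar_generated S : S `<=` cstar_generated S.
Proof. by move=> a Sa B [_ SB]; exact: SB. Qed.

Lemma cstar_generated_min S B : cstar_subalgebra B -> S `<=` B -> cstar_generated S `<=` B.
Proof. by move=> CB SB a aS; exact: (aS B (conj CB SB)). Qed.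

(* The weight [P] of the polarization identity may be any linear operator. *)
Lemma polarization D M P : star_alg D -> lin_subspace M -> linear P ->
  (forall y y', D y -> D y' -> is_adjoint y y' -> M (y' \o P \o y)) ->
  forall x y, D x -> D y -> M (x \o P \o y).
Proof.
move=> [DB DL DM DJ] ML lP h x y Dx Dy.
have [x' Dx' xx'] := DJ _ Dx; have [y' Dy' yy'] := DJ _ Dy.
pose ii : Cx R := 0 +i* 1.
(* [Q k] is z* P z for z = k x' + y. Summing k Q(k) over the fourth roots of unity k leaves 4 times
   the term in conj k, which is x P y. *)
pose Q (k : Cx R) : op := (conjc k *: x + y') \o P \o (k *: x' + y).
have MQ k : M (Q k).
  apply: h; [by case: DL => _; apply|by case: DL => _; apply|].
  by apply: adjoint_lin => //; exact: adjointC.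
have -> : x \o P \o y = 4^-1 *: ((Q 1 - Q (-1)) + ii *: (Q ii - Q (- ii))).
  apply/funext => u.
  rewrite -[RHS]/(4^-1 *: ((Q 1 u - Q (-1) u) + ii *: (Q ii u - Q (- ii) u))).
  have [lx _] := DB _ Dx; have [ly _] := DB _ Dy.
  have [lx' _] := DB _ Dx'; have [ly' _] := DB _ Dy'.
  have QE k : Q k u = k *: (conjc k *: x (P (x' u)) + y' (P (x' u))) +
     (conjc k *: x (P (y u)) + y' (P (y u))).
    rewrite -[Q k u]/(conjc k *: x (P (k *: x' u + y u)) + y' (P (k *: x' u + y u))).
    rewrite lP lx ly'; apply: inner_ext => w; rewrite !(innerDl, innerZl); ring.
  rewrite !QE; apply: inner_ext => w; rewrite !(innerDl, innerNl, innerZl).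
  set p := inner _ w; set q := inner _ w; set r := inner _ w; set s := inner _ w.
  have -> : conjc (ii : Cx R) = - ii by apply: cx_eqP => /=; rewrite ?oppr0.
  have -> : conjc (- ii : Cx R) = ii by apply: cx_eqP => /=; rewrite ?oppr0 ?opprK.
  have -> : conjc (1 : Cx R) = 1 by apply: cx_eqP => /=; rewrite ?oppr0.
  have -> : conjc (-1 : Cx R) = -1 by apply: cx_eqP => /=; rewrite ?oppr0.
  have i2 : ii * ii = -1 :> Cx R by apply: cx_eqP => /=; ring.
  clearbody ii.
  by field: i2.
apply: lin_subspaceZ => //; apply: lin_subspaceD => //.
  exact: lin_subspaceB.
by apply: lin_subspaceZ => //; exact: lin_subspaceB.
Qed.

(** Completeness gives a limit at each vector; linearity and the uniform bound pass to the limit. *)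
Lemma strong_limit (s : nat -> op) (M : R) :
  (forall n, linear (s n)) -> (forall n u, hnorm (s n u) <= M * hnorm u) ->
  (forall u (e : R), 0 < e -> exists N, forall n, (N <= n)%N -> hnorm (s n u - s N u) <= e) ->
  exists2 c, bounded_op c & forall u (e : R), 0 < e ->
    exists N, forall n, (N <= n)%N -> hnorm (s n u - c u) <= e.
Proof.
move=> ls sM cs.
have /choice[c hc] : forall u, exists v, forall e : R, 0 < e ->
    exists N, forall n, (N <= n)%N -> hnorm (s n u - v) <= e.
  by move=> u; apply: L2_complete => e e0; exact: cs.
exists c => //; split.
- move=> k u v; apply/eqP; rewrite -subr_eq0; apply/eqP.
  apply: (@hnorm_small _ _ _ _ _ (1 + (Num.sqrt (sqnorm k) + 1))) => e e0.
  have [N1 h1] := hc u e e0; have [N2 h2] := hc v e e0.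
  have [N3 h3] := hc (k *: u + v) e e0.
  pose n := maxn N1 (maxn N2 N3).
  have n1 : (N1 <= n)%N by rewrite leq_maxl.
  have n2 : (N2 <= n)%N by rewrite !leq_max leqnn !orbT.
  have n3 : (N3 <= n)%N by rewrite !leq_max leqnn !orbT.
  apply: le_trans (hnormB_tri (s n (k *: u + v)) _ _) _.
  rewrite [leRHS]mulrDr mulr1; apply: lerD; first by rewrite hnormBC; exact: h3.
  rewrite ls opprD addrACA -scalerBr; apply: le_trans (hnormD _ _) _.
  rewrite [leRHS]mulrDr mulr1; apply: lerD; last exact: h2.
  by rewrite hnormZ [leLHS]mulrC; apply: ler_wpM2r; [exact: sqrtr_ge0|exact: h1].
- exists M => u; apply/ler_addgt0Pr => e e0; have [N hN] := hc u e e0.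
  rewrite -[c u](subrK (s N u)); apply: le_trans (hnormD _ _) _.
  by rewrite [leRHS]addrC; apply: lerD; [rewrite hnormBC; exact: hN|exact: sM].
Qed.

(** In the corner with unit [P], the inverse of P - T is the geometric series of the T^n P, which
    converges in norm as [T] has norm at most 1/2. The partial sums s_n telescope: s_n (P - T) = (P
    - T) s_n = P - T^n P. *)
Lemma neumann A P T : cstar_subalgebra A -> A P -> A T ->
  P \o P = P -> P \o T = T -> T \o P = T ->
  (forall u, hnorm (T u) <= 2^-1 * hnorm u) ->
  exists c, [/\ A c, c \o (P - T) = P, (P - T) \o c = P & P \o c = c].
Proof.
move=> CA AP AT PP PT TP T2; have [AB AL AM AJ AC] := CA.
have [lP _] := AB _ AP; have [lT _] := AB _ AT.
have [M M0 PM] := bounded_opP (AB _ AP).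
have PPu u : P (P u) = P u by rewrite -[LHS]/((P \o P) u) PP.
have PTu u : P (T u) = T u by rewrite -[LHS]/((P \o T) u) PT.
have TPu u : T (P u) = T u by rewrite -[LHS]/((T \o P) u) TP.
pose t n : op := iter n (fun b => T \o b) P.
have At n : A (t n) by elim: n => [//|n IHn]; exact: AM.
have tM n u : hnorm (t n u) <= M / 2 ^+ n * hnorm u.
  elim: n u => [|n IHn] u; first by rewrite expr0 divr1.
  apply: le_trans (T2 _) _; rewrite exprS invfM mulrCA -mulrA ler_pM2l ?invr_gt0//.
pose s n : op := \sum_(i < n) t i.
have sE n u : s n u = \sum_(i < n) t i u.
  by rewrite /s; elim/big_ind2: _ => // a1 b1 a2 b2 <- <-.
have As n : A (s n) by rewrite /s; apply: lin_subspace_sum.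
have sS n : s n.+1 = s n + t n by rewrite /s big_ord_recr.
(* Keeping the exact geometric remainder lets the induction close. *)
have st m n u : hnorm (s (m + n)%N u - s m u) <= (2 * M / 2 ^+ m - 2 * M / 2 ^+ (m + n)) * hnorm u.
  elim: n => [|n IHn]; first by rewrite addn0 !subrr hnorm0 mul0r.
  rewrite addnS sS -[(s _ + t _) u]/(s (m + n)%N u + t (m + n)%N u) addrAC.
  apply: le_trans (hnormD _ _) _; apply: le_trans (lerD IHn (tM _ _)) _.
  rewrite -mulrDl ler_wpM2r ?hnorm_ge0// exprS le_eqVlt; apply/orP; left; apply/eqP.
  by field; rewrite !expf_neq0.
have stm m n u : (m <= n)%N -> hnorm (s n u - s m u) <= 2 * M / 2 ^+ m * hnorm u.
  move=> /subnKC <-; apply: le_trans (st _ _ _) _.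
  by rewrite ler_wpM2r ?hnorm_ge0// gerBl divr_ge0 ?exprn_ge0// mulr_ge0// ltW.
have [||u e e0|c bc hc] := @strong_limit s (2 * M).
- by move=> n; have [] := AB _ (As n).
- move=> n u; have := stm 0%N n u (leq0n n); rewrite expr0 divr1.
  by rewrite {2}/s big_ord0 -[(0 : op) u]/(0 : H) subr0.
- have [k hk] := expN2_small (2 * M * hnorm u) e0.
  by exists k => n kn; apply: le_trans (stm _ _ _ kn) _; rewrite mulrAC ltW.
have cs n u : hnorm (c u - s n u) <= 2 * M / 2 ^+ n * hnorm u.
  apply/ler_addgt0Pr => e e0; have [N hN] := hc u e e0.
  apply: le_trans (hnormB_tri (s (maxn N n) u) _ _) _; rewrite addrC lerD//.
    by apply: stm; rewrite leq_maxr.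
  by rewrite hnormBC; apply: hN; rewrite leq_maxl.
have [lc _] := bc.
have [lPT _] : bounded_op (P - T).
  exact: (bounded_opB (AB _ AP) (AB _ AT)).
have approx (e : R) : 0 < e -> exists n, (forall u, hnorm (c u - s n u) <= e * hnorm u) /\
    (forall u, hnorm (t n u) <= e * hnorm u).
  move=> e0; have [n hn] := expN2_small (2 * M) e0; exists n; split=> u.
    by apply: le_trans (cs n u) _; rewrite ler_wpM2r ?hnorm_ge0// ltW.
  apply: le_trans (tM n u) _; rewrite ler_wpM2r ?hnorm_ge0//.
  apply: le_trans (ltW hn); rewrite ler_wpM2r ?invr_ge0 ?exprn_ge0//.
  by rewrite ler_peMl ?ltW// ltr1n.
have small a b (K : R) : (forall e u, 0 < e -> hnorm (a u - b u) <= e * (K * hnorm u)) -> a = b.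
  move=> h; apply/funext => u; apply/eqP; rewrite -subr_eq0; apply/eqP.
  by apply: (@hnorm_small _ _ _ _ _ (K * hnorm u)) => e; exact: h.
have sPT n u : s n (P u - T u) = P u - t n u.
  elim: n => [|n IHn]; first by rewrite /s big_ord0 subrr.
  rewrite sS -[(s n + t n) _]/(s n (P u - T u) + t n (P u - T u)) IHn.
  have [lt _] := AB _ (At n); rewrite (linear_opB _ _ lt).
  have tP v : t n (P v) = t n v.
    by elim: n {IHn lt} => [|n IHn] /=; rewrite ?PPu ?IHn.
  have tT v : t n (T v) = t n.+1 v.
    by elim: n {IHn lt tP} => [|n IHn] /=; rewrite ?PTu ?TPu ?IHn.
  by rewrite tP tT addrA subrK.
have PTs n u : P (s n u) - T (s n u) = P u - t n u.
  elim: n => [|n IHn].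
    have -> : s 0%N u = 0 by rewrite /s big_ord0.
    by rewrite (linear_op0 lP) (linear_op0 lT) subr0 -[t 0%N u]/(P u) subrr.
  rewrite sS -[(s n + t n) _]/(s n u + t n u) (linear_opD _ _ lP) (linear_opD _ _ lT).
  rewrite opprD addrACA IHn.
  have -> : P (t n u) = t n u by case: n {IHn} => [|n] /=; rewrite ?PPu ?PTu.
  by rewrite addrA subrK.
have Ps n u : P (s n u) = s n u.
  rewrite sE (linear_op_sum _ _ lP); apply: eq_bigr => -[[|i] /= _] _; first exact: PPu.
  exact: PTu.
have [N N0 PTN] : exists2 N : R, 0 < N & forall u, hnorm ((P - T) u) <= N * hnorm u.
  exact: (bounded_opP (bounded_opB (AB _ AP) (AB _ AT))).
exists c; split => //.
- apply: AC; apply: approx_op_closure => // e /approx[n [hn _]].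
  by exists (s n).
- apply: (@small _ _ (N + 1)) => e u e0 /=; have [n [cn tn]] := approx e e0.
  apply: le_trans (hnormB_tri (s n ((P - T) u)) _ _) _.
  rewrite mulrDl mul1r mulrDr lerD//.
    by apply: le_trans (cn _) _; rewrite ler_pM2l.
  by rewrite -[(P - T) u]/(P u - T u) sPT addrAC subrr add0r hnormN.
- apply: (@small _ _ (N + 1)) => e u e0 /=; have [n [cn tn]] := approx e e0.
  apply: le_trans (hnormB_tri ((P - T) (s n u)) _ _) _.
  rewrite mulrDl mul1r mulrDr lerD//.
    by rewrite -(linear_opB _ _ lPT); apply: le_trans (PTN _) _; rewrite mulrCA ler_pM2l.
  by rewrite -[(P - T) _]/(P (s n u) - T (s n u)) PTs addrAC subrr add0r hnormN.
- apply: (@small _ _ (M + 1)) => e u e0 /=; have [n [cn tn]] := approx e e0.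
  apply: le_trans (hnormB_tri (s n u) _ _) _.
  rewrite mulrDl mul1r mulrDr lerD//; last by rewrite hnormBC.
  by rewrite -{1}Ps -(linear_opB _ _ lP); apply: le_trans (PM _) _; rewrite mulrCA ler_pM2l.
Qed.

End operator_theory.

(** * Classes of square integrable functions and multiplication operators *)

Section classes.
Context d (X : measurableType d) (R : realType) (mu : {measure set X -> \bar R}).
Local Notation H := (L2 mu).
Local Notation op := (H -> H).
Local Notation sqint := (sqintegrable mu).
Local Notation cls := (L2_class mu).
Implicit Types (f g h phi psi : X -> Cx R) (u v w : H) (k : Cx R).

Lemma L2_class_pi f (sf : f \in sqint) :
  cls f = \pi_H (exist (fun g => g \in sqint) f sf).
Proof. by congr (\pi_H _); apply: val_inj; rewrite /= insubdK. Qed.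

Opaque L2_class inner cint.

Lemma L2_classK u : cls (sval (repr u)) = u.
Proof. by rewrite (L2_class_pi (valP (repr u))) -[RHS]reprK; congr (\pi_H _); apply: val_inj. Qed.

Lemma L2_classP u : exists2 f : X -> Cx R, f \in sqint & u = cls f.
Proof. by exists (sval (repr u)); [exact: (valP (repr u))|rewrite L2_classK]. Qed.

Lemma L2_class_ae f g : f \in sqint -> g \in sqint ->
  {ae mu, forall x, f x = g x} -> cls f = cls g.
Proof. by move=> sf sg fg; rewrite !L2_class_pi; apply/L2_eqP. Qed.

Lemma ae_repr_class f : f \in sqint -> {ae mu, forall x, sval (repr (cls f)) x = f x}.
Proof. by move=> sf; rewrite L2_class_pi; exact: ae_repr. Qed.

Lemma sqintegrableZD k f g : f \in sqint -> g \in sqint ->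
  (fun x => k * f x + g x) \in sqint.
Proof.
move=> sf sg; have := sqintegrableZB (- k) sf sg; rewrite -rpredN => h.
rewrite (_ : (fun x => _) = - (fun x => - k * f x - g x)) //; apply/funext => x.
by rewrite -[RHS]/(- (- k * f x - g x)) opprB mulNr opprK addrC.
Qed.

Lemma L2_classZD k f g : f \in sqint -> g \in sqint ->
  cls (fun x => k * f x + g x) = k *: cls f + cls g.
Proof.
move=> sf sg; rewrite (L2_class_pi (sqintegrableZD k sf sg)) !L2_class_pi -pi_ZD.
by congr (\pi_H _); apply: val_inj.
Qed.

Lemma L2_class0 : cls (fun=> 0) = 0.
Proof.
by rewrite (L2_class_pi (sqintegrable0 mu)) (_ : 0 = \pi_H (0 : sqfun mu)) ?piE//;
  congr (\pi_H _); apply: val_inj.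
Qed.

Lemma L2_classB f g : f \in sqint -> g \in sqint ->
  cls f - cls g = cls (fun x => f x - g x).
Proof.
move=> sf sg; rewrite addrC -scaleN1r -L2_classZD//; congr cls.
by apply/funext => x; rewrite mulN1r addrC.
Qed.

Lemma sqintegrable_le f g : cmeasurable g -> (forall x, sqnorm (g x) <= sqnorm (f x)) ->
  f \in sqint -> g \in sqint.
Proof.
move=> mg gf; rewrite !inE => -[mf foo]; split=> //; apply: le_lt_trans foo.
apply: ge0_le_integral => //.
- by move=> y _; rewrite lee_fin sqnorm_ge0.
- exact/measurable_EFinP/measurable_sqnorm.
- exact/measurable_EFinP/measurable_sqnorm.
- by move=> y _; rewrite lee_fin.
Qed.

Lemma inner_class f g : f \in sqint -> g \in sqint ->
  inner (cls f) (cls g) = cint mu (fun x => f x * conjc (g x)).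
Proof. by move=> sf sg; rewrite !L2_class_pi inner_pi. Qed.

Lemma inner_class_integrable f g : f \in sqint -> g \in sqint ->
  cintegrable mu (fun x => f x * conjc (g x)).
Proof.
move=> sf sg.
exact: (inner_integrable (exist (fun g => g \in sqint) f sf) (exist (fun g => g \in sqint) g sg)).
Qed.

Lemma sqn_class f : f \in sqint -> (sqn (cls f))%:E = (\int[mu]_x (sqnorm (f x))%:E)%E.
Proof.
move=> sf; rewrite L2_class_pi sqn_pi /Rintegral fineK//.
have [_ foo] := sqfunP (exist (fun g => g \in sqint) f sf).
by rewrite ge0_fin_numE//; apply: integral_ge0 => x _; rewrite lee_fin sqnorm_ge0.
Qed.

Definition bounded_measurable phi :=
  cmeasurable phi /\ exists M : R, forall x, sqnorm (phi x) <= M.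

Lemma sqintegrableM phi f : bounded_measurable phi -> f \in sqint ->
  (fun x => phi x * f x) \in sqint.
Proof.
move=> [mphi [M hM]]; rewrite !inE => -[mf foo]; split; first exact: cmeasurableM.
have M0 (x : X) : 0 <= M by exact: le_trans (sqnorm_ge0 _) (hM x).
(* That [M] is non-negative is only known through a point, so an empty space is treated apart. *)
have [[x _]|/nonemptyPn X0] := pselect (@setT X !=set0); last first.
  by rewrite X0 integral_set0.
apply: (@le_lt_trans _ _ (\int[mu]_x (M%:E * (sqnorm (f x))%:E))%E).
  apply: ge0_le_integral => //.
  - by move=> y _; rewrite lee_fin sqnorm_ge0.
  - by apply/measurable_EFinP/measurable_sqnorm/cmeasurableM.
  - by apply: measurable_funeM; apply/measurable_EFinP/measurable_sqnorm.
  - by move=> y _; rewrite -EFinM lee_fin sqnormM ler_wpM2r ?sqnorm_ge0.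
rewrite ge0_integralZl//; last first.
- by rewrite lee_fin (M0 x).
- by move=> y _; rewrite lee_fin sqnorm_ge0.
- by apply/measurable_EFinP/measurable_sqnorm.
by rewrite lte_mul_pinfty// lee_fin (M0 x).
Qed.

Lemma mulop_class phi f : bounded_measurable phi -> f \in sqint ->
  mulop phi (cls f) = cls (fun x => phi x * f x).
Proof.
move=> bphi sf; apply: L2_class_ae.
- apply: sqintegrableM => //; exact: (valP (repr (cls f))).
- exact: sqintegrableM.
- by apply: filterS (ae_repr_class sf) => x ->.
Qed.

Lemma mulop_bound phi (M : R) : cmeasurable phi -> 0 <= M -> (forall x, sqnorm (phi x) <= M ^+ 2) ->
  forall u, hnorm (mulop phi u) <= M * hnorm u.
Proof.
move=> mphi M0 hM u; have [f sf ->] := L2_classP u.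
have bphi : bounded_measurable phi by split => //; exists (M ^+ 2).
rewrite hnorm_leP ?mulr_ge0 ?hnorm_ge0// exprMn hnorm2.
rewrite mulop_class// -lee_fin [X in (_ <= X)%E]EFinM.
rewrite [X in (_ <= _ * X)%E](sqn_class sf).
rewrite [X in (X <= _)%E](sqn_class (sqintegrableM bphi sf)).
have [mf _] : cmeasurable f /\ (\int[mu]_x (sqnorm (f x))%:E < +oo)%E by rewrite inE in sf.
rewrite -ge0_integralZl//; first last.
- by rewrite lee_fin sqr_ge0.
- by move=> x _; rewrite lee_fin sqnorm_ge0.
- by apply/measurable_EFinP/measurable_sqnorm.
apply: ge0_le_integral => //.
- by move=> x _; rewrite lee_fin sqnorm_ge0.
- by apply/measurable_EFinP/measurable_sqnorm/cmeasurableM.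
- by apply: measurable_funeM; apply/measurable_EFinP/measurable_sqnorm.
- by move=> x _; rewrite -EFinM lee_fin sqnormM ler_wpM2r ?sqnorm_ge0.
Qed.

Lemma mulop_bounded phi : bounded_measurable phi -> bounded_op (mulop phi : op).
Proof.
move=> bphi; split.
  move=> k u v; have [f sf ->] := L2_classP u; have [g sg ->] := L2_classP v.
  rewrite -L2_classZD// !mulop_class// ?sqintegrableZD// -L2_classZD ?sqintegrableM//.
  by congr cls; apply/funext => x; ring.
have [mphi [M hM]] := bphi.
exists (Num.max 1 M); apply: mulop_bound => //.
  by rewrite le_max ler01.
move=> x; apply: le_trans (hM x) _.
have : 1 <= Num.max 1 M by rewrite le_max lexx.
have : M <= Num.max 1 M by rewrite le_max lexx orbT.
set m := Num.max _ _; nra.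
Qed.

Lemma bounded_measurable_cst k : bounded_measurable (fun=> k).
Proof. by split; [exact: cmeasurable_cst|exists (sqnorm k)]. Qed.

Lemma bounded_measurableM phi psi : bounded_measurable phi -> bounded_measurable psi ->
  bounded_measurable (fun x => phi x * psi x).
Proof.
move=> [mphi [M hM]] [mpsi [N hN]]; split; first exact: cmeasurableM.
exists (M * N) => x; rewrite sqnormM ler_pM ?sqnorm_ge0//.
Qed.

Lemma bounded_measurableD phi psi : bounded_measurable phi -> bounded_measurable psi ->
  bounded_measurable (fun x => phi x + psi x).
Proof.
move=> [mphi [M hM]] [mpsi [N hN]]; split; first exact: cmeasurableD.
exists (2 * M + 2 * N) => x; apply: le_trans (sqnormD_le _ _) _.
by rewrite lerD// ler_pM2l.
Qed.

Lemma bounded_measurableJ phi : bounded_measurable phi ->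
  bounded_measurable (fun x => conjc (phi x)).
Proof.
by move=> [mphi [M hM]]; split; [exact: cmeasurableJ|exists M => x; rewrite sqnormJ].
Qed.

Lemma mulop_comp phi psi : bounded_measurable phi -> bounded_measurable psi ->
  (mulop phi : op) \o mulop psi = mulop (fun x => phi x * psi x).
Proof.
move=> bphi bpsi; apply/funext => u /=; have [f sf ->] := L2_classP u.
have bM := bounded_measurableM bphi bpsi; rewrite !mulop_class ?sqintegrableM//.
by congr cls; apply/funext => x; rewrite mulrA.
Qed.

Lemma mulop_lin k phi psi : bounded_measurable phi -> bounded_measurable psi ->
  mulop (fun x => k * phi x + psi x) = k *: (mulop phi : op) + mulop psi.
Proof.
move=> bphi bpsi; apply/funext => u.
rewrite -[RHS]/(k *: mulop phi u + mulop psi u); have [f sf ->] := L2_classP u.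
have bk := bounded_measurableD (bounded_measurableM (bounded_measurable_cst k) bphi) bpsi.
rewrite !mulop_class// -L2_classZD ?sqintegrableM//.
by congr cls; apply/funext => x; ring.
Qed.

Lemma mulop_adjoint phi : bounded_measurable phi ->
  is_adjoint (mulop phi : op) (mulop (fun x => conjc (phi x))).
Proof.
move=> bphi u v; have [f sf ->] := L2_classP u; have [g sg ->] := L2_classP v.
have bJ := bounded_measurableJ bphi.
rewrite (mulop_class bphi sf) (mulop_class bJ sg).
rewrite (inner_class (sqintegrableM bphi sf) sg) (inner_class sf (sqintegrableM bJ sg)).
by congr cint; apply/funext => x; rewrite rmorphM /= conjcK; ring.
Qed.

Lemma mulop1 : mulop (fun=> 1) = (idfun : op).
Proof.
apply/funext => u; have [f sf ->] := L2_classP u.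
rewrite (mulop_class (bounded_measurable_cst 1) sf) -[RHS]/(cls f); congr cls.
by apply/funext => x; rewrite mul1r.
Qed.

End classes.

(** * Closed subspaces that contain enough indicators *)

Section closed_subspaces.
Import HBNNSimple.
Context d (X : measurableType d) (R : realType) (mu : {measure set X -> \bar R}).
Context (finmu : fin_num_fun mu).
Local Notation H := (L2 mu).
Local Notation cls := (L2_class mu).
Implicit Types (f g : X -> Cx R) (A : set X) (W : set H).

Definition indc A : X -> Cx R := fun x => (\1_A x)%:C.

Lemma cmeasurable_real (p : X -> R) : measurable_fun setT p ->
  cmeasurable (fun x => (p x)%:C : Cx R).
Proof. by move=> mp; split => //; exact: measurable_cst. Qed.

Lemma sqintegrable_indc A : measurable A -> indc A \in sqintegrable mu.
Proof.
move=> mA; rewrite inE; split.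
  by apply: cmeasurable_real; exact: measurable_indic.
rewrite (eq_integral (EFin \o \1_A)); last first.
  move=> x _; rewrite sqnorm_real /=; congr EFin.
  by rewrite indicE; case: (_ \in _); rewrite ?expr1n// expr0n.
rewrite integral_indic// setIT ltey_eq; have := finmu mA.
by move=> ->.
Qed.

Lemma sqn_indc A : measurable A -> (sqn (cls (indc A)))%:E = mu A.
Proof.
move=> mA; rewrite (sqn_class (sqintegrable_indc mA)).
transitivity (\int[mu]_x (\1_A x)%:E)%E; last by rewrite integral_indic// setIT.
apply: eq_integral => x _; rewrite sqnorm_real; congr EFin.
by rewrite indicE; case: (_ \in _); rewrite ?expr1n// expr0n.
Qed.

(** Dynkin's theorem extends the hypothesis from the pi-system [G] to all measurable sets; linearity
    gives simple functions, dominated convergence non-negative functions, and decomposition into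
    parts all of L2. *)
Lemma closed_subspace_full (G : set (set X)) W :
  d.-measurable = <<s G >> -> setI_closed G -> lin_subspace W -> L2_closure W `<=` W ->
  G setT -> (forall A, G A -> W (cls (indc A))) -> W = setT.
Proof.
move=> dG IG WL WC GT WG.
have W0 : W 0 by case: WL.
have Wlim u : (forall e : R, 0 < e -> exists2 v, W v & hnorm (u - v) <= e) -> W u.
  move=> h; apply: WC => e e0; have [v Wv uv] := h (e / 2) (divr_gt0 e0 (ltr0Sn _ 1)).
  by exists v => //; apply: le_lt_trans uv _; rewrite gtr_pMr// invf_lt1// ltr1n.
have Windc A : measurable A -> W (cls (indc A)).
  rewrite dG; apply: (dynkin_induction (P := fun A => W (cls (indc A))) dG) => //.
  - exact: WG.
  - move=> S mS WS; rewrite (_ : cls _ = cls (indc setT) - cls (indc S)).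
      by apply: lin_subspaceB => //; exact: WG.
    rewrite L2_classB ?sqintegrable_indc//; congr cls; apply/funext => x.
    rewrite /indc indicC /= -rmorphB; congr (_%:C); rewrite indicT indicE.
    by case: (x \in S); rewrite ?subrr ?subr0.
  (* Partial sums are indicators of the finite unions; the squared error is the measure of the
     remaining part, which tends to 0 because the measure is finite. *)
  - move=> F mF tF WF; apply: Wlim => e e0.
    pose S n := \sum_(i < n) cls (indc (F i)).
    have WS n : W (S n) by apply: lin_subspace_sum.
    pose U n := \big[setU/set0]_(i < n) F i.
    have mU n : measurable (U n) by exact: bigsetU_measurable.
    have SU n : S n = cls (indc (U n)).
      elim: n => [|n IHn].
        rewrite /S /U !big_ord0 -(L2_class0 mu); congr cls.
        by apply/funext => x; rewrite /indc indic0.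
      rewrite /S /U !big_ord_recr /= -/(S n) -/(U n) IHn.
      rewrite -[cls (indc (U n))]scale1r -L2_classZD ?sqintegrable_indc//; congr cls.
      apply/funext => x; rewrite mul1r /indc -rmorphD; congr (_%:C).
      rewrite !indicE in_setU; have [xU|xU] := boolP (x \in U n) => /=; last by rewrite add0r.
      rewrite memNset ?addr0// => xF; move: xU; rewrite inE /U -bigcup_mkord => -[i /= ni xi].
      move/trivIsetP : tF => /(_ i n I I); move/(_ (negbT (ltn_eqF ni))) => /seteqP[+ _].
      by move=> /(_ x); apply.
    have mUF : measurable (\bigcup_k F k) by exact: bigcup_measurable.
    have Uc : mu (U n) @[n --> \oo] --> mu (\bigcup_k F k).
      have := nondecreasing_cvg_mu mU; rewrite (_ : \bigcup_n U n = \bigcup_k F k).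
        apply => //.
        by apply/nondecreasing_seqP => n; rewrite /U big_ord_recr /=; apply/subsetPset; exact: subsetUl.
      rewrite eqEsubset; split => x [n _].
        by rewrite /U -bigcup_mkord => -[i _ xi]; exists i.
      by move=> xn; exists n.+1 => //; rewrite /U big_ord_recr /=; right.
    have UF n : U n `<=` \bigcup_k F k.
      by rewrite /U -bigcup_mkord => x [i _ xi]; exists i.
    have muU n : (mu (\bigcup_k F k `\` U n) = mu (\bigcup_k F k) - mu (U n))%E.
      rewrite measureD//; first by rewrite setIidr.
      by rewrite ltey_eq; have := finmu mUF => ->.
    have : (fun n => mu (\bigcup_k F k) - mu (U n))%E @ \oo --> 0%E.
      rewrite -(subee (finmu mUF)); apply: cvgeB => //.
        by rewrite fin_num_adde_defl// fin_numN finmu.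
      exact: cvg_cst.
    move=> /fine_cvgP[_ /cvgrPdist_le/(_ (e ^+ 2)) /(_ (exprn_gt0 2 e0))[n _ hn]].
    exists (S n) => //; rewrite hnorm_leP ?(ltW e0)//.
    rewrite SU L2_classB ?sqintegrable_indc//.
    have -> : (fun x => indc (\bigcup_k F k) x - indc (U n) x) = indc (\bigcup_k F k `\` U n).
      apply/funext => x; rewrite /indc -rmorphB; congr (_%:C).
      rewrite !indicE in_setD; have [xU|xU] := boolP (x \in U n) => /=.
        by rewrite andbF (mem_set (UF n _ (set_mem xU))) subrr.
      by rewrite andbT subr0.
    rewrite -lee_fin sqn_indc; last exact: measurableD.
    have := hn n (leqnn n); rewrite sub0r normrN /= -muU.
    rewrite ger0_norm ?fine_ge0// -lee_fin fineK//.
    by apply: finmu; exact: measurableD.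
have Wsum (r : seq R) (F : R -> set X) : (forall y, measurable (F y)) ->
    (fun x => (\sum_(y <- r) y * \1_(F y) x)%:C : Cx R) \in sqintegrable mu /\
    W (cls (fun x => (\sum_(y <- r) y * \1_(F y) x)%:C)).
  move=> mF; elim: r => [|y r [IHs IHW]].
    rewrite (_ : (fun _ => _) = (fun=> 0)); last by apply/funext => x; rewrite big_nil.
    by split; [exact: sqintegrable0|rewrite L2_class0].
  have -> : (fun x => (\sum_(y <- y :: r) y * \1_(F y) x)%:C : Cx R) =
      (fun x => y%:C * indc (F y) x + (\sum_(y <- r) y * \1_(F y) x)%:C).
    by apply/funext => x; rewrite big_cons rmorphD rmorphM.
  have sF := sqintegrable_indc (mF y).
  split; first exact: sqintegrableZD.
  by rewrite L2_classZD//; case: WL => _; apply => //; exact: Windc.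
have Wsimple (s : {nnsfun X >-> R}) : W (cls (fun x => (s x)%:C)).
  rewrite (_ : (fun x => _) = (fun x => (\sum_(y <- finmap.enum_fset (fset_set (range s))) y *
      \1_(s @^-1` [set y]) x)%:C)); first by apply Wsum.
  by apply/funext => x; rewrite fimfunE fsbig_finite.
(* Simple functions increase to [p], and the squared errors are dominated by the integrable function
   p^2. *)
have Wreal (p : X -> R) : measurable_fun setT p -> (forall x, 0 <= p x) ->
    (fun x => (p x)%:C : Cx R) \in sqintegrable mu -> W (cls (fun x => (p x)%:C)).
  move=> mp p0 sp; apply: Wlim => e e0.
  have mEp : measurable_fun setT (EFin \o p) by exact/measurable_EFinP.
  have [g [ndg gp]] := approximation measurableT mEp (fun x _ => p0 x).
  have gle n x : g n x <= p x.
    have /fine_cvgP[_ gx] := gp x I.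
    have nd : nondecreasing_seq (fun n => g n x) by move=> k m km; exact: (lefP _ _ (ndg k m km)).
    have := nondecreasing_cvgn_le nd (cvgP _ gx) n.
    by rewrite (cvg_lim (@Rhausdorff R) gx).
  have sg n : (fun x => (g n x)%:C : Cx R) \in sqintegrable mu.
    apply: sqintegrable_le sp; first exact: cmeasurable_real.
    by move=> x; rewrite !sqnorm_real ler_sqr ?nnegrE.
  have ip : mu.-integrable setT (fun x => (p x ^+ 2)%:E).
    have := sq_integrable (exist (fun g => g \in sqintegrable mu) _ sp).
    by apply: eq_integrable => // x _ /=; rewrite sqnorm_real.
  have : (\int[mu]_x ((p x - g n x) ^+ 2)%:E)%E @[n --> \oo] --> (\int[mu]_x 0)%E.
    apply: (dominated_cvg measurableT _ _ _ ip) => //.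
    - by move=> n; apply/measurable_EFinP/measurable_funX/measurable_funB.
    - move=> x _; apply: cvg_EFin; first by near=> n.
      have /fine_cvgP[_ gx] := gp x I.
      rewrite (_ : 0 = (p x - p x) ^+ 2 :> R); last by rewrite subrr expr0n.
      rewrite expr2 [X in X @ _](_ : _ = fun n => (p x - g n x) * (p x - g n x)).
        by apply: cvgM; apply: cvgB => //; exact: cvg_cst.
      by apply/funext => n; rewrite /= expr2.
    - move=> n x _; rewrite gee0_abs ?lee_fin ?sqr_ge0// ler_sqr ?nnegrE ?subr_ge0//.
      by rewrite gerBl.
  rewrite integral0 => /fine_cvgP[_ /cvgrPdist_le/(_ (e ^+ 2)) /(_ (exprn_gt0 2 e0))[n _ hn]].
  exists (cls (fun x => (g n x)%:C)) => //; rewrite hnorm_leP ?(ltW e0)//.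
  have := hn n (leqnn n); rewrite sub0r normrN /= ger0_norm; last first.
    by apply: fine_ge0; apply: integral_ge0 => x _; rewrite lee_fin sqr_ge0.
  pose q x : Cx R := (p x)%:C - (g n x)%:C; rewrite (L2_classB sp (sg n)) -/q.
  have sq : q \in sqintegrable mu.
    have := sqintegrableZB 1 sp (sg n).
    by rewrite (_ : (fun x => 1 * _ - _) = q)//; apply/funext => x; rewrite mul1r.
  rewrite (_ : sqn _ = fine (sqn (cls q))%:E)// (sqn_class sq).
  rewrite [X in _ -> fine X <= _](eq_integral (fun x => ((p x - g n x) ^+ 2)%:E))//.
  by move=> x _; rewrite /q -rmorphB sqnorm_real.
apply/seteqP; split => // u _; have [f sf ->] := L2_classP u.
have [[mre mim] _] : cmeasurable f /\ (\int[mu]_x (sqnorm (f x))%:E < +oo)%E by rewrite inE in sf.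
have part (p : X -> R) : measurable_fun setT p -> (forall x, p x ^+ 2 <= sqnorm (f x)) ->
    (fun x => (p x)%:C : Cx R) \in sqintegrable mu /\ W (cls (fun x => (p x)%:C)).
  move=> mp pf.
  have sub (q : X -> R) : measurable_fun setT q -> (forall x, `|q x| <= `|p x|) ->
      (fun x => (q x)%:C : Cx R) \in sqintegrable mu.
    move=> mq qp; apply: sqintegrable_le sf; first exact: cmeasurable_real.
    move=> x; rewrite sqnorm_real; apply: le_trans (pf x).
    by rewrite -ler_sqrt ?sqr_ge0// !sqrtr_sqr.
  split; first exact: sub.
  have mpos : measurable_fun setT p^\+ by exact: measurable_funrpos.
  have mneg : measurable_fun setT p^\- by exact: measurable_funrneg.
  have spos : (fun x => (p^\+ x)%:C : Cx R) \in sqintegrable mu.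
    by apply: sub => // x; rewrite /funrpos; case: (leP 0 (p x)) => [|_]; rewrite ?normr0.
  have sneg : (fun x => (p^\- x)%:C : Cx R) \in sqintegrable mu.
    apply: sub => // x; rewrite /funrneg; case: (leP (- p x) 0) => [_|_]; rewrite ?normr0//.
    by rewrite normrN.
  rewrite (_ : cls _ = cls (fun x => (p^\+ x)%:C) - cls (fun x => (p^\- x)%:C)).
    by apply: lin_subspaceB => //; apply: Wreal.
  rewrite (L2_classB spos sneg); congr cls; apply/funext => x.
  rewrite -rmorphB; congr (_%:C); by rewrite -{1}(funrposBneg p).
have [|sre Wre] := part (fun x => complex.Re (f x)) mre.
  by move=> x; rewrite /sqnorm lerDl sqr_ge0.
have [|sim Wim] := part (fun x => complex.Im (f x)) mim.
  by move=> x; rewrite /sqnorm lerDr sqr_ge0.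
rewrite (_ : f = (fun x => (0 +i* 1 : Cx R) * (complex.Im (f x))%:C + (complex.Re (f x))%:C)).
  by rewrite L2_classZD//; case: WL => _; apply.
by apply/funext => x; apply: cx_eqP => /=; ring.
Unshelve. all: by end_near.
Qed.

End closed_subspaces.

(** * Tensors of square integrable functions on the torus *)

Section tensor_products.
Context (R : realType).
Local Notation T := (circle R).
Local Notation mu := (circle_measure R).
Local Notation mu2 := (torus_measure R).
Local Notation H := (L2 mu).
Local Notation H2 := (L2 mu2).
Local Notation cls := (L2_class mu).
Local Notation cls2 := (L2_class mu2).
Implicit Types (f g : T -> Cx R) (u v w : H) (k : Cx R).

Lemma circle_measureT : mu setT = 1%E.
Proof. exact: (@probability_setT _ _ _ (distribution (uniform_prob (@ltr01 R)) (@circle_param R))). Qed.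

Lemma circle_measure_fin : fin_num_fun mu.
Proof. by apply: lty_fin_num_fun; rewrite [X in (X < _)%E]circle_measureT ltry. Qed.

Lemma torus_measureX (A B : set T) : measurable A -> measurable B ->
  mu2 (A `*` B) = (mu A * mu B)%E.
Proof. exact: product_measure1E. Qed.

Lemma torus_measure_fin : fin_num_fun mu2.
Proof.
apply: lty_fin_num_fun; rewrite [X in (X < _)%E](_ : _ = 1%E) ?ltry//.
rewrite -setXTT; apply: etrans (torus_measureX measurableT measurableT) _.
by rewrite circle_measureT mule1.
Qed.

Lemma ae_fst (P : T -> Prop) : {ae mu, forall x, P x} -> {ae mu2, forall x, P x.1}.
Proof.
move=> [A [mA A0 PA]]; exists (A `*` setT); split.
- exact: measurableX.
- by apply: etrans (torus_measureX mA measurableT) _; rewrite [mu A]A0 mul0e.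
- by move=> x /= Px; split => //; apply: PA.
Qed.

Lemma ae_snd (P : T -> Prop) : {ae mu, forall x, P x} -> {ae mu2, forall x, P x.2}.
Proof.
move=> [A [mA A0 PA]]; exists (setT `*` A); split.
- exact: measurableX.
- by apply: etrans (torus_measureX measurableT mA) _; rewrite [mu A]A0 mule0.
- by move=> x /= Px; split => //; apply: PA.
Qed.

(** Tonelli for the absolute values gives integrability, then Fubini applies; in both cases the
    iterated integral factors. *)
Lemma integrable_tensor (a b : T -> R) :
  mu.-integrable setT (EFin \o a) -> mu.-integrable setT (EFin \o b) ->
  mu2.-integrable setT (EFin \o (fun z => a z.1 * b z.2)) /\
  \int[mu2]_z (a z.1 * b z.2) = (\int[mu]_x a x) * (\int[mu]_x b x).
Proof.
move=> ia ib.
have [/integrableP[ma fa] /integrableP[mb fb]] := (ia, ib).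
have mab : measurable_fun setT (EFin \o (fun z : T * T => a z.1 * b z.2)).
  apply/measurable_EFinP; apply: measurable_funM.
    by apply: measurableT_comp => //; exact/measurable_EFinP.
  by apply: measurableT_comp => //; exact/measurable_EFinP.
have iab : mu2.-integrable setT (EFin \o (fun z => a z.1 * b z.2)).
  apply/(integrable12ltyP mu mu mab).
  have mna : measurable_fun setT (fun x => (`|a x|)%:E).
    by apply/measurable_EFinP; apply: measurableT_comp => //; exact/measurable_EFinP.
  have mnb : measurable_fun setT (fun x => (`|b x|)%:E).
    by apply/measurable_EFinP; apply: measurableT_comp => //; exact/measurable_EFinP.
  have I0 : (0 <= \int[mu]_y (`|b y|)%:E)%E by apply: integral_ge0.
  have Ib : (\int[mu]_y (`|b y|)%:E)%E \is a fin_num by rewrite ge0_fin_numE.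
  rewrite [X in (X < _)%E](_ : _ = (\int[mu]_x
      ((fine (\int[mu]_y (`|b y|)%:E))%:E * (`|a x|)%:E))%E).
    rewrite ge0_integralZl ?lee_fin ?fine_ge0//.
    by rewrite lte_mul_pinfty// lee_fin fine_ge0.
  apply: eq_integral => x _; rewrite (fineK Ib) muleC -(ge0_integralZl mu measurableT mnb)//.
  by apply: eq_integral => y _; rewrite /= normrM EFinM.
split=> //; rewrite /Rintegral.
have -> : (\int[mu2]_z (a z.1 * b z.2)%:E = \int[mu]_x \int[mu]_y (a x * b y)%:E)%E.
  exact/esym/(integral12_prod_meas1 iab).
have Ib := integrable_fin_num measurableT ib.
have Ia := integrable_fin_num measurableT ia.
rewrite (_ : (\int[mu]_x \int[mu]_y (a x * b y)%:E =
    \int[mu]_x ((fine (\int[mu]_y (b y)%:E))%:E * (a x)%:E))%E).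
  by rewrite (integralZl measurableT ia) -(fineK Ia) -EFinM /= mulrC.
apply: eq_integral => x _; rewrite (fineK Ib) muleC -(integralZl measurableT ib).
by apply: eq_integral => y _; rewrite EFinM.
Qed.

Lemma cint_tensor (p q : T -> Cx R) : cintegrable mu p -> cintegrable mu q ->
  cintegrable mu2 (fun z => p z.1 * q z.2) /\
  cint mu2 (fun z => p z.1 * q z.2) = cint mu p * cint mu q.
Proof.
move=> [pr pi] [qr qi].
have [irr err] := integrable_tensor pr qr; have [iri eri] := integrable_tensor pr qi.
have [iir eir] := integrable_tensor pi qr; have [iii eii] := integrable_tensor pi qi.
have reE : (fun z : T * T => complex.Re (p z.1 * q z.2)) =
    (fun z => complex.Re (p z.1) * complex.Re (q z.2) - complex.Im (p z.1) * complex.Im (q z.2)).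
  by apply/funext => z; case: (p z.1) (q z.2) => [? ?] [? ?].
have imE : (fun z : T * T => complex.Im (p z.1 * q z.2)) =
    (fun z => complex.Re (p z.1) * complex.Im (q z.2) + complex.Im (p z.1) * complex.Re (q z.2)).
  by apply/funext => z; case: (p z.1) (q z.2) => [? ?] [? ?].
split.
  split.
  - rewrite reE; have := integrableB measurableT irr iii.
    by congr (integrable _ _ _).
  - rewrite imE; have := integrableD measurableT iri iir.
    by congr (integrable _ _ _).
apply: cx_eqP.
- rewrite [LHS]/= reE RintegralB// err eii.
  by [].
- rewrite [LHS]/= imE RintegralD// eri eir.
  by [].
Qed.

Lemma cmeasurable_fst f : cmeasurable f -> cmeasurable (fun z : T * T => f z.1).
Proof.
by move=> [mr mi]; split; [exact: (measurableT_comp mr measurable_fst)|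
  exact: (measurableT_comp mi measurable_fst)].
Qed.

Lemma cmeasurable_snd f : cmeasurable f -> cmeasurable (fun z : T * T => f z.2).
Proof.
by move=> [mr mi]; split; [exact: (measurableT_comp mr measurable_snd)|
  exact: (measurableT_comp mi measurable_snd)].
Qed.

Lemma sqintegrable_tensor f g : f \in sqintegrable mu -> g \in sqintegrable mu ->
  (fun z : T * T => f z.1 * g z.2) \in sqintegrable mu2.
Proof.
move=> sf sg; have [mf _] := sqfunP (exist (fun g => g \in sqintegrable mu) _ sf).
have [mg _] := sqfunP (exist (fun g => g \in sqintegrable mu) _ sg).
have isf := sq_integrable (exist (fun g => g \in sqintegrable mu) _ sf).
have isg := sq_integrable (exist (fun g => g \in sqintegrable mu) _ sg).
have [/integrableP[_ +] _] := integrable_tensor isf isg.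
move=> foo; rewrite inE; split.
  by apply: cmeasurableM; [exact: cmeasurable_fst|exact: cmeasurable_snd].
apply: le_lt_trans foo; rewrite le_eqVlt; apply/orP; left; apply/eqP.
apply: eq_integral => z _ /=; rewrite ger0_norm ?mulr_ge0 ?sqnorm_ge0//.
by rewrite sqnormM.
Qed.

Lemma tensor_class f g : f \in sqintegrable mu -> g \in sqintegrable mu ->
  tensor (cls f) (cls g) = cls2 (fun z => f z.1 * g z.2).
Proof.
move=> sf sg; apply: L2_class_ae.
- apply: sqintegrable_tensor; [exact: (valP (repr (cls f)))|exact: (valP (repr (cls g)))].
- exact: sqintegrable_tensor.
- have := ae_snd (ae_repr_class sg); have := ae_fst (ae_repr_class sf).
  by apply: filterS2 => z -> ->.
Qed.

Lemma inner_tensor u v u' v' :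
  inner (tensor u v) (tensor u' v') = inner u u' * inner v v'.
Proof.
have [f sf ->] := L2_classP u; have [g sg ->] := L2_classP v.
have [f' sf' ->] := L2_classP u'; have [g' sg' ->] := L2_classP v'.
rewrite (tensor_class sf sg) (tensor_class sf' sg').
rewrite (inner_class (sqintegrable_tensor sf sg) (sqintegrable_tensor sf' sg')).
rewrite (inner_class sf sf') (inner_class sg sg').
have [_ <-] := cint_tensor (inner_class_integrable sf sf') (inner_class_integrable sg sg').
by congr cint; apply/funext => z; rewrite rmorphM; ring.
Qed.

Lemma hnorm_tensor u v : hnorm (tensor u v) = hnorm u * hnorm v.
Proof.
rewrite /hnorm inner_tensor !inner_sqn -rmorphM /= sqrtrM// sqn_ge0//.
Qed.

Lemma tensorZDl k u v w : tensor (k *: u + v) w = k *: tensor u w + tensor v w.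
Proof.
have [f sf ->] := L2_classP u; have [g sg ->] := L2_classP v.
have [h sh ->] := L2_classP w.
rewrite -(L2_classZD k sf sg) (tensor_class (sqintegrableZD k sf sg) sh).
rewrite (tensor_class sf sh) (tensor_class sg sh).
rewrite -(L2_classZD k (sqintegrable_tensor sf sh) (sqintegrable_tensor sg sh)).
by congr cls2; apply/funext => z; ring.
Qed.

Lemma tensorZDr k u v w : tensor w (k *: u + v) = k *: tensor w u + tensor w v.
Proof.
have [f sf ->] := L2_classP u; have [g sg ->] := L2_classP v.
have [h sh ->] := L2_classP w.
rewrite -(L2_classZD k sf sg) (tensor_class sh (sqintegrableZD k sf sg)).
rewrite (tensor_class sh sf) (tensor_class sh sg).
rewrite -(L2_classZD k (sqintegrable_tensor sh sf) (sqintegrable_tensor sh sg)).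
by congr cls2; apply/funext => z; ring.
Qed.

Lemma tensorBl u v w : tensor (u - v) w = tensor u w - tensor v w.
Proof. by rewrite addrC -scaleN1r tensorZDl scaleN1r addrC. Qed.

Lemma tensorBr u v w : tensor w (u - v) = tensor w u - tensor w v.
Proof. by rewrite addrC -scaleN1r tensorZDr scaleN1r addrC. Qed.

Lemma tensor0l w : tensor 0 w = 0.
Proof. by have := tensorBl 0 0 w; rewrite !subrr. Qed.

Lemma tensor0r w : tensor w 0 = 0.
Proof. by have := tensorBr 0 0 w; rewrite !subrr. Qed.

Lemma tensorZl k u w : tensor (k *: u) w = k *: tensor u w.
Proof. by have := tensorZDl k u 0 w; rewrite tensor0l !addr0. Qed.

Lemma tensorZr k u w : tensor w (k *: u) = k *: tensor w u.
Proof. by have := tensorZDr k u 0 w; rewrite tensor0r !addr0. Qed.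

Lemma tensor_suml I (r : seq I) (F : I -> H) w :
  tensor (\sum_(i <- r) F i) w = \sum_(i <- r) tensor (F i) w.
Proof.
apply: (big_morph (fun u => tensor u w)) => [u v|]; last exact: tensor0l.
by rewrite -[u]scale1r tensorZDl !scale1r.
Qed.

Lemma tensor_sumr I (r : seq I) (F : I -> H) w :
  tensor w (\sum_(i <- r) F i) = \sum_(i <- r) tensor w (F i).
Proof.
apply: (big_morph (fun u => tensor w u)) => [u v|]; last exact: tensor0r.
by rewrite -[u]scale1r tensorZDr !scale1r.
Qed.

(* Indicators of measurable rectangles are tensors. *)
Lemma tensor_total (W : set H2) : lin_subspace W -> L2_closure W `<=` W ->
  (forall u v, W (tensor u v)) -> W = setT.
Proof.
move=> WL WC Wt.
pose G : set (set (T * T)) := [set A `*` B | A in measurable & B in measurable].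
apply: (closed_subspace_full torus_measure_fin (G := G)) => //.
- by rewrite measurable_prod_measurableType.
- move=> _ _ [A mA [B mB <-]] [A' mA' [B' mB' <-]]; rewrite -setXI.
  by exists (A `&` A'); [exact: measurableI|exists (B `&` B'); [exact: measurableI|]].
- by exists setT => //; exists setT => //; rewrite setXTT.
- move=> _ [A mA [B mB <-]].
  have -> : indc R (A `*` B) = (fun z => indc R A z.1 * indc R B z.2).
    by apply/funext => z; rewrite /indc -rmorphM !indicE in_setX -natrM mulnb.
  have sA := sqintegrable_indc circle_measure_fin mA.
  have sB := sqintegrable_indc circle_measure_fin mB.
  by rewrite -(tensor_class sA sB).
Qed.

(** The equalizer of two bounded operators is a closed subspace, so [tensor_total] applies. This is
    what makes [op_tensor] unambiguous. *)
Lemma bounded_op_tensor_ext (c d : H2 -> H2) : bounded_op c -> bounded_op d ->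
  (forall u v, c (tensor u v) = d (tensor u v)) -> c = d.
Proof.
move=> bc bd cd; have [lc _] := bc; have [ld _] := bd.
pose W : set H2 := [set w | c w = d w].
suff WT : W = setT by apply/funext => w; have : W w by rewrite WT.
apply: tensor_total => //.
- split; first by rewrite /W /= (linear_op0 lc) (linear_op0 ld).
  by move=> k u v; rewrite /W /= lc ld => -> ->.
- move=> w wW; rewrite /W /=; apply/eqP; rewrite -subr_eq0; apply/eqP.
  have [M M0 cM] := bounded_opP bc; have [N N0 dN] := bounded_opP bd.
  apply: (@hnorm_small _ _ _ _ _ (M + N)) => e e0; have [v Wv wv] := wW e e0.
  apply: le_trans (hnormB_tri (c v) _ _) _; rewrite mulrDr; apply: lerD.
    rewrite -(linear_opB _ _ lc); apply: le_trans (cM _) _.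
    by rewrite [leRHS]mulrC; apply: ler_wpM2l; rewrite ltW.
  rewrite [c v]Wv -(linear_opB _ _ ld); apply: le_trans (dN _) _.
  by rewrite [leRHS]mulrC hnormBC; apply: ler_wpM2l; rewrite ltW.
Qed.

(* Both sides are bounded sesquilinear forms, so it suffices to compare them on tensors. *)
Lemma adjoint_tensor_ext (c d : H2 -> H2) : bounded_op c -> bounded_op d ->
  (forall u v u' v', inner (c (tensor u v)) (tensor u' v') = inner (tensor u v) (d (tensor u' v'))) ->
  is_adjoint c d.
Proof.
move=> bc bd cd; have [lc _] := bc; have [ld _] := bd.
have [M M0 cM] := bounded_opP bc; have [N N0 dN] := bounded_opP bd.
have small (z : Cx R) (K : R) : 0 <= K -> (forall e, 0 < e -> sqnorm z <= e ^+ 2 * K) -> z = 0.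
  move=> K0 h; apply: sqnorm_eq0; apply/eqP; rewrite eq_le sqnorm_ge0 andbT.
  apply/ler_addgt0Pr => e e0; rewrite add0r.
  have K1 : 0 < K + 1 by rewrite ltr_wpDl.
  have := h (Num.sqrt (e / (K + 1))); rewrite sqrtr_gt0 divr_gt0// sqr_sqrtr ?divr_ge0 ?(ltW e0) ?(ltW K1)//.
  move=> /(_ isT) /le_trans; apply; rewrite mulrAC ler_pdivrMr// ler_pM2l// lerDl//.
have arith (K e s t : R) : e ^+ 2 * (2 * (K * s) + 2 * t) = 2 * (K * e ^+ 2 * s) + 2 * (e ^+ 2 * t).
  by ring.
have bound (u w : H2) : L2_closure [set f : H2 | inner (c f) w = inner f (d w)] u ->
    inner (c u) w = inner u (d w).
  move=> uW; apply/eqP; rewrite -subr_eq0; apply/eqP.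
  apply: (@small _ (2 * (M ^+ 2 * sqn w) + 2 * sqn (d w))) => [|e e0].
    have p1 := mulr_ge0 (sqr_ge0 M) (sqn_ge0 w).
    exact: addr_ge0 (mulr_ge0 (ler0n _ 2) p1) (mulr_ge0 (ler0n _ 2) (sqn_ge0 _)).
  have [f /= fW uf] := uW e e0.
  have -> : inner (c u) w - inner u (d w) = inner (c (u - f)) w + - inner (u - f) (d w).
    by rewrite (linear_opB _ _ lc) !innerBl fW; ring.
  apply: le_trans (sqnormD_le _ _) _; rewrite sqnormN arith; have s1 : sqn (u - f) <= e ^+ 2.
    by rewrite -hnorm_leP ?(ltW e0)// ltW.
  have s2 : sqn (c (u - f)) <= M ^+ 2 * e ^+ 2.
    rewrite -exprMn -hnorm_leP ?(mulr_ge0 (ltW M0) (ltW e0))//; apply: le_trans (cM _) _.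
    by rewrite ler_pM2l// ltW.
  apply: lerD; rewrite ler_pM2l//; apply: le_trans (cauchy_schwarz _ _) _.
    exact: ler_wpM2r (sqn_ge0 _) _ _ s2.
  exact: ler_wpM2r (sqn_ge0 _) _ _ s1.
have step (w : H2) : (forall u v, inner (c (tensor u v)) w = inner (tensor u v) (d w)) ->
    forall f : H2, inner (c f) w = inner f (d w).
  move=> h f; pose W : set H2 := [set f : H2 | inner (c f) w = inner f (d w)].
  have WT : W = setT.
    apply: tensor_total => //.
    - split; first by rewrite /W /= (linear_op0 lc) !inner0l.
      by move=> k x y; rewrite /W /= lc !innerDl !innerZl => -> ->.
    - by move=> u uW; exact: bound.
  by have : W f by rewrite WT.
move=> f g; have -> : inner (c f) g = inner f (d g).
  have h1 u' v' : inner (c f) (tensor u' v') = inner f (d (tensor u' v')).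
    by apply: step => u v; exact: cd.
  pose W : set H2 := [set g : H2 | inner (c f) g = inner f (d g)].
  have WT : W = setT.
    apply: tensor_total => //.
    - split; first by rewrite /W /= (linear_op0 ld) !inner0r.
      by move=> k x y; rewrite /W /= ld !innerDr !innerZr => -> ->.
    - move=> u uW; rewrite /W /=; apply/eqP; rewrite -subr_eq0; apply/eqP.
      apply: (@small _ (2 * sqn (c f) + 2 * (N ^+ 2 * sqn f))) => [|e e0].
        have p1 := mulr_ge0 (sqr_ge0 N) (sqn_ge0 f).
        exact: addr_ge0 (mulr_ge0 (ler0n _ 2) (sqn_ge0 _)) (mulr_ge0 (ler0n _ 2) p1).
      have [v /= vW uv] := uW e e0.
      have -> : inner (c f) u - inner f (d u) = inner (c f) (u - v) + - inner f (d (u - v)).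
        by rewrite (linear_opB _ _ ld) !innerBr vW; ring.
      apply: le_trans (sqnormD_le _ _) _; rewrite sqnormN [X in e ^+ 2 * X]addrC arith [leRHS]addrC; have s1 : sqn (u - v) <= e ^+ 2.
        by rewrite -hnorm_leP ?(ltW e0)// ltW.
      have s2 : sqn (d (u - v)) <= N ^+ 2 * e ^+ 2.
        rewrite -exprMn -hnorm_leP ?(mulr_ge0 (ltW N0) (ltW e0))//; apply: le_trans (dN _) _.
        by rewrite ler_pM2l// ltW.
      apply: lerD; rewrite ler_pM2l//; apply: le_trans (cauchy_schwarz _ _) _.
        by rewrite [leLHS]mulrC; exact: ler_wpM2r (sqn_ge0 _) _ _ s1.
      rewrite [leLHS]mulrC; exact: ler_wpM2r (sqn_ge0 _) _ _ s2.
  by have : W g by rewrite WT.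
by [].
Qed.

End tensor_products.

(** * The circle, its measure and the orthonormality of the powers of z *)

Section circle_points.
Context (R : realType).
Local Notation T := (circle R).
Local Notation mu := (circle_measure R).
Implicit Types (x y : T) (z : Cx R) (s t : R).

Lemma circle_sqnorm x : sqnorm (sval x) = 1.
Proof. by apply: unitc_sqnorm; have := valP x; rewrite inE. Qed.

Lemma circle_neq0 x : sval x != 0.
Proof.
by apply/eqP => x0; have := circle_sqnorm x; rewrite x0 sqnorm0 => /esym/eqP; rewrite oner_eq0.
Qed.

Lemma sqnormX z n : sqnorm (z ^+ n) = sqnorm z ^+ n.
Proof.
elim: n => [|n IHn]; first by rewrite !expr0 sqnorm1.
by rewrite !exprS sqnormM IHn.
Qed.

Lemma conjc_unit z : sqnorm z = 1 -> conjc z = z^-1.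
Proof.
move=> z1; have z0 : z != 0.
  by apply/eqP => z0; move: z1; rewrite z0 sqnorm0 => /esym/eqP; rewrite oner_eq0.
by apply: (mulfI z0); rewrite mulcJ z1 divff.
Qed.

Lemma circle_sqnorm_expz x (m : int) : sqnorm (sval x ^ m) = 1.
Proof.
have h n : sqnorm (sval x ^+ n) = 1 by rewrite sqnormX circle_sqnorm expr1n.
case: m => n; first exact: h.
by rewrite NegzE -invr_expz -conjc_unit ?sqnormJ; exact: h.
Qed.

Lemma conjc_expz x (m : int) : conjc (sval x ^ m) = sval x ^ (- m).
Proof. by rewrite conjc_unit ?circle_sqnorm_expz// invr_expz. Qed.

Definition expi t : Cx R := cos (2 * pi * t) +i* sin (2 * pi * t).

Lemma expiD s t : expi (s + t) = expi s * expi t.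
Proof. by apply: cx_eqP; rewrite /= mulrDr ?cosD ?sinD; ring. Qed.

Lemma expi0 : expi 0 = 1.
Proof. by apply: cx_eqP; rewrite /= mulr0 ?cos0 ?sin0. Qed.

Lemma expi_nat n : expi n%:R = 1.
Proof.
elim: n => [|n IHn]; first exact: expi0.
rewrite -natr1 expiD IHn mul1r; apply: cx_eqP; rewrite /= mulr1 mulrC.
  by rewrite mulr_natr cos2pi.
by rewrite mulr_natr sin2pi.
Qed.

Lemma expi_expn t n : expi t ^+ n = expi (n%:R * t).
Proof.
elim: n => [|n IHn]; first by rewrite expr0 mul0r expi0.
by rewrite exprS IHn -expiD -natr1 mulrDl mul1r addrC.
Qed.

Lemma expiN t : expi (- t) = (expi t)^-1.
Proof.
have h : expi t * expi (- t) = 1 by rewrite -expiD subrr expi0.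
have e0 : expi t != 0 by apply/eqP => e0; move: h; rewrite e0 mul0r => /esym/eqP; rewrite oner_eq0.
by apply: (mulfI e0); rewrite h divff.
Qed.

Lemma expi_expz t (m : int) : expi t ^ m = expi (m%:~R * t).
Proof.
case: m => n; first by rewrite -exprnP expi_expn.
by rewrite NegzE -exprnN expi_expn -expiN mulrNz mulNr.
Qed.

Lemma circle_paramE t : sval (circle_param t) = expi t.
Proof. by []. Qed.

(** [acos] parametrizes the upper half circle; a point below the axis is reached at 1 minus the
    parameter of its conjugate. *)
Lemma circle_param_surj x : exists2 t, 0 <= t <= 1 & circle_param t = x.
Proof.
have h := circle_sqnorm x; move: h; case E : (sval x) => [a b]; rewrite /sqnorm /= => ab.
have a1 : -1 <= a <= 1 by apply/andP; split; nra.
have p0 : (0 : R) < 2 * pi by rewrite mulr_gt0 ?pi_gt0.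
have ca : cos (acos a) = a by rewrite acosK// in_itv.
have sa : sin (acos a) = `|b|.
  by rewrite sin_acos// (_ : 1 - a ^+ 2 = b ^+ 2) ?sqrtr_sqr//; lra.
have [a0 api] : 0 <= acos a /\ acos a <= pi by rewrite acos_ge0 ?acos_lepi.
have d0 : 2 * pi * (acos a / (2 * pi)) = acos a by rewrite mulrC divfK ?gt_eqF.
have dle : 0 <= acos a / (2 * pi) <= 1.
  apply/andP; split; first by rewrite divr_ge0 ?(ltW p0).
  by rewrite ler_pdivrMr// mul1r; have := pi_gt0 R; lra.
have [b0|b0] := leP 0 b.
  exists (acos a / (2 * pi)) => //; apply: val_inj; rewrite /= d0 ca sa ger0_norm//.
exists (1 - acos a / (2 * pi)); first by apply/andP; split; move/andP: dle => []; lra.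
apply: val_inj; rewrite /= -/(expi _) expiD (expi_nat 1) mul1r E /expi.
by rewrite mulrN cosN sinN d0 ca sa ltr0_norm// opprK.
Qed.

(** The real part is 1 - 2 sin^2(pi t), and this sine is positive for t strictly between 0 and 1. *)
Lemma expi_neq1 t : 0 < t < 1 -> expi t != 1.
Proof.
move=> /andP[t0 t1]; apply/eqP => /(congr1 (@complex.Re R)) /=.
rewrite (_ : 2 * pi * t = pi * t + pi * t); last by ring.
rewrite cosD; have := cos2Dsin2 (pi * t).
have : 0 < sin (pi * t).
  by apply: sin_gt0_pi; rewrite mulr_gt0 ?pi_gt0//= gtr_pMr ?pi_gt0.
nra.
Qed.

Lemma circle_sqdist_le x y : sqnorm (sval x - sval y) <= 4.
Proof.
by apply: le_trans (sqnormD_le _ _) _; rewrite sqnormN !circle_sqnorm; lra.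
Qed.

Lemma continuous_circle_val : continuous (fun x : T => sval x : Cx R).
Proof. by apply/continuousP => V oV; exists V. Qed.

Lemma circle_compact : compact (@setT T).
Proof.
rewrite (_ : setT = (@circle_param R : R -> T) @` `[0, 1]%classic).
  apply: continuous_compact; last exact: segment_compact.
  by apply: continuous_subspaceT; exact: continuous_circle_param.
by apply/seteqP; split => // x _; have [t t01 <-] := circle_param_surj x; exists t.
Qed.

Lemma continuous_Re : continuous (fun z : Cx R => complex.Re z : R).
Proof.
move=> z A /nbhs_ballP[e /= e0 eA]; apply/nbhs_ballP; exists e%:C => /=.
  by rewrite ltcR.
move=> w zw; apply: eA; move: zw; rewrite /ball /= normc_sqnorm ltcR.
apply: le_lt_trans; rewrite -sqrtr_sqr ler_wsqrtr//.
by case: z w => [a b] [c f]; rewrite /sqnorm /= lerDl sqr_ge0.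
Qed.

Lemma continuous_Im : continuous (fun z : Cx R => complex.Im z : R).
Proof.
move=> z A /nbhs_ballP[e /= e0 eA]; apply/nbhs_ballP; exists e%:C => /=.
  by rewrite ltcR.
move=> w zw; apply: eA; move: zw; rewrite /ball /= normc_sqnorm ltcR.
apply: le_lt_trans; rewrite -sqrtr_sqr ler_wsqrtr//.
by case: z w => [a b] [c f]; rewrite /sqnorm /= lerDr sqr_ge0.
Qed.

Lemma continuous_sqnorm (U : topologicalType) (f : U -> Cx R) : continuous f ->
  continuous (fun u => sqnorm (f u)).
Proof.
move=> cf u.
have cr : (fun v => complex.Re (f v)) @ u --> complex.Re (f u).
  exact: (continuous_comp (cf u) (@continuous_Re (f u))).
have ci : (fun v => complex.Im (f v)) @ u --> complex.Im (f u).
  exact: (continuous_comp (cf u) (@continuous_Im (f u))).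
rewrite /continuous_at /sqnorm !expr2; under eq_fun do rewrite !expr2.
by apply: cvgD; apply: cvgM.
Qed.

Lemma circle_measurable_continuous (p : T -> R) : continuous p -> measurable_fun setT p.
Proof.
move=> cp; apply: (measurability (RGenOInfty.G (R := R))).
  exact: RGenOInfty.measurableE.
move=> _ [_ [r ->] <-]; rewrite setTI; apply: sub_sigma_algebra.
by apply: open_comp => [x _|]; [exact: cp|rewrite set_itvE; exact: open_gt].
Qed.

Lemma cmeasurable_expz (m : int) : cmeasurable (fun x : T => sval x ^ m).
Proof.
have mv : cmeasurable (fun x : T => sval x : Cx R).
  split; apply: circle_measurable_continuous => x.
    exact: (continuous_comp (@continuous_circle_val x) (@continuous_Re _)).
  exact: (continuous_comp (@continuous_circle_val x) (@continuous_Im _)).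
have mX n : cmeasurable (fun x : T => sval x ^+ n).
  elim: n => [|n IHn]; first by under eq_fun do rewrite expr0; exact: cmeasurable_cst.
  by under eq_fun do rewrite exprS; exact: cmeasurableM.
case: m => n; first exact: mX.
rewrite (_ : (fun x : T => _) = fun x => conjc (sval x ^+ n.+1)); first exact: cmeasurableJ.
by apply/funext => x; rewrite exprnP conjc_expz NegzE.
Qed.

Lemma sqintegrable_expz (m : int) : (fun x : T => sval x ^ m) \in sqintegrable mu.
Proof.
rewrite inE; split; first exact: cmeasurable_expz.
rewrite (eq_integral (cst 1%E)); last by move=> x _; rewrite circle_sqnorm_expz.
by rewrite integral_cst// mul1e [X in (X < _)%E]circle_measureT ltry.
Qed.

Lemma circle_integral (p : T -> R) : measurable_fun setT p -> (forall x, 0 <= p x) ->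
  (\int[mu]_x (p x)%:E = \int[lebesgue_measure]_(t in `[0%R, 1%R]) (p (circle_param t))%:E)%E.
Proof.
move=> mp p0.
have mE : measurable_fun setT (EFin \o p) by exact/measurable_EFinP.
transitivity (\int[uniform_prob (@ltr01 R)]_t (p (circle_param t))%:E)%E.
  have := ge0_integral_pushforward (@measurable_circle_param R) (uniform_prob (@ltr01 R))
    measurableT mE (fun x _ => p0 x).
  by rewrite preimage_setT.
rewrite integral_uniform ?subr0 ?invr1 ?mul1e//; last first.
  by move=> t; rewrite lee_fin.
by apply/measurable_EFinP; apply: measurableT_comp => //; exact: measurable_circle_param.
Qed.

(** Adding 1 makes the integrand non-negative, as [circle_integral] requires. The hypothesis on the
    sine makes the periodic part of the antiderivative cancel between the endpoints. *)
Lemma integral_cosD1 (w c : R) : w != 0 -> sin (w + c) = sin c ->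
  (\int[lebesgue_measure]_(t in `[0%R, 1%R]) (1 + cos (w * t + c))%:E = 1%E)%E.
Proof.
move=> w0 wc; pose F t := t + w^-1 * sin (w * t + c).
have dF t : is_derive t 1 F (1 + cos (w * t + c)).
  have d1 : is_derive t 1 (fun t : R => w * t + c) w.
    have : is_derive t 1 (w \*: (@id R) + cst c) (w *: 1 + 0).
      by apply: is_deriveD.
    by rewrite addr0 [_ *: 1]mulr1.
  have d2 := @is_derive1_comp _ sin (fun t : R => w * t + c) t _ _ (is_derive_sin (w * t + c)) d1.
  have : is_derive t 1 (@id R + w^-1 \*: (sin \o (fun t : R => w * t + c)))
     (1 + w^-1 *: (cos (w * t + c) * w)) by apply: is_deriveD.
  by rewrite [w^-1 *: _]mulrC -mulrA divff// mulr1.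
have cF : continuous F.
  by move=> t; apply: differentiable_continuous; apply/derivable1_diffP; exact: ex_derive.
rewrite (@continuous_FTC2 _ _ F)//.
- rewrite /F mulr1 mulr0 wc !add0r -EFinB; congr EFin; ring.
- apply: continuous_subspaceT => t; apply: cvgD; first exact: cvg_cst.
  have lin : {for t, continuous (fun t : R => w * t + c)}.
    by apply: cvgD; [apply: cvgM; [exact: cvg_cst|exact: cvg_id]|exact: cvg_cst].
  exact: (continuous_comp lin (@continuous_cos R _)).
- split; first by move=> t _; exact: ex_derive.
    by apply: cvg_at_right_filter; exact: cF.
  by apply: cvg_at_left_filter; exact: cF.
- by move=> t _; rewrite derive1E; exact: derive_val.
Qed.

Lemma cint_expz (m : int) : cint mu (fun x : T => sval x ^ m) = (m == 0)%:R.
Proof.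
have [->|m0] := eqVneq m 0.
  apply: cx_eqP => /=.
    rewrite (@eq_Rintegral _ _ _ _ _ (fun=> 1)); last by move=> x _.
    by rewrite Rintegral_cst// mul1r [X in fine X]circle_measureT.
  rewrite (@eq_Rintegral _ _ _ _ _ (fun=> 0)); last by move=> x _.
  by rewrite Rintegral_cst// mul0r.
pose w : R := 2 * pi * m%:~R.
have w0 : w != 0.
  by apply: mulf_neq0; [rewrite gt_eqF// mulr_gt0 ?pi_gt0|rewrite intr_eq0].
have [mr mi] := cmeasurable_expz m.
have pE t : sval (circle_param t) ^ m = cos (w * t) +i* sin (w * t) :> Cx R.
  by rewrite circle_paramE expi_expz /expi /w !mulrA.
(* Real and imaginary parts are treated together: a sine is a cosine with phase - pi / 2. *)
have shift (p : T -> R) (c : R) : measurable_fun setT p -> (forall x, p x ^+ 2 <= 1) ->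
    (forall t, p (circle_param t) = cos (w * t + c)) -> sin (w + c) = sin c ->
    \int[mu]_x p x = 0.
  move=> mp p1 pc wc.
  have pm1 x : -1 <= p x <= 1 by have := p1 x => h; apply/andP; split; nra.
  have i1 : mu.-integrable setT (EFin \o (fun=> 1 : R)).
    apply/integrableP; split; first exact: measurable_cst.
    rewrite (eq_integral (cst 1%E)); last by move=> x _; rewrite /= normr1.
    by rewrite integral_cst// mul1e [X in (X < _)%E]circle_measureT ltry.
  have ip : mu.-integrable setT (EFin \o p).
    apply: le_integrable i1 => //; first exact/measurable_EFinP.
    by move=> x _ /=; rewrite lee_fin normr1 ler_norml; exact: pm1.
  have : (\int[mu]_x (1 + p x)%:E = 1)%E.
    rewrite circle_integral; first last.
    - by move=> x; have := pm1 x; lra.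
    - by apply: measurable_funD.
    by under eq_integral do rewrite pc; exact: integral_cosD1.
  move=> /(congr1 fine); rewrite -/(Rintegral _ _ _) RintegralD//.
  rewrite Rintegral_cst// mul1r [X in fine X + _]circle_measureT /=; lra.
have wpi : sin w = 0 /\ cos w = 1.
  have := expi_expz 1 m; rewrite (expi_nat 1) exp1rz mulr1 /expi -/w => h.
  by split; [have := congr1 (@complex.Im R) h|have := congr1 (@complex.Re R) h].
have sq x : complex.Re (sval x ^ m) ^+ 2 + complex.Im (sval x ^ m) ^+ 2 = 1.
  exact: circle_sqnorm_expz.
apply: cx_eqP.
- apply: (shift _ 0) => //.
  + by move=> x; rewrite -(sq x) lerDl sqr_ge0.
  + by move=> t; rewrite pE addr0.
  + by rewrite addr0 wpi.1 sin0.
- apply: (shift _ (- (pi / 2))) => //.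
  + by move=> x; rewrite -(sq x) lerDr sqr_ge0.
  + by move=> t; rewrite pE cosB cos_pihalf sin_pihalf mulr0 add0r mulr1.
  + by rewrite sinD wpi.1 wpi.2 mul0r mul1r add0r.
Qed.

Lemma inner_zpow (m n : int) : inner (zpow R m) (zpow R n) = (m == n)%:R.
Proof.
rewrite (inner_class (sqintegrable_expz m) (sqintegrable_expz n)).
rewrite (_ : (fun x : T => _) = fun x : T => sval x ^ (m - n)).
  by rewrite cint_expz subr_eq0.
by apply/funext => x; rewrite conjc_expz expfzDr ?circle_neq0.
Qed.

End circle_points.

(** * Moduli of continuity, Fejer kernels and roots of unity *)

Section trigonometric_approximation.
Context (R : realType).
Local Notation T := (circle R).
Local Notation mu2 := (torus_measure R).
Implicit Types (phi : T * T -> Cx R) (x y : T * T).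

Definition sqdist x y : R := sqnorm (sval x.1 - sval y.1) + sqnorm (sval x.2 - sval y.2).

Lemma sqdist_ge0 x y : 0 <= sqdist x y.
Proof. by rewrite addr_ge0 ?sqnorm_ge0. Qed.

Lemma sqdist_eq0 x y : sqdist x y = 0 -> x = y.
Proof.
case: x y => [x1 x2] [y1 y2] /eqP; rewrite paddr_eq0 ?sqnorm_ge0// => /andP[].
move=> /eqP/sqnorm_eq0/subr0_eq h1 /eqP/sqnorm_eq0/subr0_eq h2.
by congr (_, _); exact: val_inj.
Qed.

Lemma continuous_proj1 (U V : topologicalType) : continuous (fun p : U * V => p.1).
Proof. by move=> p; exact: cvg_fst. Qed.

Lemma continuous_proj2 (U V : topologicalType) : continuous (fun p : U * V => p.2).
Proof. by move=> p; exact: cvg_snd. Qed.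

Lemma continuous_compose (U V W : topologicalType) (f : U -> V) (g : V -> W) :
  continuous f -> continuous g -> continuous (fun u => g (f u)).
Proof. by move=> cf cg u; exact: (continuous_comp (cf u) (cg (f u))). Qed.

Lemma continuous_sqnormB (U : topologicalType) (f g : U -> Cx R) :
  continuous f -> continuous g -> continuous (fun u => sqnorm (f u - g u)).
Proof.
move=> cf cg; apply: continuous_sqnorm => u.
by apply: (@cvgB _ (Cx R)^o); [exact: cf|exact: cg].
Qed.

Lemma continuous_circle_comp (U : topologicalType) (f : U -> T) : continuous f ->
  continuous (fun u => sval (f u) : Cx R).
Proof. by move=> cf; exact: (continuous_compose cf (@continuous_circle_val R)). Qed.

(* The open sets where the bound holds with constant [n] increase with [n] and
   cover the compact square of the torus. *)
Lemma continuous_sqdist_bound phi : continuous phi -> forall e : R, 0 < e ->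
  exists2 C : R, 0 <= C & forall x y, sqnorm (phi x - phi y) <= e + C * sqdist x y.
Proof.
move=> cphi e e0.
pose U (n : nat) : set ((T * T) * (T * T)) :=
  [set p | 0 < e + n%:R * sqdist p.1 p.2 - sqnorm (phi p.1 - phi p.2)].
pose D := ((T * T) * (T * T))%type.
have p1 : continuous (fun p : D => p.1) by exact: continuous_proj1.
have p2 : continuous (fun p : D => p.2) by exact: continuous_proj2.
have pcB (f g : T * T -> T) : continuous f -> continuous g ->
    continuous (fun p : D => sqnorm (sval (f p.1) - sval (g p.2))).
  move=> cf cg; apply: continuous_sqnormB; apply: continuous_circle_comp.
    exact: (continuous_compose p1 cf).
  exact: (continuous_compose p2 cg).
have oU n : open (U n).
  have cg : continuous (fun p : D =>
      e + n%:R * sqdist p.1 p.2 - sqnorm (phi p.1 - phi p.2)).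
    move=> p; apply: cvgB; last first.
      exact: (continuous_sqnormB (continuous_compose p1 cphi) (continuous_compose p2 cphi)).
    apply: cvgD; first exact: cvg_cst.
    apply: cvgM; first exact: cvg_cst.
    apply: cvgD; [exact: (pcB _ _ (@continuous_proj1 T T) (@continuous_proj1 T T))|
      exact: (pcB _ _ (@continuous_proj2 T T) (@continuous_proj2 T T))].
  by apply: (open_comp (D := [set r : R | 0 < r])) => [p _|]; [exact: cg|exact: open_gt].
have cov p : exists n, U n p.
  have [p0|p0] := eqVneq (sqdist p.1 p.2) 0.
    by exists 0%N; rewrite /U /= (sqdist_eq0 p0) subrr sqnorm0 mul0r addr0 subr0.
  have pp : 0 < sqdist p.1 p.2 by rewrite lt_def p0 sqdist_ge0.
  pose s := sqnorm (phi p.1 - phi p.2).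
  exists (Num.truncn (s / sqdist p.1 p.2)).+1; rewrite /U /= -/s.
  by have := truncnS_gt (s / sqdist p.1 p.2); rewrite ltr_pdivrMr//; lra.
have cT : compact [set: (T * T) * (T * T)].
  by rewrite -!setXTT; do !apply: compact_setX; exact: circle_compact.
have /(_ nat \oo U) := (compact_near_coveringP _).1 cT.
case=> [p _|N _ hN].
  have [n Un] := cov p; exists (U n, [set k | (n <= k)%N]).
    split; last by exists n.
    by apply: open_nbhs_nbhs; split; [exact: oU|exact: Un].
  move=> [q k] [/= Uq nk]; move: Uq; rewrite /U /= => /lt_le_trans; apply.
  by rewrite lerD2r lerD2l ler_wpM2r ?sqdist_ge0// ler_nat.
exists N%:R => [|x y]; first by rewrite ler0n.
have := hN N (leqnn N) (x, y) I; rewrite /U /=; lra.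
Qed.

Lemma sqdist_le x y : sqdist x y <= 8.
Proof. by have := circle_sqdist_le x.1 y.1; have := circle_sqdist_le x.2 y.2; rewrite /sqdist; lra. Qed.

Lemma continuous_sqnorm_bound phi : continuous phi ->
  exists2 M : R, 0 <= M & forall x, sqnorm (phi x) <= M.
Proof.
move=> cphi; have [C C0 hC] := continuous_sqdist_bound cphi ltr01.
pose x0 : T * T := (point, point).
exists (2 * (1 + C * 8) + 2 * sqnorm (phi x0)) => [|x].
  by have := sqnorm_ge0 (phi x0); lra.
rewrite -[phi x](subrK (phi x0)); apply: le_trans (sqnormD_le _ _) _.
rewrite lerD2r ler_pM2l//; apply: le_trans (hC x x0) _.
by rewrite lerD2l ler_wpM2l// sqdist_le.
Qed.

Definition monomial (m n : int) : T * T -> Cx R := fun x => sval x.1 ^ m * sval x.2 ^ n.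

(** The degree bound is recorded because multiplication by (z1 z2)^N must later make every exponent
    non-negative. *)
Definition trig_polynomial (N : nat) : set (T * T -> Cx R) :=
  lin_span [set f | exists m n : int,
    [/\ (`|m| <= N)%N, (`|n| <= N)%N & f = monomial m n]].

(** The difference of the two sides is the variance of [z] under the weights [w]. *)
Lemma sqnorm_convex (I : finType) (w : I -> R) (z : I -> Cx R) :
  (forall i, 0 <= w i) -> \sum_i w i = 1 ->
  sqnorm (\sum_i (w i)%:C * z i) <= \sum_i w i * sqnorm (z i).
Proof.
move=> w0 w1; set m := \sum_i _.
have : 0 <= \sum_i w i * sqnorm (z i - m).
  by apply: sumr_ge0 => i _; rewrite mulr_ge0 ?sqnorm_ge0.
suff -> : \sum_i w i * sqnorm (z i - m) = \sum_i w i * sqnorm (z i) - sqnorm m.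
  by rewrite subr_ge0.
have mre : complex.Re m = \sum_i w i * complex.Re (z i).
  rewrite /m (big_morph (fun v : Cx R => complex.Re v) (id1 := 0) (op1 := +%R))//.
    by apply: eq_bigr => i _; case: (z i) => a b /=; rewrite mul0r subr0.
  by move=> [? ?] [? ?].
have mim : complex.Im m = \sum_i w i * complex.Im (z i).
  rewrite /m (big_morph (fun v : Cx R => complex.Im v) (id1 := 0) (op1 := +%R))//.
    by apply: eq_bigr => i _; case: (z i) => a b /=; rewrite mul0r addr0.
  by move=> [? ?] [? ?].
transitivity (\sum_i (w i * sqnorm (z i) - 2 * complex.Re m * (w i * complex.Re (z i)) -
    2 * complex.Im m * (w i * complex.Im (z i)) + sqnorm m * w i)).
  by apply: eq_bigr => i _; case: (z i) m {mre mim} => [a b] [c f]; rewrite /sqnorm /=; ring.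
rewrite !big_split /= !sumrN -!mulr_sumr -mre -mim w1 /sqnorm; ring.
Qed.

Lemma real_cxM (a b : R) : (a * b)%:C = a%:C * b%:C :> Cx R.
Proof. exact: rmorphM. Qed.

Lemma real_cx_natV n : (n%:R^-1 : R)%:C = n%:R^-1 :> Cx R.
Proof. by rewrite -[LHS]/(real_complex R _) fmorphV rmorph_nat. Qed.

Lemma real_cx_sum (I : finType) (F : I -> R) : (\sum_i F i)%:C = \sum_i (F i)%:C :> Cx R.
Proof. exact: rmorph_sum. Qed.

(** The Fejer kernel of order [N], as a function of a unit complex number. *)
Definition fejer (N : nat) (u : Cx R) : R := N%:R^-1 * sqnorm (\sum_(a < N) u ^+ a).

Lemma fejer_ge0 N u : 0 <= fejer N u.
Proof. by rewrite mulr_ge0 ?invr_ge0 ?sqnorm_ge0. Qed.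

(** The factor 1 - u sums the geometric series to 1 - u^N, whose squared modulus is at most 4. *)
Lemma fejer_second_moment N u : (0 < N)%N -> sqnorm u = 1 ->
  sqnorm (1 - u) * fejer N u <= 4 / N%:R.
Proof.
move=> N0 u1; rewrite /fejer mulrCA -sqnormM -opprB mulNr sqnormN -subrX1 mulrC.
rewrite ler_wpM2r ?invr_ge0//; apply: le_trans (sqnormD_le _ _) _.
by rewrite sqnormN sqnormX u1 expr1n sqnorm1; lra.
Qed.

Lemma fejerE N u : sqnorm u = 1 ->
  (fejer N u)%:C = \sum_(a < N) \sum_(b < N) (N%:R^-1 : Cx R) * u ^ (a%:Z - b%:Z).
Proof.
move=> u1; have u0 : u != 0.
  by apply/eqP => u0; move: u1; rewrite u0 sqnorm0 => /esym/eqP; rewrite oner_eq0.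
rewrite /fejer real_cxM -mulcJ real_cx_natV mulr_suml mulr_sumr.
apply: eq_bigr => a _; rewrite rmorph_sum !mulr_sumr; apply: eq_bigr => b _.
by rewrite expfzDr// -invr_expz rmorphXn /= conjc_unit// exprVn.
Qed.

Definition root_of_unity (M : nat) (j : nat) : T := circle_param (j%:R / M%:R).
Arguments root_of_unity : simpl never.

(** For k != 0 this is a geometric sum of ratio q with q^M = 1, and the bound on [k] keeps q
    different from 1. *)
Lemma sum_root_of_unity M (k : int) : (0 < M)%N -> (`|k| < M)%N ->
  \sum_(j < M) sval (root_of_unity M j) ^ k = (k == 0)%:R * M%:R :> Cx R.
Proof.
move=> M0 kM; have [->|k0] := eqVneq k 0.
  under eq_bigr do rewrite expr0z.
  by rewrite sumr_const card_ord mul1r.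
rewrite mul0r.
have MR : (M%:R : R) != 0 by rewrite pnatr_eq0 -lt0n.
pose q := expi (k%:~R / M%:R : R).
have -> : \sum_(j < M) sval (root_of_unity M j) ^ k = \sum_(j < M) q ^+ j.
  apply: eq_bigr => j _; rewrite circle_paramE expi_expz expi_expn; congr expi.
  by rewrite mulrCA.
have kint : expi (k%:~R : R) = 1.
  by have := expi_expz (1 : R) k; rewrite mulr1 (expi_nat R 1) exp1rz.
have q1 : q != 1.
  have pos (n : nat) : (0 < n)%N -> (n < M)%N -> expi (n%:R / M%:R : R) != 1.
    move=> n0 nM; apply: expi_neq1; rewrite divr_gt0 ?ltr0n//= ltr_pdivrMr ?ltr0n//.
    by rewrite mul1r ltr_nat.
  rewrite /q; case: k k0 kM {kint q} => n k0 kM.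
    by apply: pos => //; rewrite lt0n.
  rewrite NegzE mulrNz mulNr expiN invr_eq1; exact: pos.
apply: (mulfI (_ : q - 1 != 0)); first by rewrite subr_eq0.
by rewrite -subrX1 mulr0 /q expi_expn mulrC divfK// kint subrr.
Qed.

End trigonometric_approximation.

(** * Uniform approximation by trigonometric polynomials *)

Section fejer_approximation.
Context (R : realType).
Local Notation T := (circle R).
Local Notation mu2 := (torus_measure R).
Implicit Types (phi : T * T -> Cx R) (x y : T * T).

(** Fejer averages sampled at the roots of unity instead of integrated: all frequencies are below
    [N] in absolute value, so the discrete mean of the kernel is exactly 1. *)
Definition fejer_weight N j (x : T) : R :=
  N%:R^-1 * fejer N (sval x * conjc (sval (root_of_unity R N j))).

Lemma circle_mulJ (x y : T) : sqnorm (sval x * conjc (sval y)) = 1.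
Proof. by rewrite sqnormM sqnormJ !circle_sqnorm mul1r. Qed.

Lemma fejer_weight_ge0 N j (x : T) : 0 <= fejer_weight N j x.
Proof. by rewrite mulr_ge0 ?invr_ge0 ?fejer_ge0. Qed.

Lemma fejer_weightE N j (x : T) :
  (fejer_weight N j x)%:C = \sum_(a < N) \sum_(b < N) (N%:R^-1 : Cx R) * (N%:R^-1 *
    (sval x ^ (a%:Z - b%:Z) * sval (root_of_unity R N j) ^ (b%:Z - a%:Z))).
Proof.
rewrite /fejer_weight real_cxM real_cx_natV (fejerE _ (circle_mulJ _ _)) mulr_sumr.
apply: eq_bigr => a _.
rewrite mulr_sumr; apply: eq_bigr => b _; congr (_ * (_ * _)).
have x0 := circle_neq0 x; have y0 := circle_neq0 (root_of_unity R N j).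
rewrite conjc_unit ?circle_sqnorm// exprzMl ?unitfE ?invr_eq0//.
by rewrite exprz_inv opprB.
Qed.

(** Summation over the roots keeps only the diagonal terms a = b, each of which contributes 1/N. *)
Lemma fejer_weight_sum N (x : T) : (0 < N)%N -> \sum_(j < N) fejer_weight N j x = 1.
Proof.
move=> N0; have NC : (N%:R : Cx R) != 0 by rewrite pnatr_eq0 -lt0n.
suff : (\sum_(j < N) fejer_weight N j x)%:C = 1 :> Cx R by move=> /(congr1 (@complex.Re R)).
rewrite real_cx_sum; under eq_bigr do rewrite fejer_weightE.
rewrite exchange_big /=; under eq_bigr do rewrite exchange_big /=.
transitivity (\sum_(a < N) (N%:R^-1 : Cx R)); last first.
  by rewrite sumr_const card_ord -[_ *+ N]mulr_natr mulVf.
apply: eq_bigr => a _.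
have inner_sum (b : 'I_N) : \sum_(j < N) (N%:R^-1 : Cx R) * (N%:R^-1 *
    (sval x ^ (a%:Z - b%:Z) * sval (root_of_unity R N j) ^ (b%:Z - a%:Z))) =
    N%:R^-1 * (N%:R^-1 * (sval x ^ (a%:Z - b%:Z) * ((b == a)%:R * N%:R))).
  have ab : (`|b%:Z - a%:Z| < N)%N by have := ltn_ord a; have := ltn_ord b; lia.
  have <- : \sum_(j < N) sval (root_of_unity R N j) ^ (b%:Z - a%:Z) = (b == a)%:R * N%:R :> Cx R.
    by rewrite (sum_root_of_unity _ N0 ab) subr_eq0 eqz_nat.
  by rewrite !mulr_sumr.
rewrite (eq_bigr _ (fun b _ => inner_sum b)) (bigD1 a) //= [X in _ + X]big1 ?addr0.
  by rewrite subrr expr0z eqxx !mul1r mulVf// mulr1.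
by move=> b /negbTE ->; rewrite mul0r !mulr0.
Qed.

Lemma fejer_weight_second_moment N (x : T) : (0 < N)%N ->
  \sum_(j < N) fejer_weight N j x * sqnorm (sval x - sval (root_of_unity R N j)) <= 4 / N%:R.
Proof.
move=> N0; have NR : (0 : R) < N%:R by rewrite ltr0n.
apply: (@le_trans _ _ (\sum_(j < N) N%:R^-1 * (4 / N%:R))).
  apply: ler_sum => j _; rewrite /fejer_weight -mulrA ler_pM2l ?invr_gt0// mulrC.
  set y := root_of_unity R N j.
  have -> : sqnorm (sval x - sval y) = sqnorm (1 - sval x * conjc (sval y)).
    rewrite -[LHS]mulr1 -(circle_sqnorm y) -(sqnormJ (sval y)) -sqnormM mulrBl mulcJ.
    by rewrite circle_sqnorm -sqnormN opprB.
  exact: fejer_second_moment N0 (circle_mulJ _ _).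
by rewrite sumr_const card_ord -[_ *+ N]mulr_natl mulrA divff ?mul1r// gt_eqF.
Qed.

Definition torus_weight N (ij : 'I_N * 'I_N) (x : T * T) :=
  fejer_weight N ij.1 x.1 * fejer_weight N ij.2 x.2.

Definition torus_root N (ij : 'I_N * 'I_N) : T * T :=
  (root_of_unity R N ij.1, root_of_unity R N ij.2).

Lemma torus_weight_ge0 N (ij : 'I_N * 'I_N) x : 0 <= torus_weight ij x.
Proof. by rewrite mulr_ge0 ?fejer_weight_ge0. Qed.

Lemma torus_weight_sum N x : (0 < N)%N -> \sum_(ij : 'I_N * 'I_N) torus_weight ij x = 1.
Proof.
move=> N0; rewrite /torus_weight.
rewrite -(pair_bigA _ (fun i j : 'I_N => fejer_weight N i x.1 * fejer_weight N j x.2)) /=.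
under eq_bigr do rewrite -mulr_sumr fejer_weight_sum// mulr1.
exact: fejer_weight_sum.
Qed.

Lemma torus_weight_second_moment N x : (0 < N)%N ->
  \sum_(ij : 'I_N * 'I_N) torus_weight ij x * sqdist x (torus_root ij) <= 8 / N%:R.
Proof.
move=> N0; rewrite (_ : 8 = 4 + 4 :> R); last by rewrite -natrD.
rewrite mulrDl /sqdist; under eq_bigr do rewrite mulrDr.
rewrite big_split /=; apply: lerD.
- rewrite -(pair_bigA _ (fun i j : 'I_N => fejer_weight N i x.1 * fejer_weight N j x.2 *
    sqnorm (sval x.1 - sval (root_of_unity R N i)))) /=.
  apply: le_trans (fejer_weight_second_moment x.1 N0).
  rewrite le_eqVlt; apply/orP; left; apply/eqP.
  apply: eq_bigr => i _; under eq_bigr do rewrite mulrAC.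
  by rewrite -mulr_sumr fejer_weight_sum// mulr1.
- rewrite -(pair_bigA _ (fun i j : 'I_N => fejer_weight N i x.1 * fejer_weight N j x.2 *
    sqnorm (sval x.2 - sval (root_of_unity R N j)))) /=.
  apply: le_trans (fejer_weight_second_moment x.2 N0).
  under eq_bigr do under eq_bigr do rewrite -mulrA.
  under eq_bigr do rewrite -mulr_sumr.
  by rewrite -mulr_suml fejer_weight_sum// mul1r.
Qed.

Lemma sum_funE (I : finType) (F : I -> T * T -> Cx R) x : (\sum_i F i) x = \sum_i F i x.
Proof.
elim: (index_enum I) => [|i r IHr]; first by rewrite !big_nil.
by rewrite !big_cons -IHr.
Qed.

Lemma trig_polynomial_torus_weight N (ij : 'I_N * 'I_N) :
  trig_polynomial N (fun x => (torus_weight ij x)%:C).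
Proof.
pose c a b a' b' : Cx R := N%:R^-1 * N%:R^-1 * (N%:R^-1 * N%:R^-1) *
  (sval (torus_root ij).1 ^ (b%:Z - a%:Z) * sval (torus_root ij).2 ^ (b'%:Z - a'%:Z)).
rewrite (_ : (fun x => _) = \sum_(a < N) \sum_(b < N) \sum_(a' < N) \sum_(b' < N)
  c a b a' b' *: monomial (a%:Z - b%:Z) (a'%:Z - b'%:Z)).
  have TL : lin_subspace (trig_polynomial (R := R) N) := lin_span_subspace _.
  apply: (lin_subspace_sum _ TL) => a; apply: (lin_subspace_sum _ TL) => b.
  apply: (lin_subspace_sum _ TL) => a'; apply: (lin_subspace_sum _ TL) => b'.
  apply: (lin_subspaceZ _ TL).
  apply: sub_lin_span; exists (a%:Z - b%:Z), (a'%:Z - b'%:Z); split => //.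
    by have := ltn_ord a; have := ltn_ord b; lia.
  by have := ltn_ord a'; have := ltn_ord b'; lia.
apply/funext => x.
rewrite /torus_weight real_cxM !fejer_weightE sum_funE mulr_suml; apply: eq_bigr => a _.
rewrite sum_funE mulr_suml; apply: eq_bigr => b _.
rewrite sum_funE mulr_sumr; apply: eq_bigr => a' _.
rewrite sum_funE mulr_sumr; apply: eq_bigr => b' _.
rewrite -[RHS]/(c a b a' b' * (sval x.1 ^ (a%:Z - b%:Z) * sval x.2 ^ (a'%:Z - b'%:Z))) /c.
set p1 := sval x.1 ^ _; set p2 := sval x.2 ^ _; set p3 := sval _ ^ _; set p4 := sval _ ^ _.
ring.
Qed.

(** The approximant is the average of the values of [phi] at pairs of roots of unity under
    [torus_weight]. By convexity its squared error at x is at most the average of e / 2 + C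
    [sqdist], and the second moment of the weights is at most 8 / N. *)
Lemma trig_approximation phi : continuous phi -> forall e : R, 0 < e ->
  exists N, exists2 q, trig_polynomial N q & forall x, sqnorm (phi x - q x) <= e.
Proof.
move=> cphi e e0; have [C C0 hC] := continuous_sqdist_bound cphi (divr_gt0 e0 (ltr0Sn _ 1)).
(* N exceeds 16 C / e, which makes C * (8 / N) at most e / 2. *)
pose N := (Num.truncn (16 * C / e)).+1; have N0 : (0 < N)%N by [].
have NR : (0 : R) < N%:R by rewrite ltr0n.
have hN : C * (8 / N%:R) <= e / 2.
  have := ltW (truncnS_gt (16 * C / e)); rewrite -/N.
  by rewrite ler_pdivrMr// mulrA ler_pdivrMr//; lra.
clearbody N.
exists N, (\sum_(ij : 'I_N * 'I_N) phi (torus_root ij) *: (fun x => (torus_weight ij x)%:C)).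
  have TL : lin_subspace (trig_polynomial (R := R) N) := lin_span_subspace _.
  apply: (lin_subspace_sum _ TL) => ij; apply: (lin_subspaceZ _ TL).
  exact: trig_polynomial_torus_weight.
move=> x; have W1 := torus_weight_sum x N0.
have -> : phi x - (\sum_(ij : 'I_N * 'I_N) phi (torus_root ij) *: (fun x => (torus_weight ij x)%:C)) x =
    \sum_(ij : 'I_N * 'I_N) (torus_weight ij x)%:C * (phi x - phi (torus_root ij)).
  rewrite sum_funE; under [RHS]eq_bigr do rewrite mulrBr.
  rewrite sumrB -mulr_suml -real_cx_sum W1 mul1r; congr (_ - _).
  by apply: eq_bigr => ij _; rewrite mulrC.
apply: le_trans (@sqnorm_convex R _ (fun ij => torus_weight ij x)
  (fun ij => phi x - phi (torus_root ij)) (fun ij => torus_weight_ge0 ij x) W1) _.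
apply: (@le_trans _ _ (\sum_(ij : 'I_N * 'I_N) torus_weight ij x * (e / 2 + C * sqdist x (torus_root ij)))).
  by apply: ler_sum => ij _; rewrite ler_wpM2l ?torus_weight_ge0.
under eq_bigr do rewrite mulrDr.
rewrite big_split /= -mulr_suml W1 mul1r [leRHS](splitr e) lerD2l.
apply: le_trans hN; apply: le_trans (ler_wpM2l C0 (torus_weight_second_moment x N0)).
by rewrite mulr_sumr; apply: ler_sum => ij _; rewrite mulrCA.
Qed.

Lemma cmeasurable_monomial m n : cmeasurable (@monomial R m n).
Proof.
by apply: cmeasurableM; [exact: (cmeasurable_fst (cmeasurable_expz R m))|
  exact: (cmeasurable_snd (cmeasurable_expz R n))].
Qed.

Lemma bounded_measurable_monomial m n : bounded_measurable (@monomial R m n).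
Proof.
split; first exact: cmeasurable_monomial.
by exists 1 => x; rewrite sqnormM !circle_sqnorm_expz mulr1.
Qed.

Lemma bounded_measurable_trig N (q : T * T -> Cx R) : trig_polynomial N q -> bounded_measurable q.
Proof.
apply: (lin_span_min (B := [set q : T * T -> Cx R | bounded_measurable q])).
  split; first exact: (@bounded_measurable_cst _ _ R 0).
  move=> k f g bf bg; apply: bounded_measurableD => //.
  by apply: bounded_measurableM => //; exact: bounded_measurable_cst.
by move=> _ [m [n [_ _ ->]]]; exact: bounded_measurable_monomial.
Qed.

(** Measurability for the product sigma-algebra holds because [phi] is a pointwise limit of
    trigonometric polynomials, whose monomials are products of functions of one variable. *)
Lemma bounded_measurable_continuous phi : continuous phi -> bounded_measurable phi.
Proof.
move=> cphi; split; last by have [M _ hM] := continuous_sqnorm_bound cphi; exists M.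
have /choice[q hq] : forall n, exists q : T * T -> Cx R, cmeasurable q /\
    forall x, sqnorm (phi x - q x) <= ((2 ^+ n)^-1) ^+ 2.
  move=> n; have [|N [q tq hq]] := trig_approximation cphi (e := ((2 ^+ n)^-1) ^+ 2).
    by rewrite exprn_gt0// invr_gt0 exprn_gt0.
  by exists q; split => //; have [] := bounded_measurable_trig tq.
have lim (p : Cx R -> R) x : (forall z w, p z - p w = p (z - w)) ->
    (forall z, p z ^+ 2 <= sqnorm z) -> (fun n => p (q n x)) @ \oo --> p (phi x).
  move=> pB psq; apply/cvgrPdist_le => e e0.
  have [k hk] := expN2_small 1 e0; exists k => // n /= kn.
  rewrite pB -sqrtr_sqr; apply: le_trans (ler_wsqrtr (le_trans (psq _) ((hq n).2 x))) _.
  rewrite sqrtr_sqr ger0_norm ?invr_ge0 ?exprn_ge0//; apply: le_trans (ltW hk).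
  by rewrite mul1r lef_pV2 ?posrE ?exprn_gt0// ler_weXn2l ?ler1n.
split.
- apply: (@measurable_fun_cvg _ _ _ _ (fun n x => complex.Re (q n x))).
    by move=> n; case: (hq n) => -[].
  by move=> x _; apply: lim => [[? ?] [? ?]|[? ?]] //=; rewrite /sqnorm /= lerDl sqr_ge0.
- apply: (@measurable_fun_cvg _ _ _ _ (fun n x => complex.Im (q n x))).
    by move=> n; case: (hq n) => -[].
  by move=> x _; apply: lim => [[? ?] [? ?]|[? ?]] //=; rewrite /sqnorm /= lerDr sqr_ge0.
Qed.

End fejer_approximation.

(** * Orthogonality and Fourier projections *)

Section projections.
Context d (X : measurableType d) (R : realType) (mu : {measure set X -> \bar R}).
Local Notation H := (L2 mu).
Implicit Types (u v w : H) (S : set H).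

Lemma sub_L2_closure S : S `<=` L2_closure S.
Proof. by move=> u Su e e0; exists u => //; rewrite subrr hnorm0. Qed.

Lemma L2_closure_subspace S : lin_subspace S -> lin_subspace (L2_closure S).
Proof.
move=> [S0 SL]; split; first exact: sub_L2_closure.
move=> k u v uS vS e e0.
pose s := Num.sqrt (sqnorm k) + 1.
have s0 : 0 < s by rewrite ltr_wpDl ?sqrtr_ge0.
have e2 : 0 < e / 2 by rewrite divr_gt0.
have [u' Su uu'] := uS _ (divr_gt0 e2 s0); have [v' Sv vv'] := vS _ e2.
exists (k *: u' + v'); first exact: SL.
rewrite opprD addrACA -scalerBr; apply: le_lt_trans (hnormD _ _) _.
rewrite (splitr e); apply: ler_ltD => //; rewrite hnormZ.
apply: (@le_trans _ _ (s * hnorm (u - u'))).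
  by rewrite ler_wpM2r ?hnorm_ge0// lerDl.
by rewrite mulrC -ler_pdivlMr// ltW.
Qed.

Lemma orthogonal_closure S u :
  (forall v, S v -> inner u v = 0) -> forall v, L2_closure (lin_span S) v -> inner u v = 0.
Proof.
move=> uS; have uL v : lin_span S v -> inner u v = 0.
  apply: (lin_span_min (B := [set v | inner u v = 0])) => //.
  split; first exact: inner0r.
  by move=> k x y /= ux uy; rewrite innerDr innerZr ux uy mulr0 addr0.
move=> v vS; apply: sqnorm_eq0; apply/eqP; rewrite eq_le sqnorm_ge0 andbT.
apply/ler_addgt0Pr => e e0; rewrite add0r.
pose k := sqn u + 1.
have k0 : 0 < k by rewrite ltr_wpDl ?sqn_ge0.
have [|w Sw vw] := vS (Num.sqrt (e / k)); first by rewrite sqrtr_gt0 divr_gt0.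
rewrite -[v](subrK w) innerDr (uL _ Sw) addr0.
apply: le_trans (cauchy_schwarz _ _) _.
have /(ler_pM (sqn_ge0 u) (sqn_ge0 (v - w))) : sqn u <= k by rewrite lerDl.
move=> /(_ (e / k)); rewrite mulrCA divff ?gt_eqF// mulr1; apply.
have := ltW vw; rewrite hnorm_leP ?sqrtr_ge0// sqr_sqrtr// divr_ge0 ?ltW//.
Qed.

Definition orthonormal (I : eqType) (E : I -> H) := forall i j, inner (E i) (E j) = (i == j)%:R.

Definition fourier_proj (I : finType) (E : I -> H) u : H := \sum_i inner u (E i) *: E i.

Lemma fourier_proj_linear (I : finType) (E : I -> H) : linear (fourier_proj E).
Proof.
move=> k u v; rewrite /fourier_proj scaler_sumr -big_split /=; apply: eq_bigr => i _.
by rewrite innerDl innerZl scalerDl scalerA.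
Qed.

Lemma fourier_proj_adjoint (I : finType) (E : I -> H) :
  is_adjoint (fourier_proj E) (fourier_proj E).
Proof.
move=> u v; rewrite inner_suml inner_sumr; apply: eq_bigr => i _.
by rewrite innerZl innerZr mulrC (innerC v (E i)).
Qed.

Lemma fourier_proj_id (I : finType) (E : I -> H) i : orthonormal E -> fourier_proj E (E i) = E i.
Proof.
move=> oE; rewrite /fourier_proj (bigD1 i)//= oE eqxx scale1r big1 ?addr0//.
by move=> j ji; rewrite oE eq_sym (negbTE ji) scale0r.
Qed.

Lemma fourier_proj_idem (I : finType) (E : I -> H) u : orthonormal E ->
  fourier_proj E (fourier_proj E u) = fourier_proj E u.
Proof.
move=> oE; rewrite [RHS]/fourier_proj /fourier_proj; apply: eq_bigr => i _.
by rewrite -/(fourier_proj E u) fourier_proj_adjoint fourier_proj_id.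
Qed.

Lemma sqn_selfadjoint_proj (p : H -> H) u : is_adjoint p p -> p (p u) = p u ->
  inner u (p u) = (sqn (p u))%:C.
Proof. by move=> ap pp; rewrite -inner_sqn ap pp. Qed.

(** The squared norm of u - p u is |u|^2 - |p u|^2. *)
Lemma selfadjoint_proj_le (p : H -> H) u : is_adjoint p p -> p (p u) = p u ->
  sqn (p u) <= sqn u.
Proof.
move=> ap pp; have := sqn_ge0 (u - p u).
by rewrite sqnB (sqn_selfadjoint_proj ap pp) /=; lra.
Qed.

Lemma bessel (I : finType) (E : I -> H) u : orthonormal E ->
  \sum_i sqnorm (inner u (E i)) <= sqn u.
Proof.
move=> oE; have := selfadjoint_proj_le (@fourier_proj_adjoint I E) (fourier_proj_idem u oE).
rewrite [X in X <= _ -> _](_ : _ = \sum_i sqnorm (inner u (E i)))//.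
apply: complexI; rewrite -sqn_selfadjoint_proj ?fourier_proj_idem//; last exact: fourier_proj_adjoint.
rewrite inner_sumr rmorph_sum; apply: eq_bigr => i _.
by rewrite innerZr mulrC mulcJ.
Qed.

(* Monotone bounded norms make an increasing sequence of projections strongly Cauchy. *)
Lemma increasing_projections (s : nat -> H -> H) : (forall n, linear (s n)) ->
  (forall n, is_adjoint (s n) (s n)) ->
  (forall m n u, (m <= n)%N -> s m (s n u) = s m u) ->
  exists c, [/\ bounded_op c, is_adjoint c c & forall u (e : R), 0 < e ->
    exists N, forall n, (N <= n)%N -> hnorm (s n u - c u) <= e].
Proof.
move=> ls ss smn.
have sle n u : sqn (s n u) <= sqn u by apply: selfadjoint_proj_le => //; exact: smn.
have sB m n u : (m <= n)%N -> sqn (s n u - s m u) = sqn (s n u) - sqn (s m u).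
  move=> mn; rewrite sqnB; have -> : inner (s n u) (s m u) = (sqn (s m u))%:C.
    by rewrite -inner_sqn -{1}(smn m m u (leqnn m)) -(ss m) (smn m n u mn).
  by rewrite /=; lra.
have [n u|u e e0|c bc hc] := @strong_limit _ _ _ _ s 1 ls.
- by rewrite mul1r hnorm_leP ?hnorm_ge0// hnorm2.
- pose r n := sqn (s n u).
  have rnd : nondecreasing_seq r.
    by move=> m n mn; rewrite -subr_ge0 -sB// sqn_ge0.
  have : cvgn r by apply: nondecreasing_is_cvgn => //; exists (sqn u) => _ [n _ <-]; exact: sle.
  move=> cr; have := nondecreasing_cvgn_le rnd cr.
  have /cvgrPdist_le/(_ (e ^+ 2) (exprn_gt0 2 e0))[N _ hN] := cr.
  move=> rle; exists N => n Nn; rewrite hnorm_leP ?(ltW e0)// sB//.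
  have := hN N (leqnn N); have := rle n; rewrite -/(r n) -/(r N) /=.
  by rewrite ler_norml => ? /andP[_ ?]; lra.
exists c; split => // u v; apply/eqP; rewrite -subr_eq0; apply/eqP/sqnorm_eq0.
apply/eqP; rewrite eq_le sqnorm_ge0 andbT; apply/ler_addgt0Pr => e e0; rewrite add0r.
pose k := 2 * sqn v + 2 * sqn u + 1.
have k0 : 0 < k by have := sqn_ge0 u; have := sqn_ge0 v; rewrite /k; lra.
have q0 : 0 < Num.sqrt (e / k) by rewrite sqrtr_gt0 divr_gt0.
have [N1 h1] := hc u _ q0; have [N2 h2] := hc v _ q0.
pose n := maxn N1 N2.
have d1 : sqn (s n u - c u) <= e / k.
  have := h1 n (leq_maxl _ _); rewrite hnorm_leP ?(ltW q0)// sqr_sqrtr// divr_ge0// ltW//.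
have d2 : sqn (s n v - c v) <= e / k.
  have := h2 n (leq_maxr _ _); rewrite hnorm_leP ?(ltW q0)// sqr_sqrtr// divr_ge0// ltW//.
have -> : inner (c u) v - inner u (c v) = - inner (s n u - c u) v + inner u (s n v - c v).
  by rewrite innerBl innerBr (ss n u v); ring.
apply: le_trans (sqnormD_le _ _) _; rewrite sqnormN.
have b1 := cauchy_schwarz (s n u - c u) v; have b2 := cauchy_schwarz u (s n v - c v).
have c1 := ler_wpM2r (sqn_ge0 v) d1; have c2 := ler_wpM2l (sqn_ge0 u) d2.
have ek : e / k * k = e by rewrite divfK// gt_eqF.
have ek0 : 0 <= e / k by rewrite divr_ge0 ?ltW.
rewrite -[leRHS]ek /k; set q := e / k in c1 c2 ek0 *; nra.
Qed.

End projections.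

(** * The Hardy projection, the shifts and their tensors *)

Lemma xget_cases (T : choiceType) (x0 : T) (P : set T) : xget x0 P = x0 \/ P (xget x0 P).
Proof. by case: xgetP; [right|left]. Qed.

Section hardy_projection.
Context (R : realType).
Local Notation T := (circle R).
Local Notation mu := (circle_measure R).
Local Notation mu2 := (torus_measure R).
Local Notation H := (L2 mu).
Local Notation H2 := (L2 mu2).
Local Notation op := (H -> H).
Local Notation op2 := (H2 -> H2).
Local Notation e_ := (zpow R).
Implicit Types (u v w : H) (a b : op).

Lemma hardy_subspace : lin_subspace (@hardy R).
Proof. exact: L2_closure_subspace (lin_span_subspace _). Qed.

Lemma hardy_zpow (m : nat) : hardy (e_ m).
Proof. by apply: sub_L2_closure; apply: sub_lin_span; exists m. Qed.

Definition hardy_proj_spec (p : op) :=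
  forall u, hardy (p u) /\ forall v, hardy v -> inner (u - p u) v = 0.

(** [PT] is chosen, with default value 0. A character that is non-zero at [PT] excludes the default,
    and this is how the existence of the projection is obtained. *)
Lemma PT_spec : @PT R != 0 -> hardy_proj_spec (@PT R).
Proof.
move=> P0; have [PE|//] := xget_cases 0 [set p : op | hardy_proj_spec p].
by case/eqP: P0; exact: PE.
Qed.

(** [op_tensor] is 0 when no bounded operator has the required values, so existence is tracked,
    starting from shifts and the Hardy projection. *)
Definition tensorable a b := exists c : op2, bounded_op c /\
  forall u v, c (tensor u v) = tensor (a u) (b v).

Lemma op_tensorP a b : tensorable a b ->
  bounded_op (op_tensor a b) /\ forall u v, op_tensor a b (tensor u v) = tensor (a u) (b v).
Proof.
by move=> [c hc]; exact: (xgetI (P := [set c : op2 | bounded_op c /\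
  forall u v, c (tensor u v) = tensor (a u) (b v)]) 0 hc).
Qed.

Lemma op_tensor_uniq a b (c : op2) : bounded_op c ->
  (forall u v, c (tensor u v) = tensor (a u) (b v)) -> op_tensor a b = c.
Proof.
move=> bc hc; have [|bt ht] := @op_tensorP a b; first by exists c.
by apply: bounded_op_tensor_ext => // u v; rewrite ht hc.
Qed.

Lemma op_tensor_junk a b : ~ tensorable a b -> op_tensor a b = 0.
Proof.
move=> nt; rewrite /op_tensor; case: xgetP => // p _ hp.
by exfalso; apply: nt; exists p.
Qed.

Lemma op_tensor_bounded a b : bounded_op (op_tensor a b).
Proof.
have [/op_tensorP[]//|/op_tensor_junk ->] := pselect (tensorable a b).
exact: bounded_op0.
Qed.

Lemma tensorable_comp a b a' b' : tensorable a b -> tensorable a' b' ->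
  tensorable (a \o a') (b \o b').
Proof.
move=> [c [bc hc]] [c' [bc' hc']]; exists (c \o c'); split; first exact: bounded_op_comp.
by move=> u v /=; rewrite hc' hc.
Qed.

Lemma op_tensor_comp a b a' b' : tensorable a b -> tensorable a' b' ->
  op_tensor a b \o op_tensor a' b' = op_tensor (a \o a') (b \o b').
Proof.
move=> /op_tensorP[bt ht] /op_tensorP[bt' ht'].
apply/esym/op_tensor_uniq; first exact: bounded_op_comp.
by move=> u v /=; rewrite ht' ht.
Qed.

Definition shift (m : int) : op := mulop (fun x : T => sval x ^ m).

Lemma bounded_measurable_expz (m : int) : bounded_measurable (fun x : T => sval x ^ m).
Proof. by split; [exact: cmeasurable_expz|exists 1 => x; rewrite circle_sqnorm_expz]. Qed.

Lemma shift_bounded m : bounded_op (shift m).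
Proof. exact: mulop_bounded (bounded_measurable_expz m). Qed.

Lemma shift_zpow m n : shift m (e_ n) = e_ (m + n).
Proof.
rewrite /shift (mulop_class (bounded_measurable_expz m) (sqintegrable_expz R n)).
congr (L2_class _ _); apply/funext => x; by rewrite expfzDr// circle_neq0.
Qed.

Lemma shiftD m n : shift m \o shift n = shift (m + n).
Proof.
rewrite /shift (mulop_comp _ (bounded_measurable_expz m) (bounded_measurable_expz n)).
by congr mulop; apply/funext => x; rewrite expfzDr// circle_neq0.
Qed.

Lemma shift0 : shift 0 = idfun.
Proof. by rewrite -mulop1; congr mulop; apply/funext => x; rewrite expr0z. Qed.

Lemma shift_adjoint m : is_adjoint (shift m) (shift (- m)).
Proof.
have := @mulop_adjoint _ _ _ mu _ (bounded_measurable_expz m).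
rewrite (_ : (fun x : T => conjc _) = fun x : T => sval x ^ (- m))//.
by apply/funext => x; rewrite conjc_expz.
Qed.

Lemma mulop_monomial_tensor m n u v :
  mulop (@monomial R m n) (tensor u v) = tensor (shift m u) (shift n v) :> H2.
Proof.
have [f sf ->] := L2_classP u; have [g sg ->] := L2_classP v.
have bm := bounded_measurable_expz m; have bn := bounded_measurable_expz n.
rewrite (tensor_class sf sg).
rewrite (mulop_class (bounded_measurable_monomial R m n) (sqintegrable_tensor sf sg)).
rewrite /shift (mulop_class bm sf) (mulop_class bn sg).
rewrite (tensor_class (sqintegrableM bm sf) (sqintegrableM bn sg)).
by congr (L2_class _ _); apply/funext => x; rewrite /monomial; ring.
Qed.

Lemma tensorable_shift m n : tensorable (shift m) (shift n).
Proof.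
exists (mulop (@monomial R m n)); split; last exact: mulop_monomial_tensor.
exact: mulop_bounded (bounded_measurable_monomial R m n).
Qed.

Lemma op_tensor_shift m n : op_tensor (shift m) (shift n) = mulop (@monomial R m n).
Proof.
apply: op_tensor_uniq; last exact: mulop_monomial_tensor.
exact: mulop_bounded (bounded_measurable_monomial R m n).
Qed.

Context (P : op) (HP : hardy_proj_spec P).

(** The vector P u - w lies in the Hardy space and is orthogonal to it. *)
Lemma hardy_proj_uniq u w : hardy w -> (forall v, hardy v -> inner (u - w) v = 0) -> P u = w.
Proof.
move=> hw uw; have [hPu uP] := HP u; apply/eqP; rewrite -subr_eq0; apply/eqP/hnorm_eq0.
have hB : hardy (P u - w) by exact: (lin_subspaceB hardy_subspace hPu hw).
rewrite /hnorm; have -> : inner (P u - w) (P u - w) = 0.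
  rewrite -[X in inner X _](subrKA u) innerDl uw// addr0 -opprB innerNl uP//.
  by rewrite oppr0.
by rewrite /= sqrtr0.
Qed.

Lemma hardy_proj_id u : hardy u -> P u = u.
Proof. by move=> hu; apply: hardy_proj_uniq => // v _; rewrite subrr inner0l. Qed.

Lemma hardy_proj_idem : P \o P = P.
Proof. by apply/funext => u /=; apply: hardy_proj_id; case: (HP u). Qed.

Lemma hardy_proj_adjoint : is_adjoint P P.
Proof.
have h u v : inner (P u) (P v) = inner u (P v).
  have [hv _] := HP v; have [_ /(_ _ hv)] := HP u.
  by rewrite innerBl => /eqP; rewrite subr_eq0 => /eqP ->.
by move=> u v; rewrite -h innerC -h -innerC.
Qed.

Lemma hardy_proj_linear : linear P.
Proof.
move=> k u v; have [hu ou] := HP u; have [hv ov] := HP v.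
apply: hardy_proj_uniq; first by case: hardy_subspace => _; apply.
by move=> w hw; rewrite opprD addrACA -scalerBr innerDl innerZl ou// ov// mulr0 addr0.
Qed.

Lemma hardy_proj_le u : hnorm (P u) <= hnorm u.
Proof.
rewrite hnorm_leP ?hnorm_ge0// hnorm2; apply: selfadjoint_proj_le; first exact: hardy_proj_adjoint.
by rewrite -[LHS]/((P \o P) u) hardy_proj_idem.
Qed.

Lemma hardy_proj_bounded : bounded_op P.
Proof.
by split; [exact: hardy_proj_linear|exists 1 => u; rewrite mul1r; exact: hardy_proj_le].
Qed.

Lemma hardy_proj_zpow (m : int) : P (e_ m) = if 0 <= m then e_ m else 0.
Proof.
case: (leP 0 m) => [|m0].
  by case: m => // n _; apply: hardy_proj_id; exact: hardy_zpow.
apply: hardy_proj_uniq; first by case: hardy_subspace.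
apply: orthogonal_closure => _ [n _ <-]; rewrite subr0 inner_zpow.
by case: m m0 => // m; rewrite ltNge.
Qed.

Definition hardy_trunc N u : H := fourier_proj (fun i : 'I_N => e_ i) u.

Lemma orthonormal_zpow N : orthonormal (fun i : 'I_N => e_ (i : nat)).
Proof. by move=> i j; rewrite inner_zpow eqz_nat. Qed.

Lemma hardy_trunc_id N (m : nat) : (m < N)%N -> hardy_trunc N (e_ m) = e_ m.
Proof. by move=> mN; exact: (fourier_proj_id (Ordinal mN) (@orthonormal_zpow N)). Qed.

Lemma hardy_trunc_le N u : hnorm (hardy_trunc N u) <= hnorm u.
Proof.
rewrite hnorm_leP ?hnorm_ge0// hnorm2; apply: selfadjoint_proj_le.
  exact: fourier_proj_adjoint.
by apply: fourier_proj_idem; exact: orthonormal_zpow.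
Qed.

(** On the span of the z^m with m >= 0 the truncations are eventually the identity. They are
    contractions and factor through [P], so density gives strong convergence. *)
Lemma hardy_trunc_cvg u (e : R) : 0 < e ->
  exists N, forall n, (N <= n)%N -> hnorm (hardy_trunc n u - P u) <= e.
Proof.
move=> e0; have e2 : 0 < e / 2 by rewrite divr_gt0.
have [h hs uh] := (HP u).1 _ e2.
have [N hN] : exists N, forall n, (N <= n)%N -> hardy_trunc n h = h.
  move: hs; apply: (lin_span_min (B := [set h | exists N, forall n, (N <= n)%N -> hardy_trunc n h = h])).
    split.
      by exists 0%N => n _; exact: (linear_op0 (@fourier_proj_linear _ _ _ _ _ _)).
    move=> k v w [N1 h1] [N2 h2]; exists (maxn N1 N2) => n.
    rewrite geq_max => /andP[n1 n2].
    by rewrite /hardy_trunc (fourier_proj_linear _ k v w) -/(hardy_trunc n v) -/(hardy_trunc n w) h1// h2.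
  by move=> _ [m _ <-]; exists m.+1 => n; exact: hardy_trunc_id.
exists N => n Nn.
have -> : hardy_trunc n u = hardy_trunc n (P u).
  rewrite /hardy_trunc /fourier_proj; apply: eq_bigr => i _; congr (_ *: _).
  by rewrite (hardy_proj_adjoint u (e_ i)) (hardy_proj_id (hardy_zpow i)).
apply: le_trans (hnormB_tri h _ _) _; rewrite (splitr e); apply: lerD.
  rewrite -{1}(hN n Nn) -(linear_opB _ _ (@fourier_proj_linear _ _ _ _ _ _)).
  by apply: le_trans (hardy_trunc_le _ _) _; exact: ltW.
by rewrite hnormBC; exact: ltW.
Qed.

(** The tensor square of [P] is the strong limit of the Fourier projections onto tensors with both
    exponents below [N], which are tensor squares of truncations. *)
Lemma torus_projection : exists c : op2, [/\ bounded_op c, is_adjoint c c &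
  forall u v, c (tensor u v) = tensor (P u) (P v)].
Proof.
pose E N (ij : 'I_N * 'I_N) : H2 := tensor (e_ (ij.1 : nat)) (e_ (ij.2 : nat)).
have oE N : orthonormal (@E N).
  by move=> [i j] [k l]; rewrite /E inner_tensor !inner_zpow !eqz_nat /= -natrM mulnb.
pose s N := fourier_proj (@E N).
have ls N : linear (s N) := fourier_proj_linear _.
have ss N : is_adjoint (s N) (s N) := @fourier_proj_adjoint _ _ _ _ _ _.
have [m n w mn|c [bc ac hc]] := increasing_projections ls ss.
  rewrite /s {1 3}/fourier_proj; apply: eq_bigr => -[i j] _; congr (_ *: _).
  rewrite ss; congr inner.
  exact: (fourier_proj_id (widen_ord mn i, widen_ord mn j) (oE n)).
exists c; split => // u v; apply/eqP; rewrite -subr_eq0; apply/eqP.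
apply: (@hnorm_small _ _ _ _ _ (1 + (hnorm v + hnorm u))) => e e0.
have [N1 h1] := hc (tensor u v) e e0.
have [N2 h2] := hardy_trunc_cvg u e0; have [N3 h3] := hardy_trunc_cvg v e0.
pose n := maxn N1 (maxn N2 N3).
have n1 : (N1 <= n)%N by rewrite leq_maxl.
have n2 : (N2 <= n)%N by rewrite !leq_max leqnn !orbT.
have n3 : (N3 <= n)%N by rewrite !leq_max leqnn !orbT.
have sE : s n (tensor u v) = tensor (hardy_trunc n u) (hardy_trunc n v).
  rewrite /hardy_trunc {2}/fourier_proj tensor_suml.
  under [RHS]eq_bigr do rewrite tensorZl /fourier_proj tensor_sumr scaler_sumr.
  rewrite pair_bigA /=; apply: eq_bigr => -[i j] _ /=.
  by rewrite inner_tensor tensorZr scalerA.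
apply: le_trans (hnormB_tri (s n (tensor u v)) _ _) _.
rewrite [leRHS]mulrDr mulr1; apply: lerD; first by rewrite hnormBC; exact: h1.
rewrite sE; apply: le_trans (hnormB_tri (tensor (P u) (hardy_trunc n v)) _ _) _.
rewrite -tensorBl -tensorBr !hnorm_tensor mulrDr; apply: lerD.
  apply: ler_pM; rewrite ?hnorm_ge0//; [exact: h2|exact: hardy_trunc_le].
rewrite mulrC; apply: ler_pM; rewrite ?hnorm_ge0//; [exact: h3|exact: hardy_proj_le].
Qed.

Lemma tensorable_hardy_proj : tensorable P P.
Proof. by have [c [bc _ hc]] := torus_projection; exists c. Qed.

Lemma torus_projection_adjoint : is_adjoint (op_tensor P P) (op_tensor P P).
Proof. by have [c [bc ac hc]] := torus_projection; rewrite (op_tensor_uniq bc hc). Qed.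

Lemma torus_projection_idem : op_tensor P P \o op_tensor P P = op_tensor P P.
Proof.
by rewrite (op_tensor_comp tensorable_hardy_proj tensorable_hardy_proj) hardy_proj_idem.
Qed.

End hardy_projection.

(** * Operators that tend to 0 along a sequence of vectors *)

Lemma hnormE d (X : measurableType d) (R : realType) (mu : {measure set X -> \bar R})
  (u : L2 mu) : hnorm u = Num.sqrt (sqn u).
Proof. by []. Qed.

Lemma sqn_zpow (R : realType) m : sqn (zpow R m) = 1.
Proof. by rewrite /sqn inner_zpow eqxx. Qed.

Section annihilated_sequences.
Context d (X : measurableType d) (R : realType) (mu : {measure set X -> \bar R}).
Local Notation H := (L2 mu).
Local Notation op := (H -> H).
Implicit Types (a b : op) (g : nat -> H) (S : set op).

Definition annihilates g a :=
  forall e : R, 0 < e -> exists N, forall n, (N <= n)%N -> hnorm (a (g n)) <= e.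

Lemma annihilates_subspace g : lin_subspace [set a | annihilates g a].
Proof.
split=> [e e0|k a b ga gb e e0].
  by exists 0%N => n _; rewrite -[(0 : op) _]/(0 : H) hnorm0 ltW.
pose s := Num.sqrt (sqnorm k) + 1.
have s0 : 0 < s by rewrite ltr_wpDl ?sqrtr_ge0.
have e2 : 0 < e / 2 by rewrite divr_gt0.
have [N1 h1] := ga _ (divr_gt0 e2 s0); have [N2 h2] := gb _ e2.
exists (maxn N1 N2) => n; rewrite geq_max => /andP[n1 n2].
rewrite -[(k *: a + b) _]/(k *: a (g n) + b (g n)); apply: le_trans (hnormD _ _) _.
rewrite (splitr e); apply: lerD; last exact: h2.
rewrite hnormZ; apply: (@le_trans _ _ (s * hnorm (a (g n)))).
  by rewrite ler_wpM2r ?hnorm_ge0// lerDl.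
by rewrite mulrC -ler_pdivlMr// h1.
Qed.

Lemma annihilates_closure g S : (forall n, hnorm (g n) <= 1) ->
  S `<=` @bounded_op _ _ _ mu -> (forall a, S a -> annihilates g a) ->
  forall a, op_closure S a -> annihilates g a.
Proof.
move=> g1 SB Sg a aS e e0; have e2 : 0 < e / 2 by rewrite divr_gt0.
have [b Sb ab] := op_closure_approx SB aS e2.
have [N hN] := Sg _ Sb _ e2; exists N => n Nn.
rewrite -[a (g n)](subrK (b (g n))); apply: le_trans (hnormD _ _) _.
rewrite (splitr e); apply: lerD; last exact: hN.
by apply: le_trans (ab _) _; rewrite ler_piMr ?(ltW e2).
Qed.

End annihilated_sequences.

(** * Positive operators as positive semi-definite forms *)

Section positive_operators.
Context d (X : measurableType d) (R : realType) (mu : {measure set X -> \bar R}).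
Local Notation H := (L2 mu).
Context (k : H -> H) (kpos : positive_op k).
Implicit Types (u v : H).

Let q u : R := complex.Re (inner (k u) u).

Let lk : linear k. Proof. by case: kpos => -[]. Qed.

Lemma positive_form_real u : inner (k u) u = (q u)%:C.
Proof.
have [_ /(_ u)] := kpos; rewrite lecE => /andP[/eqP im _].
by apply: cx_eqP => //=; rewrite im.
Qed.

Lemma positive_form_ge0 u : 0 <= q u.
Proof. by have [_ /(_ u)] := kpos; rewrite positive_form_real lecR. Qed.

(** The form is real on the diagonal; evaluating it at t u + v with t = 1 and t = i compares
    imaginary and real parts of the mixed terms. *)
Lemma positive_form_hermitian u v : inner (k v) u = conjc (inner (k u) v).
Proof.
pose ii : Cx R := 0 +i* 1.
have h (t : Cx R) : complex.Im (t * inner (k u) v + conjc t * inner (k v) u) = 0.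
  have := positive_form_real (t *: u + v).
  rewrite lk innerDl !innerDr !innerZl !innerZr !positive_form_real => /(congr1 (@complex.Im R)).
  by case: t (inner _ v) (inner _ u) => [a b] [c e] [f g] /=; lra.
have h1 := h 1; have h2 := h ii; move: h1 h2.
case: (inner (k u) v) (inner (k v) u) => [a b] [c e] /= h1 h2.
apply: cx_eqP => /=; lra.
Qed.

(** Positivity at t u - c v makes a quadratic polynomial in t non-negative; it is evaluated at its
    minimum |c|^2 / q(u). *)
Lemma positive_form_cauchy_schwarz u v : sqnorm (inner (k u) v) <= q u * q v.
Proof.
set c := inner (k u) v.
have key (t : R) : 0 <= q u * t ^+ 2 - 2 * sqnorm c * t + sqnorm c * q v.
  have := positive_form_ge0 (t%:C *: u - c *: v).
  rewrite /q -scaleNr (linear_opD _ _ lk) !(linear_opZ _ _ lk).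
  rewrite !(innerDl, innerDr, innerZl, innerZr) (positive_form_hermitian u v) -/c.
  rewrite !positive_form_real; case: c => a b; rewrite /sqnorm /= => h.
  by apply: le_trans h _; rewrite le_eqVlt; apply/orP; left; apply/eqP; ring.
have [qu0|qu0] := eqVneq (q u) 0.
  (* With q(u) = 0 the polynomial is affine of slope -2 |c|^2, and a large t forces c = 0. *)
  rewrite qu0 mul0r; have := key (q v + 1); rewrite qu0.
  have := positive_form_ge0 v; have := sqnorm_ge0 c; set s := sqnorm c; set y := q v; nra.
have qup : 0 < q u by rewrite lt_def qu0 positive_form_ge0.
have := key (sqnorm c / q u).
have [->|c0] := eqVneq (sqnorm c) 0; first by rewrite mulr_ge0 ?positive_form_ge0.
have cp : 0 < sqnorm c by rewrite lt_def c0 sqnorm_ge0.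
rewrite (_ : _ + _ = sqnorm c / q u * (q u * q v - sqnorm c)); last by field.
by rewrite pmulr_rge0 ?divr_gt0// subr_ge0.
Qed.

(** Convexity of a squared seminorm; the two-term step is positivity at x - n y. *)
Lemma positive_form_sum n (w : nat -> H) :
  q (\sum_(i < n) w i) <= n%:R * \sum_(i < n) q (w i).
Proof.
elim: n => [|n IHn]; first by rewrite !big_ord0 mul0r /q (linear_op0 lk) inner0l.
rewrite !big_ord_recr /=; set x := \sum_(i < n) w i; set y := w n.
set s := \sum_(i < n) q (w i); rewrite -/x -/s in IHn.
have [n0|n0] := posnP n.
  by rewrite /x /s n0 !big_ord0 !add0r mul1r.
have nR : (0 : R) < n%:R by rewrite ltr0n.
have key : n%:R * q (x + y) <= n.+1%:R * (q x + n%:R * q y).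
  have := positive_form_ge0 (x - n%:R%:C *: y).
  rewrite /q -scaleNr !(linear_opD _ _ lk) !(linear_opZ _ _ lk).
  rewrite !(innerDl, innerDr, innerZl, innerZr) !positive_form_real -natr1.
  case: (inner _ _) (inner _ _) => [a b] [c e] /=.
  by set m := n%:R; nra.
suff : n%:R * q (x + y) <= n%:R * (n.+1%:R * (s + q y)) by rewrite ler_pM2l.
apply: le_trans key _; rewrite [leRHS]mulrCA ler_pM2l ?ltr0n// [leRHS]mulrDr.
by rewrite lerD2r.
Qed.

(** Cauchy-Schwarz for the form at u and k u gives |k u|^4 <= q(u) q(k u), and q(k u) is at most M
    |k u|^2. *)
Lemma positive_sqn_le (M : R) : 0 <= M -> (forall u, hnorm (k u) <= M * hnorm u) ->
  forall u, sqn (k u) <= M * q u.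
Proof.
move=> M0 kM u; have [->|s0] := eqVneq (sqn (k u)) 0.
  by rewrite mulr_ge0 ?positive_form_ge0.
have sp : 0 < sqn (k u) by rewrite lt_def s0 sqn_ge0.
have := positive_form_cauchy_schwarz u (k u); rewrite inner_sqn sqnorm_real => h.
have qk : q (k u) <= M * sqn (k u).
  apply: le_trans (_ : Num.sqrt (sqnorm (inner (k (k u)) (k u))) <= _).
    by rewrite positive_form_real sqnorm_real sqrtr_sqr ler_norm.
  apply: le_trans (sqrt_inner_le _ _) _; rewrite -hnorm2 expr2 mulrA.
  by rewrite ler_wpM2r ?hnorm_ge0.
rewrite -(ler_pM2r sp) -expr2; apply: le_trans h _.
rewrite [M * _]mulrC -mulrA; apply: ler_wpM2l => //; exact: positive_form_ge0.
Qed.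

End positive_operators.

(** * Fejer vectors and operators of finite trace *)

Section fejer_vectors.
Context (R : realType).
Local Notation T := (circle R).
Local Notation mu := (circle_measure R).
Local Notation mu2 := (torus_measure R).
Local Notation H := (L2 mu).
Local Notation H2 := (L2 mu2).
Local Notation op := (H -> H).
Local Notation op2 := (H2 -> H2).
Local Notation e_ := (zpow R).
Implicit Types (l : T) (u v w : H).

(* Squared modulus: the Fejer kernel at [l]; frequencies at least [N], so that
   these vectors lie in the Hardy space and tend weakly to [0]. *)
Definition fejer_vec l N : H :=
  (Num.sqrt N%:R^-1)%:C *: \sum_(j < N) (sval l ^ (- j%:Z)) *: e_ (N + j)%N.

Lemma fejer_vecE l N : fejer_vec l N =
  (Num.sqrt N%:R^-1)%:C *: \sum_(j < N) (sval l ^ (- j%:Z)) *: e_ (N + j)%N.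
Proof. by []. Qed.

Lemma fejer_vec_hardy l N : hardy (fejer_vec l N).
Proof.
apply: (lin_subspaceZ _ (hardy_subspace R)); apply: (lin_subspace_sum _ (hardy_subspace R)) => j.
by apply: (lin_subspaceZ _ (hardy_subspace R)); exact: hardy_zpow.
Qed.

Lemma sqn_orthonormal_sum (I : finType) (E : I -> H) (c : I -> Cx R) : orthonormal E ->
  sqn (\sum_i c i *: E i) = \sum_i sqnorm (c i).
Proof.
move=> oE; apply: complexI; rewrite -inner_sqn inner_suml [RHS]rmorph_sum.
apply: eq_bigr => i _; rewrite innerZl inner_sumr (bigD1 i)//= innerZr oE eqxx mulr1.
rewrite big1 ?addr0; last by move=> j ji; rewrite innerZr oE eq_sym (negbTE ji) mulr0.
exact: mulcJ.
Qed.

Lemma hnorm_fejer_vec l N : (0 < N)%N -> hnorm (fejer_vec l N) = 1.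
Proof.
move=> N0; have NR : (0 : R) < N%:R by rewrite ltr0n.
suff h : sqn (fejer_vec l N) = 1 by rewrite hnormE h sqrtr1.
rewrite sqnZ sqnorm_real sqr_sqrtr ?invr_ge0 ?ltW// sqn_orthonormal_sum; last first.
  by move=> i j; rewrite inner_zpow eqz_nat eqn_add2l.
under eq_bigr do rewrite circle_sqnorm_expz.
by rewrite sumr_const card_ord mulVf// gt_eqF.
Qed.

(* The sum telescopes. *)
Lemma fejer_vec_eigen l N : (0 < N)%N ->
  sqn (shift 1 (fejer_vec l N) - sval l *: fejer_vec l N) <= 4 / N%:R.
Proof.
move=> N0; have NR : (0 : R) < N%:R by rewrite ltr0n.
pose t j : H := (sval l ^ (1 - j%:Z)) *: e_ (N + j)%N.
have [ls _] := shift_bounded R 1.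
have -> : shift 1 (fejer_vec l N) - sval l *: fejer_vec l N =
    (Num.sqrt N%:R^-1)%:C *: (t N - t 0%N).
  rewrite /fejer_vec (linear_opZ _ _ ls) [sval l *: _]scalerA [sval l * _]mulrC -scalerA.
  rewrite -scalerBr; congr (_ *: _).
  rewrite -(telescope_sumr t (leq0n N)) big_mkord (linear_op_sum _ _ ls) scaler_sumr -sumrB.
  apply: eq_bigr => j _; rewrite (linear_opZ _ _ ls) shift_zpow scalerA.
  have l0 := circle_neq0 l; rewrite /t; congr (_ *: e_ _ - _ *: _).
  - by congr (_ ^ _); lia.
  - by lia.
  - by rewrite expfzDr// expr1z.
rewrite sqnZ sqnorm_real sqr_sqrtr; last by rewrite invr_ge0 ltW.
rewrite [leLHS]mulrC; apply: ler_wpM2r; first by rewrite invr_ge0 ltW.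
have h : hnorm (t N - t 0%N) <= hnorm (t N) + hnorm (t 0%N).
  by rewrite -[hnorm (t 0%N)]hnormN; exact: hnormD.
have t1 j : hnorm (t j) = 1.
  by rewrite /t hnormZ circle_sqnorm_expz sqrtr1 mul1r hnormE sqn_zpow sqrtr1.
rewrite !t1 in h; rewrite -hnorm2; have := hnorm_ge0 (t N - t 0%N); nra.
Qed.

Lemma trace_partial_sum (k : op) : positive_op k -> (trT k < +oo)%E ->
  exists K : R, forall n, \sum_(m < n) complex.Re (inner (k (e_ m)) (e_ m)) <= K.
Proof.
move=> kpos kfin; pose a (m : int) := (complex.Re (inner (k (e_ m)) (e_ m)))%:E.
have a0 m : (0 <= a m)%E by rewrite lee_fin; exact: positive_form_ge0.
have tr0 : (0 <= trT k)%E by apply: esum_ge0 => m _; exact: a0.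
have trf : trT k \is a fin_num by rewrite ge0_fin_numE.
exists (fine (trT k)) => n; rewrite -lee_fin fineK// -sumEFin.
apply: (@le_trans _ _ (\sum_(i <oo) a i%:Z)%E).
  rewrite -(big_mkord xpredT (fun m : nat => a m%:Z)).
  by apply: (@nneseries_lim_ge _ _ xpredT) => m _ _; exact: a0.
rewrite nneseries_esumT; last by move=> m; exact: a0.
rewrite -(@esum_image _ _ _ setT Posz a); last by move=> x y _ _ [].
rewrite esum_mkcond; apply: le_esum => m _; case: ifPn => // _; exact: a0.
Qed.

(** Up to a constant |k g|^2 is at most q(g). In q(g) the normalization 1/N of the Fejer vector
    cancels the factor N of [positive_form_sum], leaving the diagonal entries with index from N to
    2N - 1: a block of the tail of a convergent series. *)
Lemma annihilates_trace_class l (k : op) : positive_op k -> (trT k < +oo)%E ->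
  annihilates (fun n => fejer_vec l n.+1) k.
Proof.
move=> kpos kfin e e0; have [K hK] := trace_partial_sum kpos kfin.
have [bk _] := kpos; have [M M0 kM] := bounded_opP bk.
pose q u := complex.Re (inner (k u) u).
pose S n := \sum_(m < n) q (e_ m).
have Snd : nondecreasing_seq S.
  apply/nondecreasing_seqP => n; rewrite /S big_ord_recr /= lerDl; exact: positive_form_ge0.
have cS : cvgn S by apply: nondecreasing_is_cvgn => //; exists K => _ [n _ <-]; exact: hK.
have Sle := nondecreasing_cvgn_le Snd cS.
have e2 : 0 < e ^+ 2 / M by rewrite divr_gt0 ?exprn_gt0.
have /cvgrPdist_le/(_ _ e2)[N _ hN] := cS.
exists N => n Nn; rewrite hnorm_leP ?(ltW e0)//.
apply: le_trans (positive_sqn_le kpos (ltW M0) kM _) _.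
rewrite mulrC -ler_pdivlMr//.
have n0 : (0 : R) < n.+1%:R by rewrite ltr0n.
have [lk _] := bk.
apply: (@le_trans _ _ (\sum_(j < n.+1) q (e_ (n.+1 + j)%N))).
  rewrite fejer_vecE (linear_opZ _ _ lk) innerZl innerZr mulrA mulcJ sqnorm_real sqr_sqrtr.
  2: by rewrite invr_ge0 ltW.
  set F := \sum_(j < n.+1) _.
  have h := positive_form_sum kpos n.+1 (fun j => (sval l ^ (- j%:Z)) *: e_ (n.+1 + j)%N).
  have -> : complex.Re ((n.+1%:R^-1 : R)%:C * inner (k F) F) = n.+1%:R^-1 * q F.
    by rewrite (positive_form_real kpos F) -real_cxM.
  rewrite [leLHS]mulrC ler_pdivrMr// [leRHS]mulrC.
  apply: le_trans h _.
  rewrite ler_pM2l//; apply: ler_sum => j _.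
  by rewrite (linear_opZ _ _ lk) innerZl innerZr mulrA mulcJ circle_sqnorm_expz mul1r.
have -> : \sum_(j < n.+1) q (e_ (n.+1 + j)%N) = S (n.+1 + n.+1)%N - S n.+1.
  by rewrite /S big_split_ord /= addrAC subrr add0r.
have := hN n.+1 (leqW Nn); have := Sle (n.+1 + n.+1)%N.
by rewrite ler_norml => ? /andP[_ ?]; lra.
Qed.

Lemma fejer_vec_le1 l n : hnorm (fejer_vec l n.+1) <= 1.
Proof. by rewrite hnorm_fejer_vec. Qed.

End fejer_vectors.

(** * Concentration of tensors of Fejer vectors at a point of the torus *)

Section fejer_tensors.
Context (R : realType).
Local Notation T := (circle R).
Local Notation mu := (circle_measure R).
Local Notation mu2 := (torus_measure R).
Local Notation H := (L2 mu).
Local Notation H2 := (L2 mu2).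
Local Notation op := (H -> H).
Local Notation op2 := (H2 -> H2).
Local Notation e_ := (zpow R).
Implicit Types (l : T) (u v w : H).

Definition fejer_tensor (x : T * T) n : H2 := tensor (fejer_vec x.1 n.+1) (fejer_vec x.2 n.+1).

Lemma hnorm_fejer_tensor x n : hnorm (fejer_tensor x n) = 1.
Proof.
rewrite /fejer_tensor hnorm_tensor -[RHS]mulr1.
by congr (_ * _); exact: hnorm_fejer_vec.
Qed.

Lemma sqn_mulop_le (phi psi1 psi2 : T * T -> Cx R) (e C : R) (w : H2) :
  bounded_measurable phi -> bounded_measurable psi1 -> bounded_measurable psi2 ->
  0 <= e -> 0 <= C ->
  (forall x, sqnorm (phi x) <= e + C * (sqnorm (psi1 x) + sqnorm (psi2 x))) ->
  sqn (mulop phi w) <= e * sqn w + C * (sqn (mulop psi1 w) + sqn (mulop psi2 w)).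
Proof.
move=> b0 b1 b2 e0 C0 h; have [f sf ->] := L2_classP w.
rewrite (mulop_class b0 sf) (mulop_class b1 sf) (mulop_class b2 sf).
have s0 := sqintegrableM b0 sf; have s1 := sqintegrableM b1 sf; have s2 := sqintegrableM b2 sf.
have E g (sg : g \in sqintegrable mu2) : sqn (L2_class mu2 g) = \int[mu2]_x sqnorm (g x).
  by rewrite (L2_class_pi sg) sqn_pi.
have I g (sg : g \in sqintegrable mu2) : mu2.-integrable setT (EFin \o (fun x => sqnorm (g x))).
  exact: sq_integrable (exist (fun g => g \in sqintegrable mu2) g sg).
rewrite (E _ s0) (E _ s1) (E _ s2) (E _ sf).
have Z (r : R) g : mu2.-integrable setT (EFin \o g) -> mu2.-integrable setT (EFin \o (fun x => r * g x)).
  by move=> ig; exact: (integrableZl measurableT r ig).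
have D g g' : mu2.-integrable setT (EFin \o g) -> mu2.-integrable setT (EFin \o g') ->
    mu2.-integrable setT (EFin \o (fun x => g x + g' x)).
  by move=> ig ig'; exact: (integrableD measurableT ig ig').
rewrite -(RintegralD measurableT (I _ s1) (I _ s2)).
rewrite -(RintegralZl _ measurableT (I _ sf)) -(RintegralZl _ measurableT (D _ _ (I _ s1) (I _ s2))).
rewrite -(RintegralD measurableT (Z _ _ (I _ sf)) (Z _ _ (D _ _ (I _ s1) (I _ s2)))).
apply: le_Rintegral => //.
- exact: (I _ s0).
- exact: (D _ _ (Z _ _ (I _ sf)) (Z _ _ (D _ _ (I _ s1) (I _ s2)))).
move=> x _; rewrite !sqnormM; apply: le_trans (ler_wpM2r (sqnorm_ge0 (f x)) (h x)) _.
by rewrite mulrDl -mulrA -mulrDl.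
Qed.

Lemma second_moment_rate (C m f : R) : 0 < m -> 0 < f -> 16 * C / f <= m ->
  C * (4 / m + 4 / m) <= f / 2.
Proof.
move=> m0 f0; rewrite ler_pdivrMr// => h.
by rewrite -mulrDl mulrA ler_pdivrMr//; lra.
Qed.

(** Continuity bounds |phi|^2 by a small constant plus C times the squared distance to [x], and
    multiplication by a coordinate difference is small on these vectors by [fejer_vec_eigen]. *)
Lemma annihilates_mulop (x : T * T) (phi : T * T -> Cx R) : continuous phi -> phi x = 0 ->
  annihilates (fejer_tensor x) (mulop phi).
Proof.
move=> cphi phi0 e e0; have e2 : 0 < e ^+ 2 / 2 by rewrite divr_gt0 ?exprn_gt0.
have [C C0 hC] := continuous_sqdist_bound cphi e2.
have bphi := bounded_measurable_continuous cphi.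
have bM := bounded_measurable_monomial R.
have bc := @bounded_measurable_cst _ (T * T)%type R.
(* The coordinate differences y.1 - x.1 and y.2 - x.2, shaped for [mulop_lin] and
   [mulop_monomial_tensor]. *)
pose psi1 (y : T * T) := (- sval x.1 : Cx R) * 1 + @monomial R 1 0 y.
pose psi2 (y : T * T) := (- sval x.2 : Cx R) * 1 + @monomial R 0 1 y.
have b1 : bounded_measurable psi1.
  by apply: bounded_measurableD; [exact: bounded_measurable_cst|exact: bM].
have b2 : bounded_measurable psi2.
  by apply: bounded_measurableD; [exact: bounded_measurable_cst|exact: bM].
pose N := Num.truncn (16 * C / e ^+ 2); exists N => n Nn.
have n0 : (0 : R) < n.+1%:R by rewrite ltr0n.
rewrite hnorm_leP ?(ltW e0)//.
have g1 : sqn (fejer_tensor x n) = 1 by rewrite -hnorm2 hnorm_fejer_tensor expr1n.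
have p1 : sqn (mulop psi1 (fejer_tensor x n)) <= 4 / n.+1%:R.
  rewrite /psi1 (mulop_lin _ _ (@bounded_measurable_cst _ _ R 1) (bM 1 0)) mulop1.
  rewrite -[X in sqn X]/(- sval x.1 *: fejer_tensor x n + mulop (@monomial R 1 0) (fejer_tensor x n)).
  rewrite /fejer_tensor mulop_monomial_tensor shift0 scaleNr addrC -tensorZl -tensorBl.
  by rewrite -hnorm2 hnorm_tensor hnorm_fejer_vec// mulr1 hnorm2 fejer_vec_eigen.
have p2 : sqn (mulop psi2 (fejer_tensor x n)) <= 4 / n.+1%:R.
  rewrite /psi2 (mulop_lin _ _ (@bounded_measurable_cst _ _ R 1) (bM 0 1)) mulop1.
  rewrite -[X in sqn X]/(- sval x.2 *: fejer_tensor x n + mulop (@monomial R 0 1) (fejer_tensor x n)).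
  rewrite /fejer_tensor mulop_monomial_tensor shift0 scaleNr addrC -tensorZr -tensorBr.
  by rewrite -hnorm2 hnorm_tensor hnorm_fejer_vec// mul1r hnorm2 fejer_vec_eigen.
have hn : C * (4 / n.+1%:R + 4 / n.+1%:R) <= e ^+ 2 / 2.
  have hN : 16 * C / e ^+ 2 <= n.+1%:R.
    by apply: le_trans (ltW (truncnS_gt _)) _; rewrite ler_nat ltnS.
  exact: second_moment_rate n0 (exprn_gt0 2 e0) hN.
have eg : e ^+ 2 / 2 * sqn (fejer_tensor x n) <= e ^+ 2 / 2 by rewrite g1 mulr1.
apply: le_trans (le_trans (lerD eg (ler_wpM2l C0 (lerD p1 p2))) _); last first.
  by rewrite [leRHS](splitr (e ^+ 2)) lerD2l.
apply: (@sqn_mulop_le phi psi1 psi2 (e ^+ 2 / 2) C (fejer_tensor x n) bphi b1 b2 (ltW e2) C0).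
move=> y; have := hC y x; rewrite phi0 subr0 => /le_trans; apply.
rewrite lerD2l ler_wpM2l// /sqdist /psi1 /psi2 /monomial !expr0z !expr1z mulr1 mul1r.
by rewrite !mulr1 ![- _ + _]addrC.
Qed.

Lemma bounded_measurable_circle (phi : T -> Cx R) : continuous phi -> bounded_measurable phi.
Proof.
move=> cphi; split.
  split; apply: circle_measurable_continuous.
    exact: (continuous_compose cphi (@continuous_Re R)).
  exact: (continuous_compose cphi (@continuous_Im R)).
have c1 : continuous (fun x : T * T => phi x.1).
  exact: (continuous_compose (@continuous_proj1 T T) cphi).
have [M _ hM] := continuous_sqnorm_bound c1.
by exists M => x; exact: (hM (x, x)).
Qed.

End fejer_tensors.

(** * Fredholm implies invertible *)

Section fredholm_implies_invertible.
Context (R : realType).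
Local Notation T := (circle R).
Local Notation mu := (circle_measure R).
Local Notation mu2 := (torus_measure R).
Local Notation H := (L2 mu).
Local Notation H2 := (L2 mu2).
Local Notation op := (H -> H).
Local Notation op2 := (H2 -> H2).
Implicit Types (a b k : op) (x : T * T).

Lemma ind_proj_OmegaT2 theta tau : ind_proj (OmegaT2 theta tau) = @PT2 R.
Proof.
by rewrite /ind_proj /= /FT2 subrK scalerA mulVf ?scale1r//.
Qed.

Context (HP : hardy_proj_spec (@PT R)).

Lemma LT_generators_bounded :
  ([set mulop phi | phi in [set phi : T -> Cx R | continuous phi]] `|` [set @PT R])
    `<=` @bounded_op _ _ _ mu.
Proof.
move=> _ [[phi cphi <-]| ->]; last exact: hardy_proj_bounded.
by apply: mulop_bounded; exact: bounded_measurable_circle.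
Qed.

Lemma LT_cstar : cstar_subalgebra (@LT R).
Proof. exact: cstar_generated_cstar LT_generators_bounded. Qed.

Lemma LT_bounded a : LT a -> bounded_op a.
Proof. by case: LT_cstar => h _ _ _ _; exact: h. Qed.

Lemma LT_PT : LT (@PT R).
Proof. by apply: sub_cstar_generated; right. Qed.

Lemma trace_span_bounded : trace_span (@LT R) (@trT R) `<=` @bounded_op _ _ _ mu.
Proof.
apply: lin_span_min; first exact: bounded_op_subspace.
by move=> k [/LT_bounded].
Qed.

Lemma KT_bounded k : KT k -> bounded_op k.
Proof. exact: op_closure_bounded. Qed.

Lemma KT_annihilates (l : T) k : KT k -> annihilates (fun n => fejer_vec l n.+1) k.
Proof.
apply: annihilates_closure; [exact: fejer_vec_le1|exact: trace_span_bounded|].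
apply: lin_span_min; first exact: annihilates_subspace.
by move=> k' [_ kpos kfin]; exact: annihilates_trace_class.
Qed.

(** One factor tends to 0 on its Fejer vectors while the other stays bounded; a tensor without a
    bounded realization is 0 by default. *)
Lemma op_tensor_annihilates x a b :
  (bounded_op a /\ annihilates (fun n => fejer_vec x.2 n.+1) b) \/
  (bounded_op b /\ annihilates (fun n => fejer_vec x.1 n.+1) a) ->
  annihilates (fejer_tensor x) (op_tensor a b).
Proof.
move=> h; have [ht|/op_tensor_junk ->] := pselect (tensorable a b); last first.
  by case: (annihilates_subspace (fejer_tensor x)).
have [_ hab] := op_tensorP ht => e e0.
case: h => -[/bounded_opP[M M0 aM] bn].
  have [N hN] := bn _ (divr_gt0 e0 M0); exists N => n Nn.
  rewrite /fejer_tensor hab hnorm_tensor.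
  have h1 : hnorm (a (fejer_vec x.1 n.+1)) <= M.
    by apply: le_trans (aM _) _; rewrite ler_piMr ?(ltW M0)// fejer_vec_le1.
  apply: le_trans (ler_pM (hnorm_ge0 _) (hnorm_ge0 _) h1 (hN n Nn)) _.
  by rewrite mulrC divfK// gt_eqF.
have [N hN] := bn _ (divr_gt0 e0 M0); exists N => n Nn.
rewrite /fejer_tensor hab hnorm_tensor.
have h1 : hnorm (b (fejer_vec x.2 n.+1)) <= M.
  by apply: le_trans (aM _) _; rewrite ler_piMr ?(ltW M0)// fejer_vec_le1.
apply: le_trans (ler_pM (hnorm_ge0 _) (hnorm_ge0 _) (hN n Nn) h1) _.
by rewrite divfK// gt_eqF.
Qed.

Lemma tensor_closure_annihilates x (A B : set op) :
  (forall a b, A a -> B b -> annihilates (fejer_tensor x) (op_tensor a b)) ->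
  forall c, tensor_closure A B c -> annihilates (fejer_tensor x) c.
Proof.
move=> AB; apply: annihilates_closure.
- by move=> n; rewrite hnorm_fejer_tensor.
- apply: lin_span_min; first exact: bounded_op_subspace.
  by move=> _ [a _ [b _ <-]]; exact: op_tensor_bounded.
- apply: lin_span_min; first exact: annihilates_subspace.
  by move=> _ [a Aa [b Bb <-]]; exact: AB.
Qed.

Lemma IT2_annihilates x c : IT2 c -> annihilates (fejer_tensor x) c.
Proof.
move=> [c1 h1 [c2 h2 <-]]; apply: (lin_subspaceD (annihilates_subspace (fejer_tensor x))).
- apply: tensor_closure_annihilates h1 => a b /LT_bounded ba /KT_annihilates hb.
  by apply: op_tensor_annihilates; left.
- apply: tensor_closure_annihilates h2 => a b /KT_annihilates ha /LT_bounded bb.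
  by apply: op_tensor_annihilates; right.
Qed.

Lemma PT2_fejer_tensor x n : @PT2 R (fejer_tensor x n) = fejer_tensor x n.
Proof.
have [_ h] := op_tensorP (tensorable_hardy_proj HP).
rewrite /fejer_tensor /PT2 h (hardy_proj_id HP (fejer_vec_hardy _ _)).
by rewrite (hardy_proj_id HP (fejer_vec_hardy _ _)).
Qed.

Lemma toeplitz_bounded theta tau (phi : T * T -> Cx R) : continuous phi ->
  bounded_op (toeplitz (OmegaT2 theta tau) (mulop phi)).
Proof.
move=> cphi; rewrite /toeplitz ind_proj_OmegaT2.
have bP : bounded_op (@PT2 R) := op_tensor_bounded _ _.
apply: bounded_op_comp => //; apply: bounded_op_comp => //.
exact: mulop_bounded (bounded_measurable_continuous cphi).
Qed.

Lemma toeplitz_generators_bounded theta tau :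
  [set toeplitz (OmegaT2 theta tau) c | c in @CT2 R] `<=` @bounded_op _ _ _ mu2.
Proof. by move=> _ [_ [phi cphi <-] <-]; exact: toeplitz_bounded. Qed.

(** At a zero of [phi], the unit vectors are fixed by Q, while both Q - b T_phi and b T_phi tend to
    0 along them. *)
Lemma fredholm_invertible theta tau (phi : T * T -> Cx R) : continuous phi ->
  fredholm (OmegaT2 theta tau) (@CT2 R) (toeplitz (OmegaT2 theta tau) (mulop phi)) ->
  invertible_CT2 phi.
Proof.
move=> cphi [_ [b [Ab _ Mba]]].
suff nz x : phi x != 0.
  exists (fun x => (phi x)^-1); last by move=> x; rewrite divff ?nz.
  by move=> x; apply: cvgV; [exact: nz|exact: cphi].
apply/eqP => phi0.
have bb : bounded_op b.
  by have [h _ _ _ _] := cstar_generated_cstar (@toeplitz_generators_bounded theta tau); exact: h.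
have [M M0 bM] := bounded_opP bb.
have bP : bounded_op (@PT2 R) := op_tensor_bounded _ _.
have [K K0 PK] := bounded_opP bP.
have ann : annihilates (fejer_tensor x) (@PT2 R - (b \o toeplitz (OmegaT2 theta tau) (mulop phi))).
  move: Mba; rewrite ind_proj_OmegaT2; apply: lin_span_min; first exact: annihilates_subspace.
  (* The trace is infinite off the ideal, so finite trace gives membership in it. *)
  move=> c [_ _]; rewrite /= /trT2; case: asboolP => // cI _.
  exact: IT2_annihilates.
have [|N1 h1] := ann (1 / 4); first by rewrite divr_gt0.
(* With [M] and [K] bounding [b] and Q, this tolerance makes b Q phi g of norm at most 1/4. *)
have [|N2 h2] := annihilates_mulop cphi phi0 (e := (4 * (M * K))^-1).
  by rewrite invr_gt0 mulr_gt0 ?mulr_gt0.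
pose n := maxn N1 N2; pose g := fejer_tensor x n.
have g1 : hnorm g = 1 := hnorm_fejer_tensor x n.
have Pg : @PT2 R g = g := PT2_fejer_tensor x n.
have d1 : hnorm (g - b (@PT2 R (mulop phi g))) <= 1 / 4.
  have := h1 n (leq_maxl _ _); rewrite -/g.
  rewrite -[(@PT2 R - _) g]/(@PT2 R g - b (ind_proj _ (mulop phi (ind_proj _ g)))).
  by rewrite ind_proj_OmegaT2 Pg.
have d2 : hnorm (b (@PT2 R (mulop phi g))) <= 1 / 4.
  apply: le_trans (bM _) _; apply: le_trans (ler_wpM2l (ltW M0) (PK _)) _.
  apply: le_trans (ler_wpM2l (ltW M0) (ler_wpM2l (ltW K0) (h2 n (leq_maxr _ _)))) _.
  rewrite mulrA invfM mulrCA divff ?mulf_neq0 ?gt_eqF// mulr1 mul1r//.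
have := hnormD (g - b (@PT2 R (mulop phi g))) (b (@PT2 R (mulop phi g))).
rewrite subrK g1; move: d1 d2; set p := hnorm _; set q := hnorm _.
lra.
Qed.

End fredholm_implies_invertible.

(** * Closed equalizers and products with a fixed middle factor *)

Section closed_equalizers.
Context d (X : measurableType d) (R : realType) (mu : {measure set X -> \bar R}).
Local Notation H := (L2 mu).
Implicit Types (a b c : H -> H) (u v : H).

Lemma bounded_op_eq_closed a b : bounded_op a -> bounded_op b ->
  L2_closure [set w | a w = b w] `<=` [set w | a w = b w].
Proof.
move=> ba bb w wW; have [la _] := ba; have [lb _] := bb.
rewrite /=; apply/eqP; rewrite -subr_eq0; apply/eqP.
have [M M0 aM] := bounded_opP ba; have [N N0 bN] := bounded_opP bb.
apply: (@hnorm_small _ _ _ _ _ (M + N)) => e e0; have [v Wv wv] := wW e e0.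
apply: le_trans (hnormB_tri (a v) _ _) _; rewrite mulrDr; apply: lerD.
  rewrite -(linear_opB _ _ la); apply: le_trans (aM _) _.
  by rewrite [leRHS]mulrC; apply: ler_wpM2l; rewrite ltW.
rewrite [a v]Wv -(linear_opB _ _ lb); apply: le_trans (bN _) _.
by rewrite [leRHS]mulrC hnormBC; apply: ler_wpM2l; rewrite ltW.
Qed.

Lemma op_eq_subspace a b : linear a -> linear b -> lin_subspace [set w | a w = b w].
Proof.
move=> la lb; split; first by rewrite /= (linear_op0 la) (linear_op0 lb).
by move=> k u v /=; rewrite la lb => -> ->.
Qed.

(** Adjoints are unique; this carries identities for shifts over to backward shifts. *)
Lemma op_eq_adjoint a b a' b' : is_adjoint a a' -> is_adjoint b b' -> a = b -> a' = b'.
Proof.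
move=> aa bb ab; apply/funext => u; apply: inner_ext => w.
by rewrite (adjointC aa) ab -(adjointC bb).
Qed.

Lemma sandwich_closure (G L : set (H -> H)) c : G `<=` @bounded_op _ _ _ mu ->
  L `<=` @bounded_op _ _ _ mu -> bounded_op c ->
  (forall x y, G x -> G y -> L (x \o c \o y)) ->
  forall x y, op_closure G x -> op_closure G y -> op_closure L (x \o c \o y).
Proof.
move=> Gb Lb bc GL x y xG yG.
have bx := op_closure_bounded xG; have by_ := op_closure_bounded yG.
have [lx _] := bx; have [lc _] := bc.
have [K K0 cK] := bounded_opP bc; have [M M0 xM] := bounded_opP bx.
have [N N0 yN] := bounded_opP by_.
apply: approx_op_closure; first exact: bounded_op_comp bx (bounded_op_comp bc by_).
(* The errors are M K f, from [y], and f K (N + 1), from [x]: the approximant of [y] is bounded by N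
   + 1 once f <= 1. *)
move=> e e0; pose C := M * K + (K * N + K).
have C0 : 0 < C by rewrite !addr_gt0 ?mulr_gt0.
pose f := Num.min 1 (e / C); have f0 : 0 < f by rewrite lt_min ltr01 divr_gt0.
have f1 : f <= 1 by rewrite ge_min lexx.
have fe : f * C <= e by rewrite -ler_pdivlMr// ge_min lexx orbT.
have [x' Gx xx] := op_closure_approx Gb xG f0; have [y' Gy yy] := op_closure_approx Gb yG f0.
exists (x' \o c \o y'); first exact: GL.
move=> u; apply: le_trans (hnormB_tri (x (c (y' u))) _ _) _ => /=.
have y'N : hnorm (y' u) <= (N + 1) * hnorm u.
  have -> : y' u = y u - (y u - y' u) by rewrite opprB addrC subrK.
  apply: le_trans (hnormD _ _) _; rewrite hnormN mulrDl; apply: lerD (yN _) _.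
  by apply: le_trans (yy _) _; apply: ler_wpM2r => //; exact: hnorm_ge0.
apply: (@le_trans _ _ ((M * (K * (f * hnorm u))) + f * (K * ((N + 1) * hnorm u)))).
  apply: lerD.
    rewrite -(linear_opB _ _ lx) -(linear_opB _ _ lc); apply: le_trans (xM _) _.
    rewrite ler_pM2l//; apply: le_trans (cK _) _; rewrite ler_pM2l//; exact: yy.
  apply: le_trans (xx _) _; rewrite ler_pM2l//; apply: le_trans (cK _) _.
  by rewrite ler_pM2l.
rewrite (_ : _ + _ = (f * C) * hnorm u); last by rewrite /C; ring.
by apply: ler_wpM2r => //; exact: hnorm_ge0.
Qed.

End closed_equalizers.

(** * Toeplitz operators with monomial symbol in one variable *)

Section hardy_shifts.
Context (R : realType).
Local Notation T := (circle R).
Local Notation mu := (circle_measure R).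
Local Notation H := (L2 mu).
Local Notation op := (H -> H).
Local Notation e_ := (zpow R).
Local Notation S_ := (@shift R).
Implicit Types (u v w : H) (a b : op).

Lemma continuous_expz (m : int) : continuous (fun x : T => sval x ^ m : Cx R).
Proof.
have X n : continuous (fun x : T => sval x ^+ n : Cx R).
  elim: n => [|n IHn] x; first exact: (@cst_continuous T (Cx R) 1 x).
  rewrite (_ : (fun y : T => _) = fun y : T => sval y * sval y ^+ n); last first.
    by apply/funext => y; rewrite exprS.
  exact: (cvgM (@continuous_circle_val R x) (IHn x)).
case: m => n; first exact: X.
by move=> x; exact: (cvgV (expf_neq0 n.+1 (circle_neq0 x)) (X n.+1 x)).
Qed.

Lemma LT_shift m : LT (S_ m).
Proof. by apply: sub_cstar_generated; left; exists (fun x : T => sval x ^ m) => //; exact: continuous_expz. Qed.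

Context (P : op) (HP : hardy_proj_spec P).

Lemma hardy_ext a b : bounded_op a -> bounded_op b ->
  (forall m : nat, a (e_ m) = b (e_ m)) -> a \o P = b \o P.
Proof.
move=> ba bb ab; apply/funext => u /=.
have [la _] := ba; have [lb _] := bb; apply: (bounded_op_eq_closed ba bb).
move=> e e0; have [v Sv uv] := (HP u).1 e e0; exists v => //.
apply: (lin_span_min (op_eq_subspace la lb) _ Sv) => _ [m _ <-]; exact: ab.
Qed.

(** Multiplication by z^k with k >= 0 preserves the Hardy space. *)
Lemma hardy_shift (k : nat) : P \o S_ k \o P = S_ k \o P.
Proof.
apply: (hardy_ext (a := P \o S_ k) (b := S_ k)) => [||m /=]; first exact: bounded_op_comp (hardy_proj_bounded HP) (shift_bounded _ _).
  exact: shift_bounded _ _.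
by rewrite shift_zpow (hardy_proj_zpow HP).
Qed.

Lemma hardy_coshift (k : nat) : P \o S_ (- k%:Z) \o P = P \o S_ (- k%:Z).
Proof.
have PP := hardy_proj_adjoint HP; have SS := @shift_adjoint R k.
apply: (op_eq_adjoint (a := P \o S_ k \o P) (b := S_ k \o P)).
- exact: (adjoint_comp (adjoint_comp PP SS) PP).
- exact: (adjoint_comp SS PP).
- exact: hardy_shift.
Qed.

Definition toeplitz_shift m : op := P \o S_ m \o P.

Lemma toeplitz_shift_bounded m : bounded_op (toeplitz_shift m).
Proof.
by apply: bounded_op_comp (hardy_proj_bounded HP); apply: bounded_op_comp (hardy_proj_bounded HP) (shift_bounded _ _).
Qed.

Lemma toeplitz_shift_adjoint m : is_adjoint (toeplitz_shift m) (toeplitz_shift (- m)).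
Proof.
have PP := hardy_proj_adjoint HP.
exact: (adjoint_comp (adjoint_comp PP (shift_adjoint m)) PP).
Qed.

(** Forward shifts are isometries of the Hardy space. *)
Lemma toeplitz_shiftK (k : nat) : toeplitz_shift (- k%:Z) \o toeplitz_shift k = P.
Proof.
rewrite /toeplitz_shift hardy_shift hardy_coshift.
by rewrite -[_ \o (_ \o P)]/(P \o (S_ (- k%:Z) \o S_ k) \o P) shiftD addNr shift0 -[RHS](hardy_proj_idem HP).
Qed.

(** The projection onto z^N H^2, written with Toeplitz operators so that it lies in [LT] and the
    character can be evaluated on it. *)
Definition range_proj (N : nat) : op := toeplitz_shift N \o toeplitz_shift (- N%:Z).

(** Both sides send z^m to itself for 0 <= m < N and to 0 for m >= N. This puts the finite-rank
    truncation in [LT]. *)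
Lemma hardy_trunc_range N : hardy_trunc N = P - range_proj N :> op.
Proof.
have bP := hardy_proj_bounded HP; have PP := hardy_proj_idem HP.
have bR : bounded_op (P - range_proj N).
  by apply: bounded_opB bP _; exact: bounded_op_comp (toeplitz_shift_bounded _) (toeplitz_shift_bounded _).
have RP : (P - range_proj N) \o P = P - range_proj N.
  apply/funext => u; have Pu : P (P u) = P u := congr1 (fun f => f u) PP.
  rewrite -[LHS]/(P (P u) - range_proj N (P u)) -[RHS]/(P u - range_proj N u).
  by rewrite /range_proj /toeplitz_shift /= Pu.
have tP : hardy_trunc N \o P = hardy_trunc N.
  apply/funext => u; apply: eq_bigr => i _ /=.
  by rewrite (hardy_proj_adjoint HP) (hardy_proj_zpow HP).
have bt : bounded_op (hardy_trunc N : op).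
  split; first exact: fourier_proj_linear.
  by exists 1 => u; rewrite mul1r hardy_trunc_le.
rewrite -RP -tP; apply: (hardy_ext bt bR) => m.
have [lP _] := bP; have [lS _] := shift_bounded R N.
rewrite -[RHS]/(P (e_ m) - range_proj N (e_ m)) /range_proj /toeplitz_shift /=.
rewrite !(hardy_proj_zpow HP) !shift_zpow !(hardy_proj_zpow HP) /=.
have [mN|Nm] := ltnP m N.
  rewrite (hardy_trunc_id _ mN) ifF; last by apply/negbTE; lia.
  by rewrite (linear_op0 lP) (linear_op0 lS) (linear_op0 lP) subr0.
rewrite ifT; last by lia.
rewrite (hardy_proj_zpow HP) ifT; last by lia.
rewrite shift_zpow (hardy_proj_zpow HP).
have -> : (N%:Z + (- N%:Z + m%:Z)) = m%:Z by lia.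
transitivity (0 : H); last by symmetry; exact: (subrr (e_ m)).
apply: big1 => i _.
have mi : inner (e_ m) (e_ i) = 0.
  apply: (etrans (inner_zpow R m i)).
  have -> : (m%:Z == i%:Z) = false by apply/negbTE; have := ltn_ord i; lia.
  by [].
exact: (etrans (congr1 (fun c : Cx R => c *: e_ i) mi) (scale0r _)).
Qed.

Lemma hardy_trunc_adjoint N : is_adjoint (hardy_trunc N : op) (hardy_trunc N).
Proof. exact: fourier_proj_adjoint. Qed.

Lemma hardy_trunc_linear N : linear (hardy_trunc N : op).
Proof. exact: fourier_proj_linear. Qed.

Lemma hardy_trunc_idem N u : hardy_trunc N (hardy_trunc N u) = hardy_trunc N u.
Proof. apply: fourier_proj_idem; exact: orthonormal_zpow. Qed.

End hardy_shifts.

(** * Finite trace of operators that factor through a truncation *)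

Section trace_finite.
Context (R : realType).
Local Notation T := (circle R).
Local Notation mu := (circle_measure R).
Local Notation H := (L2 mu).
Local Notation op := (H -> H).
Local Notation e_ := (zpow R).
Implicit Types (u v w : H) (a b : op).

Lemma bessel_seq (s : seq int) u : uniq s -> \sum_(m <- s) sqnorm (inner (e_ m) u) <= sqn u.
Proof.
move=> us; have inj : injective (tnth (in_tuple s)) by apply/tuple_uniqP.
have /bessel : orthonormal (fun i : 'I_(size s) => e_ (tnth (in_tuple s) i)).
  by move=> i j; rewrite inner_zpow (inj_eq inj).
move=> /(_ u); rewrite -(big_tnth _ _ s xpredT (fun m => sqnorm (inner u (e_ m)))).
by under eq_bigr do rewrite innerC sqnormJ.
Qed.

Lemma sqn_zpow_sum (s : seq int) (c : int -> Cx R) : uniq s ->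
  sqn (\sum_(m <- s) c m *: e_ m) = \sum_(m <- s) sqnorm (c m).
Proof.
move=> us; have inj : injective (tnth (in_tuple s)) by apply/tuple_uniqP.
rewrite [X in sqn X]big_tnth [RHS]big_tnth.
apply: (@sqn_orthonormal_sum _ _ (fun i => e_ (tnth (in_tuple s) i)) (fun i => c (tnth (in_tuple s) i))) => i j.
by rewrite inner_zpow (inj_eq inj).
Qed.

(* Bessel for the adjoint of [b]: test [b] on the vector with coordinates conj <b e_m, u>. *)
Lemma dual_bessel b (M : R) (s : seq int) u : linear b -> 0 <= M ->
  (forall v, hnorm (b v) <= M * hnorm v) -> uniq s ->
  \sum_(m <- s) sqnorm (inner (b (e_ m)) u) <= M ^+ 2 * sqn u.
Proof.
move=> lb M0 bM us; set S := \sum_(m <- s) _.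
pose c m := conjc (inner (b (e_ m)) u); pose f := \sum_(m <- s) c m *: e_ m.
have S0 : 0 <= S by apply: sumr_ge0 => m _; exact: sqnorm_ge0.
have fS : sqn f = S by rewrite sqn_zpow_sum//; apply: eq_bigr => m _; rewrite /c sqnormJ.
have bf : inner (b f) u = S%:C.
  rewrite (linear_op_sum _ _ lb) inner_suml rmorph_sum; apply: eq_bigr => m _.
  by rewrite (linear_opZ _ _ lb) innerZl /c mulrC mulcJ.
have := cauchy_schwarz (b f) u; rewrite bf sqnorm_real => SS.
have bfM : sqn (b f) <= M ^+ 2 * S.
  by rewrite -fS -!hnorm2 -exprMn ler_sqr ?nnegrE ?mulr_ge0 ?hnorm_ge0.
have [->|Sn0] := eqVneq S 0; first by rewrite mulr_ge0 ?sqr_ge0 ?sqn_ge0.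
have Sp : 0 < S by rewrite lt_neqAle eq_sym Sn0.
rewrite -(ler_pM2l Sp) -expr2; apply: le_trans SS _.
apply: (@le_trans _ _ (M ^+ 2 * S * sqn u)); first by apply: ler_wpM2r bfM; exact: sqn_ge0.
by rewrite mulrA [S * _]mulrC.
Qed.

Lemma Re_mul_le (z w : Cx R) : complex.Re (z * w) <= sqnorm z + sqnorm w.
Proof.
case: z w => [a b] [c d]; rewrite /sqnorm /=.
have := sqr_ge0 (a - c); have := sqr_ge0 (b + d).
have := sqr_ge0 a; have := sqr_ge0 b; have := sqr_ge0 c; have := sqr_ge0 d.
by rewrite sqrrD sqrrB !mulr2n; lra.
Qed.

Lemma trT_ge0 a : (0 <= trT a)%E.
Proof.
apply: ereal_sup_ubound; exists set0; first by split => //; exact: finite_set0.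
by rewrite fsbig_set0.
Qed.

(** [trT] is a supremum of finite partial sums, also for an operator that is not positive. Each
    diagonal entry is a sum of N products of coefficients, bounded by their squares, and Bessel's
    inequality bounds the sums of these uniformly. *)
Lemma trT_trunc N a b : bounded_op a -> bounded_op b ->
  (trT (a \o hardy_trunc N \o b) < +oo)%E.
Proof.
move=> ba bb; have [la _] := ba; have [lb _] := bb.
have [M M0 bM] := bounded_opP bb.
pose K := \sum_(i < N) (M ^+ 2 * sqn (e_ i) + sqn (a (e_ i))).
apply: (@le_lt_trans _ _ K%:E); last exact: ltry.
apply: ub_ereal_sup => _ [X [finX _] <-].
rewrite fsbig_finite// sumEFin lee_fin; set s := finmap.enum_fset _.
have us : uniq s by exact: finmap.fset_uniq.
have ReE m : complex.Re (inner ((a \o hardy_trunc N \o b) (e_ m)) (e_ m)) <=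
    \sum_(i < N) (sqnorm (inner (b (e_ m)) (e_ i)) + sqnorm (inner (e_ m) (a (e_ i)))).
  have -> : inner ((a \o hardy_trunc N \o b) (e_ m)) (e_ m) =
      \sum_(i < N) inner (b (e_ m)) (e_ i) * inner (a (e_ i)) (e_ m).
    rewrite /= (linear_op_sum _ _ la) inner_suml; apply: eq_bigr => i _.
    by rewrite (linear_opZ _ _ la) innerZl.
  rewrite raddf_sum; apply: ler_sum => i _; apply: le_trans (Re_mul_le _ _) _.
  by rewrite [inner (a _) _]innerC sqnormJ.
apply: le_trans (ler_sum _ (fun m _ => ReE m)) _; rewrite exchange_big.
apply: ler_sum => i _; rewrite big_split; apply: lerD.
  exact: (dual_bessel _ lb (ltW M0) bM us).
exact: bessel_seq.
Qed.

End trace_finite.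

(** * The ideal of the trace and the values of the character *)

Section trace_sandwich.
Context (R : realType).
Local Notation T := (circle R).
Local Notation mu := (circle_measure R).
Local Notation H := (L2 mu).
Local Notation op := (H -> H).
Local Notation P := (@PT R).
Local Notation LT := (@LT R).
Implicit Types (u v w : H) (a b : op).
Context (HP : hardy_proj_spec P).

Lemma LT_comp a b : LT a -> LT b -> LT (a \o b).
Proof. by have [_ _ c _ _] := LT_cstar HP; exact: c. Qed.

Lemma LT_toeplitz_shift m : LT (toeplitz_shift P m).
Proof. exact: LT_comp (LT_comp (@LT_PT R) (@LT_shift R m)) (@LT_PT R). Qed.

Lemma LT_range_proj N : LT (range_proj P N).
Proof. exact: LT_comp (LT_toeplitz_shift _) (LT_toeplitz_shift _). Qed.

Lemma LT_subspace : lin_subspace LT.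
Proof. by have [_ ? _ _ _] := LT_cstar HP. Qed.

Lemma LT_trunc N : LT (hardy_trunc N).
Proof.
rewrite (hardy_trunc_range HP).
exact: (lin_subspaceB LT_subspace (@LT_PT R) (LT_range_proj N)).
Qed.

Definition LT_adj : set op := [set a | LT a /\ exists2 a', LT a' & is_adjoint a a'].

(** Polarization reduces to y* E_N y, which is positive because E_N is a projection, and of finite
    trace by [trT_trunc]. *)
Lemma KT_trunc_sandwich N x y : LT_adj x -> LT_adj y -> KT (x \o hardy_trunc N \o y).
Proof.
move=> Dx Dy; apply: sub_op_closure; first exact: trace_span_bounded HP.
apply: (polarization (cstar_adjointable (LT_cstar HP)) (lin_span_subspace _)
  (hardy_trunc_linear N) _ Dx Dy) => {Dx Dy} {}y y' [Ly _] [Ly' _] yy'.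
apply: sub_lin_span; have Lc : LT (y' \o hardy_trunc N \o y).
  exact: LT_comp (LT_comp Ly' (LT_trunc N)) Ly.
split => //; last exact: trT_trunc (LT_bounded HP Ly') (LT_bounded HP Ly).
split; first exact: (LT_bounded HP Lc).
move=> u /=; rewrite (adjointC yy') -hardy_trunc_idem hardy_trunc_adjoint inner_sqn.
by rewrite lecE /= eqxx sqn_ge0.
Qed.

Context (tau : op -> Cx R) (tauP : is_character LT tau) (tauP0 : tau P != 0).

(** The value is a non-zero idempotent scalar. *)
Lemma character_hardy_proj : tau P = 1.
Proof.
have [_ tauM _] := tauP; apply: (mulfI tauP0).
by rewrite -tauM ?(hardy_proj_idem HP) ?mulr1//; exact: LT_PT.
Qed.

(** Scalars commute, so tau takes equal values at S S* and at S* S = P, where S is the forward shift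
    by N on the Hardy space. *)
Lemma character_range_proj N : tau (range_proj P N) = 1.
Proof.
have [_ tauM _] := tauP.
rewrite tauM; [|exact: LT_toeplitz_shift|exact: LT_toeplitz_shift].
rewrite mulrC -tauM; [|exact: LT_toeplitz_shift|exact: LT_toeplitz_shift].
by rewrite (toeplitz_shiftK HP); exact: character_hardy_proj.
Qed.

Lemma character_trunc N : tau (hardy_trunc N) = 0.
Proof.
have [tauL _ _] := tauP; rewrite (hardy_trunc_range HP).
have -> : P - range_proj P N = (-1) *: range_proj P N + P by rewrite scaleN1r addrC.
rewrite tauL; [|exact: LT_range_proj|exact: LT_PT].
by rewrite character_range_proj character_hardy_proj mulN1r addNr.
Qed.

End trace_sandwich.

(** * Elementary tensors and Toeplitz operators on the torus *)

Lemma star_alg_span d (X : measurableType d) (R : realType) (mu : {measure set X -> \bar R})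
    (E : set (L2 mu -> L2 mu)) : E `<=` @bounded_op _ _ _ mu ->
  (forall a b, E a -> E b -> E (a \o b)) ->
  (forall a, E a -> exists2 a', E a' & is_adjoint a a') -> star_alg (lin_span E).
Proof.
move=> Eb EM EJ; have SS := lin_span_subspace E; split => //.
- exact: (lin_span_min (bounded_op_subspace _) Eb).
- move=> a b Ea Eb'; refine (@lin_span_min _ _ E [set b : L2 mu -> L2 mu | lin_span E (a \o b)] _ _ b Eb'); last first.
    move=> {}b {}Eb' /=; refine (@lin_span_min _ _ E [set a : L2 mu -> L2 mu | lin_span E (a \o b)] _ _ a Ea).
      split; first by have [] := SS.
      by move=> k x y /= xE yE; exact: (SS.2 k _ _ xE yE).
    by move=> {Ea}a Ea; apply: sub_lin_span; exact: EM.
  have [la _] : bounded_op a by exact: (lin_span_min (bounded_op_subspace _) Eb).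
  split.
    rewrite /= (_ : a \o 0 = 0); first by have [] := SS.
    by apply/funext => u; exact: linear_op0.
  move=> k x y /= xE yE; rewrite (_ : a \o _ = k *: (a \o x) + (a \o y)); last first.
    by apply/funext => u; exact: la.
  exact: (SS.2 k _ _ xE yE).
- move=> a Ea; refine (@lin_span_min _ _ E [set a : L2 mu -> L2 mu | exists2 a', lin_span E a' & is_adjoint a a'] _ _ a Ea).
    split; first by exists 0; [have [] := SS|exact: adjoint0].
    move=> k x y [x' xE xx] [y' yE yy]; exists (conjc k *: x' + y').
      exact: (SS.2 _ _ _ xE yE).
    exact: adjoint_lin.
  by move=> {Ea}a /EJ[a' Ea' aa]; exists a' => //; exact: sub_lin_span.
Qed.

Section torus_toeplitz.
Context (R : realType).
Local Notation T := (circle R).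
Local Notation mu := (circle_measure R).
Local Notation mu2 := (torus_measure R).
Local Notation H := (L2 mu).
Local Notation H2 := (L2 mu2).
Local Notation op := (H -> H).
Local Notation op2 := (H2 -> H2).
Local Notation P := (@PT R).
Local Notation Q := (@PT2 R).
Local Notation LT := (@LT R).
Implicit Types (a b : op) (c d : op2) (k : Cx R) (f g : T * T -> Cx R).

Lemma continuous_monomial m n : continuous (@monomial R m n).
Proof.
move=> x; have c1 := continuous_compose (@continuous_proj1 T T) (@continuous_expz R m).
have c2 := continuous_compose (@continuous_proj2 T T) (@continuous_expz R n).
exact: (cvgM (c1 x) (c2 x)).
Qed.

Context (HP : hardy_proj_spec P).

(** Each factor comes with an adjoint in [LT], and the tensor operators are required to exist: the
    span is then a star algebra, and [op_tensor] is used at its genuine values. *)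
Definition elementary_tensors : set op2 := [set c | exists a b a' b',
  [/\ LT a /\ LT b, LT a' /\ LT b', is_adjoint a a' /\ is_adjoint b b',
      tensorable a b /\ tensorable a' b' & c = op_tensor a b]].

Local Notation G := (lin_span elementary_tensors).

Lemma op_tensor_adjoint a b a' b' : tensorable a b -> tensorable a' b' ->
  is_adjoint a a' -> is_adjoint b b' -> is_adjoint (op_tensor a b) (op_tensor a' b').
Proof.
move=> ab ab' aa bb; apply: adjoint_tensor_ext; try exact: op_tensor_bounded.
move=> u v u' v'; rewrite (op_tensorP ab).2 (op_tensorP ab').2.
apply: (etrans (inner_tensor _ _ _ _)); rewrite aa bb; symmetry; exact: inner_tensor.
Qed.

Lemma elementary_star : star_alg G.
Proof.
apply: star_alg_span.
- by move=> _ [a [b [_ [_ [_ _ _ _ ->]]]]]; exact: op_tensor_bounded.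
- move=> _ _ [a [b [a' [b' [[La Lb] [La' Lb'] [aa bb] [ab ab'] ->]]]]]
    [x [y [x' [y' [[Lx Ly] [Lx' Ly'] [xx yy] [xy xy'] ->]]]]].
  exists (a \o x), (b \o y), (x' \o a'), (y' \o b'); split.
  + by split; exact: LT_comp.
  + by split; exact: LT_comp.
  + by split; exact: adjoint_comp.
  + by split; exact: tensorable_comp.
  + by rewrite op_tensor_comp.
- move=> _ [a [b [a' [b' [Lab Lab' [aa bb] [ab ab'] ->]]]]].
  exists (op_tensor a' b'); last exact: op_tensor_adjoint.
  by exists a', b', a, b; split => //; split; exact: adjointC.
Qed.

Lemma elementary_bounded : G `<=` @bounded_op _ _ _ mu2.
Proof. by have [] := elementary_star. Qed.

Lemma elementary_LT2 : op_closure G `<=` @LT2 R.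
Proof.
apply: op_closureS; apply: lin_span_min (lin_span_subspace _) _.
by move=> _ [a [b [_ [_ [[La Lb] _ _ _ ->]]]]]; apply: sub_lin_span; exists a => //; exists b.
Qed.

Definition torus_toeplitz (f : T * T -> Cx R) : op2 := Q \o mulop f \o Q.

Lemma torus_toeplitzE theta tau f :
  toeplitz (OmegaT2 theta tau) (mulop f) = torus_toeplitz f.
Proof. by rewrite /toeplitz ind_proj_OmegaT2. Qed.

Lemma PT2_idem : Q \o Q = Q. Proof. exact: torus_projection_idem HP. Qed.

Lemma PT2_adjoint : is_adjoint Q Q. Proof. exact: torus_projection_adjoint HP. Qed.

Lemma PT2_bounded : bounded_op Q. Proof. exact: op_tensor_bounded. Qed.

Lemma hnorm_PT2 (u : H2) : hnorm (Q u) <= hnorm u.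
Proof.
rewrite hnorm_leP ?hnorm_ge0// hnorm2; apply: selfadjoint_proj_le PT2_adjoint _.
exact: (congr1 (fun h => h u) PT2_idem).
Qed.

Lemma torus_toeplitz_bounded f : bounded_measurable f -> bounded_op (torus_toeplitz f).
Proof.
move=> bf; exact: bounded_op_comp PT2_bounded (bounded_op_comp (mulop_bounded _ bf) PT2_bounded).
Qed.

Lemma torus_toeplitz_lin k f g : bounded_measurable f -> bounded_measurable g ->
  torus_toeplitz (fun x => k * f x + g x) = k *: torus_toeplitz f + torus_toeplitz g.
Proof.
move=> bf bg; apply/funext => u; rewrite /torus_toeplitz /= (mulop_lin _ k bf bg).
by have [lQ _] := PT2_bounded; exact: lQ.
Qed.

Lemma torus_toeplitz1 : torus_toeplitz (fun=> 1) = Q.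
Proof. by rewrite /torus_toeplitz mulop1; exact: PT2_idem. Qed.

Lemma torus_toeplitz_monomial m n :
  torus_toeplitz (monomial m n) = op_tensor (toeplitz_shift P m) (toeplitz_shift P n).
Proof.
have tP := tensorable_hardy_proj HP; have tS := tensorable_shift R m n.
rewrite /torus_toeplitz -op_tensor_shift /PT2 (op_tensor_comp tP tS).
by rewrite (op_tensor_comp (tensorable_comp tP tS) tP).
Qed.

Lemma tensorable_toeplitz_shift m n :
  tensorable (toeplitz_shift P m) (toeplitz_shift P n).
Proof.
have tP := tensorable_hardy_proj HP; have tS := tensorable_shift R m n.
exact: (tensorable_comp (tensorable_comp tP tS) tP).
Qed.

Lemma elementary_monomial m n : G (torus_toeplitz (monomial m n)).
Proof.
apply: sub_lin_span; exists (toeplitz_shift P m), (toeplitz_shift P n),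
  (toeplitz_shift P (- m)), (toeplitz_shift P (- n)); split.
- by split; exact: (LT_toeplitz_shift HP).
- by split; exact: (LT_toeplitz_shift HP).
- by split; exact: toeplitz_shift_adjoint.
- by split; exact: tensorable_toeplitz_shift.
- exact: torus_toeplitz_monomial.
Qed.

Lemma elementary_trig N q : trig_polynomial N q -> G (torus_toeplitz q).
Proof.
move=> qN; suff : bounded_measurable q /\ G (torus_toeplitz q) by case.
refine (@lin_span_min _ _ _ [set q : T * T -> Cx R | bounded_measurable q /\ G (torus_toeplitz q)] _ _ q qN).
  split.
    split; first exact: (@bounded_measurable_cst _ _ R 0).
    rewrite (_ : torus_toeplitz 0 = 0); first by have [] := lin_span_subspace elementary_tensors.
    have := torus_toeplitz_lin (-1) (@bounded_measurable_cst _ _ R 1) (@bounded_measurable_cst _ _ R 1).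
    by rewrite mulN1r addNr scaleN1r addNr.
  move=> k f g [bf Gf] [bg Gg]; split.
    exact: (bounded_measurableD (bounded_measurableM (@bounded_measurable_cst _ _ R k) bf) bg).
  rewrite (_ : torus_toeplitz _ = k *: torus_toeplitz f + torus_toeplitz g).
    exact: (lin_span_subspace _).2.
  exact: torus_toeplitz_lin.
move=> _ [m [n [_ _ ->]]]; split; first exact: bounded_measurable_monomial.
exact: elementary_monomial.
Qed.

Lemma torus_toeplitz_le f (e : R) : bounded_measurable f -> 0 <= e ->
  (forall x, sqnorm (f x) <= e ^+ 2) -> forall u, hnorm (torus_toeplitz f u) <= e * hnorm u.
Proof.
move=> [mf _] e0 fe u; apply: le_trans (hnorm_PT2 _) _.
apply: le_trans (mulop_bound mf e0 fe _) _; apply: ler_wpM2l => //; exact: hnorm_PT2.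
Qed.

Lemma elementary_continuous f : continuous f -> op_closure G (torus_toeplitz f).
Proof.
move=> cf; have bf := bounded_measurable_continuous cf.
apply: approx_op_closure (torus_toeplitz_bounded bf) _ => e e0.
have [N [q Nq fq]] := trig_approximation cf (exprn_gt0 2 e0).
have bq := bounded_measurable_trig Nq.
exists (torus_toeplitz q); first exact: elementary_trig Nq.
move=> u; have -> : torus_toeplitz f u - torus_toeplitz q u = torus_toeplitz (fun x => -1 * q x + f x) u.
  by rewrite (torus_toeplitz_lin (-1) bq bf) scaleN1r addrC.
apply: torus_toeplitz_le (ltW e0) _ u.
  exact: (bounded_measurableD (bounded_measurableM (@bounded_measurable_cst _ _ R (-1)) bq) bf).
by move=> x; rewrite mulN1r addrC; exact: fq.
Qed.

(** Slice maps are prescribed on elementary tensors; this inclusion lets them be computed on the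
    Toeplitz algebra. *)
Lemma toeplitz_algebra_elementary theta tau :
  toeplitz_algebra (OmegaT2 theta tau) (@CT2 R) `<=` op_closure G.
Proof.
apply: cstar_generated_min (star_alg_closure elementary_star) _.
by move=> _ [_ [f cf <-] <-]; rewrite torus_toeplitzE; exact: elementary_continuous.
Qed.

End torus_toeplitz.

(** * The gap projection, the ideal and multiplicativity of slices *)

Section gap_traces.
Context (R : realType).
Local Notation T := (circle R).
Local Notation mu := (circle_measure R).
Local Notation mu2 := (torus_measure R).
Local Notation H := (L2 mu).
Local Notation H2 := (L2 mu2).
Local Notation op := (H -> H).
Local Notation op2 := (H2 -> H2).
Local Notation P := (@PT R).
Local Notation Q := (@PT2 R).
Local Notation LT := (@LT R).
Local Notation G := (lin_span (@elementary_tensors R)).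
Local Notation p_ := (range_proj P).
Local Notation E_ := (@hardy_trunc R).
Implicit Types (a b : op) (c d : op2) (k : Cx R).
Context (HP : hardy_proj_spec P).

Lemma elementary_mem a b a' b' : LT a -> LT b -> LT a' -> LT b' ->
  is_adjoint a a' -> is_adjoint b b' -> tensorable a b -> tensorable a' b' ->
  G (op_tensor a b).
Proof. by move=> *; apply: sub_lin_span; exists a, b, a', b'. Qed.

Lemma tensorableBl a a' b : tensorable a b -> tensorable a' b -> tensorable (a - a') b.
Proof.
move=> [c [bc cE]] [c' [bc' cE']]; exists (c - c'); split; first exact: bounded_opB.
move=> u v; rewrite -[LHS]/(c (tensor u v) - c' (tensor u v)) cE cE'.
by symmetry; exact: tensorBl.
Qed.

Lemma tensorableBr a b b' : tensorable a b -> tensorable a b' -> tensorable a (b - b').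
Proof.
move=> [c [bc cE]] [c' [bc' cE']]; exists (c - c'); split; first exact: bounded_opB.
move=> u v; rewrite -[LHS]/(c (tensor u v) - c' (tensor u v)) cE cE'.
by symmetry; exact: tensorBr.
Qed.

Lemma toeplitz_shift0 : toeplitz_shift P 0 = P.
Proof. by rewrite /toeplitz_shift shift0 -[RHS](hardy_proj_idem HP). Qed.

Lemma tensorable_range_proj N : tensorable (p_ N) P.
Proof.
have := tensorable_comp (tensorable_toeplitz_shift HP N 0) (tensorable_toeplitz_shift HP (- N%:Z) 0).
by rewrite toeplitz_shift0 (hardy_proj_idem HP).
Qed.

Lemma tensorable_range_proj2 N : tensorable (p_ N) (p_ N).
Proof.
exact: (tensorable_comp (tensorable_toeplitz_shift HP N N)
  (tensorable_toeplitz_shift HP (- N%:Z) (- N%:Z))).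
Qed.

Lemma tensorable_trunc_proj N : tensorable (E_ N) P.
Proof.
rewrite (hardy_trunc_range HP).
exact: (tensorableBl (tensorable_hardy_proj HP) (tensorable_range_proj N)).
Qed.

Lemma tensorable_range_trunc N : tensorable (p_ N) (E_ N).
Proof.
rewrite (hardy_trunc_range HP).
exact: (tensorableBr (tensorable_range_proj N) (tensorable_range_proj2 N)).
Qed.

(** The projection of the Hardy space H of the torus onto the orthogonal complement of (z1 z2)^N H,
    written with Toeplitz operators so that it lies in the Toeplitz algebra. *)
Definition gap (N : nat) : op2 :=
  Q - (torus_toeplitz (monomial N N) \o torus_toeplitz (monomial (- N%:Z) (- N%:Z))).

(* [P (x) P - p (x) p = (P - p) (x) P + p (x) (P - p)]. *)
Lemma gapE N : gap N = op_tensor (E_ N) P + op_tensor (p_ N) (E_ N).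
Proof.
have tp := tensorable_range_proj2 N.
rewrite /gap !(torus_toeplitz_monomial HP).
rewrite (op_tensor_comp (tensorable_toeplitz_shift HP N N) (tensorable_toeplitz_shift HP _ _)).
apply: bounded_op_tensor_ext.
- by apply: bounded_opB; exact: op_tensor_bounded.
- have := bounded_op_lin 1 (op_tensor_bounded (E_ N) P) (op_tensor_bounded (p_ N) (E_ N)).
  by rewrite scale1r.
move=> u v.
rewrite -[LHS]/(op_tensor P P (tensor u v) - op_tensor (p_ N) (p_ N) (tensor u v)).
rewrite -[RHS]/(op_tensor (E_ N) P (tensor u v) + op_tensor (p_ N) (E_ N) (tensor u v)).
rewrite (op_tensorP (tensorable_hardy_proj HP)).2 (op_tensorP tp).2.
rewrite (op_tensorP (tensorable_trunc_proj N)).2 (op_tensorP (tensorable_range_trunc N)).2.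
have EE w : E_ N w = P w - p_ N w by rewrite (hardy_trunc_range HP).
rewrite !EE (tensorBl (P u)) (tensorBr (P v)).
by rewrite addrA subrK.
Qed.

Lemma range_proj_adjoint N : is_adjoint (p_ N) (p_ N).
Proof.
have a1 := toeplitz_shift_adjoint HP N; have a2 := toeplitz_shift_adjoint HP (- N%:Z).
by have := adjoint_comp a1 a2; rewrite opprK.
Qed.

Lemma elementary_gap N : G (gap N).
Proof.
rewrite gapE; apply: (lin_subspaceD (lin_span_subspace _)).
  apply: (elementary_mem (LT_trunc HP N) (@LT_PT R) (LT_trunc HP N) (@LT_PT R)
    (@hardy_trunc_adjoint R N) (hardy_proj_adjoint HP)); exact: tensorable_trunc_proj.
apply: (elementary_mem (LT_range_proj HP N) (LT_trunc HP N) (LT_range_proj HP N) (LT_trunc HP N)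
  (range_proj_adjoint N) (@hardy_trunc_adjoint R N)); exact: tensorable_range_trunc.
Qed.

Lemma gap_bounded N : bounded_op (gap N).
Proof. by apply: (elementary_bounded HP); exact: elementary_gap. Qed.

(** Linearity and continuity reduce [x] and [y] to elementary tensors, for which the product is
    computed factor by factor. *)
Lemma tensor_sandwich (A B : set op) a b : tensorable a b ->
  (forall x y, LT_adj x -> LT_adj y -> A (x \o a \o y)) ->
  (forall x y, LT_adj x -> LT_adj y -> B (x \o b \o y)) ->
  forall x y, op_closure G x -> op_closure G y -> tensor_closure A B (x \o op_tensor a b \o y).
Proof.
move=> tab AL BL; apply: sandwich_closure.
- exact: elementary_bounded.
- apply: lin_span_min (bounded_op_subspace _) _ => _ [x _ [y _ <-]]; exact: op_tensor_bounded.
- exact: op_tensor_bounded.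
pose L : set op2 := lin_span [set op_tensor a b | a in A & b in B].
have LS : lin_subspace L := lin_span_subspace _.
move=> x y Gx Gy.
refine (@lin_span_min _ _ _ [set x : op2 | L (x \o op_tensor a b \o y)] _ _ x Gx).
  by split; [have [] := LS|move=> k c d /= xL yL; exact: (LS.2 k _ _ xL yL)].
move=> {Gx}_ [x1 [x2 [x1' [x2' [[Lx1 Lx2] [Lx1' Lx2'] [xx1 xx2] [tx _] ->]]]]] /=.
set X := op_tensor x1 x2.
have [lX _] : bounded_op (X \o op_tensor a b).
  by apply: bounded_op_comp; exact: op_tensor_bounded.
refine (@lin_span_min _ _ _ [set y : op2 | L (X \o op_tensor a b \o y)] _ _ y Gy).
  split.
    rewrite /= (_ : _ \o 0 = 0); first by have [] := LS.
    by apply/funext => u; exact: (linear_op0 lX).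
  move=> k c d /= xL yL.
  rewrite (_ : _ \o _ = k *: (X \o op_tensor a b \o c) + (X \o op_tensor a b \o d)).
    exact: (LS.2 k _ _ xL yL).
  by apply/funext => u; exact: lX.
move=> {Gy}_ [y1 [y2 [y1' [y2' [[Ly1 Ly2] [Ly1' Ly2'] [yy1 yy2] [ty _] ->]]]]] /=.
rewrite /X (op_tensor_comp tx tab) (op_tensor_comp (tensorable_comp tx tab) ty).
apply: sub_lin_span; exists (x1 \o a \o y1).
  by apply: AL; split => //; [exists x1'|exists y1'].
exists (x2 \o b \o y2) => //.
by apply: BL; split => //; [exists x2'|exists y2'].
Qed.

(** Each summand in [gapE] has a truncation as one of its factors, and products around it fall into
    [KT]. *)
Lemma IT2_gap N x y : op_closure G x -> op_closure G y -> IT2 (x \o gap N \o y).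
Proof.
move=> Gx Gy; have [lx _] := op_closure_bounded Gx.
have LTs (c : op) : LT c -> forall a b, LT_adj a -> LT_adj b -> LT (a \o c \o b).
  by move=> Lc a b [La _] [Lb _]; exact: (LT_comp HP (LT_comp HP La Lc) Lb).
exists (x \o op_tensor (p_ N) (E_ N) \o y).
  apply: tensor_sandwich => //; [exact: tensorable_range_trunc|exact: (LTs _ (LT_range_proj HP N))|].
  exact: (@KT_trunc_sandwich R HP N).
exists (x \o op_tensor (E_ N) P \o y).
  apply: tensor_sandwich => //; [exact: tensorable_trunc_proj| |exact: (LTs _ (@LT_PT R))].
  exact: (@KT_trunc_sandwich R HP N).
rewrite gapE; apply/funext => u.
rewrite -[LHS]/(x (op_tensor (p_ N) (E_ N) (y u)) + x (op_tensor (E_ N) P (y u))).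
by rewrite -(linear_opD _ _ lx) addrC.
Qed.

(* A bounded linear map that is multiplicative on elementary tensors is
   multiplicative on their closed span. *)
Lemma slice_comp (S : op2 -> op) (s : op -> op -> op) : bounded_linear_map S ->
  (forall a b, LT a -> LT b -> S (op_tensor a b) = s a b) ->
  (forall a b a' b', LT a -> LT b -> LT a' -> LT b' ->
     s a b \o s a' b' = s (a \o a') (b \o b')) ->
  forall x y, op_closure G x -> op_closure G y -> S (x \o y) = S x \o S y.
Proof.
move=> [SL Slin [M SM]] Ss sM.
have GL := @elementary_LT2 R; have Gb := elementary_bounded HP.
have GS : lin_subspace G := lin_span_subspace _.
have G_cl c : G c -> op_closure G c by exact: sub_op_closure.
have [_ _ GM _] := elementary_star HP.
have CM := op_closure_comp Gb GM.
have bS c : op_closure G c -> bounded_op (S c) by move=> /GL /SL; exact: LT_bounded.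
have S0 : S 0 = 0.
  have L0 : LT2 (0 : op2) by apply: GL; apply: G_cl; have [] := GS.
  have := Slin (-1) 0 0 L0 L0; rewrite scaler0 addr0 scaleN1r addNr; by [].
have lc c : op_closure G c -> linear c by move=> /op_closure_bounded[].
have SlinG k c d : op_closure G c -> op_closure G d -> S (k *: c + d) = k *: S c + S d.
  by move=> /GL Lc /GL Ld; exact: Slin.
have SB c d : op_closure G c -> op_closure G d -> S (c - d) = S c - S d.
  by move=> cG dG; have := SlinG (-1) d c dG cG; rewrite !scaleN1r addrC [X in _ = X -> _]addrC.
have base x y : elementary_tensors x -> elementary_tensors y -> S (x \o y) = S x \o S y.
  move=> [x1 [x2 [x1' [x2' [[Lx1 Lx2] _ _ [tx _] ->]]]]].
  move=> [y1 [y2 [y1' [y2' [[Ly1 Ly2] _ _ [ty _] ->]]]]].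
  rewrite (op_tensor_comp tx ty) (Ss _ _ Lx1 Lx2) (Ss _ _ Ly1 Ly2) (sM _ _ _ _ Lx1 Lx2 Ly1 Ly2).
  exact: Ss (LT_comp HP Lx1 Ly1) (LT_comp HP Lx2 Ly2).
have El c : elementary_tensors c -> G c by exact: sub_lin_span.
have step1 x y : G x -> elementary_tensors y -> S (x \o y) = S x \o S y.
  move=> Gx Ey.
  refine (@lin_span_min _ _ _ [set x : op2 | G x /\ S (x \o y) = S x \o S y] _ _ x Gx).2.
    split; first by split; [have [] := GS|rewrite (_ : 0 \o y = 0)// S0].
    move=> k c d /= [cG cE] [dG dE]; split; first exact: (GS.2 k _ _ cG dG).
    rewrite (_ : _ \o y = k *: (c \o y) + (d \o y))// !SlinG ?cE ?dE//; try exact: G_cl.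
    - by apply: G_cl; apply: GM => //; exact: El.
    - by apply: G_cl; apply: GM => //; exact: El.
  by move=> c Ec; split; [exact: El|exact: base].
have step2 x y : G x -> G y -> S (x \o y) = S x \o S y.
  move=> Gx Gy; have lx := lc _ (G_cl _ Gx); have [lSx _] := bS _ (G_cl _ Gx).
  refine (@lin_span_min _ _ _ [set y : op2 | G y /\ S (x \o y) = S x \o S y] _ _ y Gy).2.
    split.
      split; [by have [] := GS|rewrite S0 (_ : x \o 0 = 0) ?S0].
        by apply/funext => u; rewrite /= (linear_op0 lSx).
      by apply/funext => u; exact: (linear_op0 lx).
    move=> k c d /= [cG cE] [dG dE]; split; first exact: (GS.2 k _ _ cG dG).
    rewrite (_ : x \o _ = k *: (x \o c) + (x \o d)); last by apply/funext => u; exact: lx.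
    rewrite !SlinG ?cE ?dE//; try exact: G_cl.
    - by apply/funext => u; rewrite /= lSx.
    - by apply: G_cl; exact: GM.
    - by apply: G_cl; exact: GM.
  by move=> c Ec; split; [exact: El|exact: step1].
(* The bound [M] of the slice map is of unknown sign, so its positive part is used. *)
have K0 : 0 <= Num.max 0 M by rewrite le_max lexx.
have Sle c (e : R) : op_closure G c -> 0 <= e -> (forall u, hnorm (c u) <= e * hnorm u) ->
    forall u, hnorm (S c u) <= (Num.max 0 M * e) * hnorm u.
  move=> cG e0 ce; apply: le_opnorm; first by have [] := bS _ cG.
  apply: le_trans (SM _ (GL _ cG)) _; have ce' := opnorm_le e0 ce.
  have n0 : (0 <= opnorm c)%E.
    by apply: ereal_sup_ubound; exists 0 => /=; rewrite ?(linear_op0 (lc _ cG)) hnorm0.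
  apply: le_trans (lee_wpmul2r n0 _ : _ <= (Num.max 0 M)%:E * _)%E _.
    by rewrite lee_fin le_max lexx orbT.
  by rewrite EFinM; apply: lee_wpmul2l ce'; rewrite lee_fin.
(* Both sides are continuous in each variable, so approximate [x], then [y], in [G]. *)
have small (a b : op) (C : R) : (forall e, 0 < e -> forall u, hnorm (a u - b u) <= e * (C * hnorm u)) -> a = b.
  move=> h; apply/funext => u; apply/eqP; rewrite -subr_eq0; apply/eqP.
  exact: (@hnorm_small _ _ _ _ _ (C * hnorm u)) (fun e e0 => h e e0 u).
have approx x y y' (C D : R) e : op_closure G x -> op_closure G y -> op_closure G y' ->
    0 <= C -> (forall u, hnorm (x u) <= C * hnorm u) ->
    0 <= D -> (forall u, hnorm (S x u) <= D * hnorm u) -> 0 < e ->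
    (forall u, hnorm (y u - y' u) <= e * hnorm u) -> S (x \o y') = S x \o S y' ->
    forall u, hnorm (S (x \o y) u - (S x \o S y) u) <=
      e * ((Num.max 0 M * C + D * Num.max 0 M) * hnorm u).
  move=> xG yG y'G C0 xC D0 SD e0 yy Sxy' u.
  have dG : op_closure G (y - y') by apply: (lin_subspaceB (op_closure_subspace Gb GS)).
  apply: le_trans (hnormB_tri (S (x \o y') u) _ _) _.
  have -> : S (x \o y) u - S (x \o y') u = S (x \o (y - y')) u.
    have -> : x \o (y - y') = (x \o y) - (x \o y').
      by apply/funext => w; exact: (linear_opB _ _ (lc _ xG)).
    by rewrite (SB _ _ (CM _ _ xG yG) (CM _ _ xG y'G)).
  have -> : S (x \o y') u - (S x \o S y) u = - S x (S (y - y') u).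
    have [lSx _] := bS _ xG.
    by rewrite Sxy' (SB _ _ yG y'G) -[(_ - _) u]/(S y u - S y' u) (linear_opB _ _ lSx) opprB.
  rewrite hnormN; apply: (@le_trans _ _ (Num.max 0 M * (C * e) * hnorm u + D * (Num.max 0 M * e * hnorm u))).
    apply: lerD.
      apply: Sle; [exact: CM|exact: mulr_ge0 C0 (ltW e0)|move=> w].
      apply: le_trans (xC _) _; rewrite -mulrA; apply: ler_wpM2l => //; exact: yy.
    apply: le_trans (SD _) _; apply: ler_wpM2l => //.
    apply: Sle => //; exact: ltW.
  by rewrite le_eqVlt; apply/orP; left; apply/eqP; ring.
have step3 x y : G x -> op_closure G y -> S (x \o y) = S x \o S y.
  move=> Gx yG; have xG := G_cl _ Gx.
  have [C /ltW C0 xC] := bounded_opP (Gb _ Gx); have [D /ltW D0 xD] := bounded_opP (bS _ xG).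
  apply: (small _ _ (Num.max 0 M * C + D * Num.max 0 M)) => e e0.
  have [y' Gy' yy] := op_closure_approx Gb yG e0.
  exact: (approx x y y' C D e xG yG (G_cl _ Gy') C0 xC D0 xD e0 yy (step2 _ _ Gx Gy')).
move=> x y xG yG.
have [C /ltW C0 yC] := bounded_opP (op_closure_bounded yG).
have [D /ltW D0 yD] := bounded_opP (bS _ yG).
apply: (small _ _ (Num.max 0 M * C + Num.max 0 M * D)) => e e0 u.
have [x' Gx' xx] := op_closure_approx Gb xG e0; have x'G := G_cl _ Gx'.
have dG : op_closure G (x - x') by apply: (lin_subspaceB (op_closure_subspace Gb GS)).
apply: le_trans (hnormB_tri (S (x' \o y) u) _ _) _.
have -> : S (x \o y) u - S (x' \o y) u = S ((x - x') \o y) u.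
  have -> : (x - x') \o y = (x \o y) - (x' \o y) by [].
  by rewrite (SB _ _ (CM _ _ xG yG) (CM _ _ x'G yG)).
have -> : S (x' \o y) u - (S x \o S y) u = - S (x - x') (S y u).
  by rewrite (step3 _ _ Gx' yG) (SB _ _ xG x'G) -[(_ - _) (S y u)]/(S x (S y u) - S x' (S y u)) opprB.
rewrite hnormN; apply: (@le_trans _ _ (Num.max 0 M * (e * C) * hnorm u + Num.max 0 M * e * (D * hnorm u))).
  apply: lerD.
    apply: Sle; [exact: CM|exact: mulr_ge0 (ltW e0) C0|move=> w].
    apply: le_trans (xx _) _; rewrite -mulrA; apply: ler_wpM2l (ltW e0) _ _ _; exact: yC.
  apply: le_trans (Sle _ _ dG (ltW e0) xx _) _; apply: ler_wpM2l (yD _).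
  exact: mulr_ge0 K0 (ltW e0).
by rewrite le_eqVlt; apply/orP; left; apply/eqP; ring.
Qed.

End gap_traces.

(** * Finite trace of products through the gap *)

Section gap_trace.
Context (R : realType).
Local Notation T := (circle R).
Local Notation mu := (circle_measure R).
Local Notation mu2 := (torus_measure R).
Local Notation H := (L2 mu).
Local Notation H2 := (L2 mu2).
Local Notation op := (H -> H).
Local Notation op2 := (H2 -> H2).
Local Notation P := (@PT R).
Local Notation Q := (@PT2 R).
Local Notation LT := (@LT R).
Local Notation G := (lin_span (@elementary_tensors R)).
Local Notation p_ := (range_proj P).
Local Notation E_ := (@hardy_trunc R).
Implicit Types (a b : op) (c d : op2) (k : Cx R) (f : T * T -> Cx R).
Context (HP : hardy_proj_spec P).
Context (theta : R) (theta0 : 0 < theta).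
Context (tau : op -> Cx R) (tauP : is_character LT tau) (tauP0 : tau P != 0).

(** Covers a slice map that has its default value 0. *)
Lemma trT0 : (trT (0%R : op) < +oo)%E.
Proof. exact: (@trT_trunc R 0%N 0%R 0%R (bounded_op0 _) (bounded_op0 _)). Qed.

(** A multiplicative slice that sends [gap N] to E_N sends x gap y to S(x) E_N S(y), to which
    [trT_trunc] applies. *)
Lemma slice_trT (S : op2 -> op) (s : op -> op -> op) N x y : bounded_linear_map S ->
  (forall a b, LT a -> LT b -> S (op_tensor a b) = s a b) ->
  (forall a b a' b', LT a -> LT b -> LT a' -> LT b' ->
     s a b \o s a' b' = s (a \o a') (b \o b')) ->
  s (E_ N) P + s (p_ N) (E_ N) = E_ N ->
  op_closure G x -> op_closure G y -> (trT (S (x \o gap N \o y)) < +oo)%E.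
Proof.
move=> SS Ss sM sE xG yG; have [SL Slin _] := SS.
have cl c : G c -> op_closure G c by apply: sub_op_closure; exact: elementary_bounded HP.
have gG := cl _ (elementary_gap HP N).
have [_ _ GM _] := elementary_star HP.
have xgG := op_closure_comp (elementary_bounded HP) GM xG gG.
rewrite (slice_comp HP SS Ss sM xgG yG) (slice_comp HP SS Ss sM xG gG).
have -> : S (gap N) = E_ N.
  have L1 : LT2 (op_tensor (E_ N) P).
    apply: elementary_LT2; apply: cl; apply: (elementary_mem (LT_trunc HP N) (@LT_PT R)
      (LT_trunc HP N) (@LT_PT R) (@hardy_trunc_adjoint R N) (hardy_proj_adjoint HP));
      exact: (tensorable_trunc_proj HP).
  have L2' : LT2 (op_tensor (p_ N) (E_ N)).
    apply: elementary_LT2; apply: cl; apply: (elementary_mem (LT_range_proj HP N) (LT_trunc HP N)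
      (LT_range_proj HP N) (LT_trunc HP N) (range_proj_adjoint HP N) (@hardy_trunc_adjoint R N));
      exact: (tensorable_range_trunc HP).
  have := Slin 1 _ _ L1 L2'; rewrite !scale1r -(gapE HP) => ->.
  rewrite (Ss _ _ (LT_trunc HP N) (@LT_PT R)) (Ss _ _ (LT_range_proj HP N) (LT_trunc HP N)).
  exact: sE.
have bS c : op_closure G c -> bounded_op (S c).
  by move=> cG; apply: (LT_bounded HP); apply: SL; exact: elementary_LT2.
exact: trT_trunc (bS _ xG) (bS _ yG).
Qed.

(** On the gap the slice equals tau(E_N) P + tau(p_N) E_N = E_N. *)
Lemma slicel_trT N x y : op_closure G x -> op_closure G y ->
  (trT (slicel tau (x \o gap N \o y)) < +oo)%E.
Proof.
move=> xG yG; rewrite /slicel; set X := mkset _; have [->|[SS Ss]] := xget_cases (fun=> 0) X; first exact: trT0.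
apply: (slice_trT SS Ss) => //.
- move=> a b a' b' La Lb La' Lb'; have [lb _] := LT_bounded HP Lb; have [_ tauM _] := tauP.
  apply/funext => u; rewrite -[LHS]/(tau a *: b (tau a' *: b' u)).
  by rewrite -[RHS]/(tau (a \o a') *: b (b' u)) (linear_opZ _ _ lb) scalerA tauM.
- by rewrite (character_trunc HP tauP tauP0) (character_range_proj HP tauP tauP0) scale0r add0r scale1r.
Qed.

Lemma slicer_trT N x y : op_closure G x -> op_closure G y ->
  (trT (slicer tau (x \o gap N \o y)) < +oo)%E.
Proof.
move=> xG yG; rewrite /slicer; set X := mkset _; have [->|[SS Ss]] := xget_cases (fun=> 0) X; first exact: trT0.
apply: (slice_trT (s := fun a b => tau b *: a) SS Ss) => //.
- move=> a b a' b' La Lb La' Lb'; have [la _] := LT_bounded HP La; have [_ tauM _] := tauP.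
  apply/funext => u; rewrite -[LHS]/(tau b *: a (tau b' *: a' u)).
  by rewrite -[RHS]/(tau (b \o b') *: a (a' u)) (linear_opZ _ _ la) scalerA tauM.
- by rewrite (character_trunc HP tauP tauP0) (character_hardy_proj HP tauP tauP0) scale0r addr0 scale1r.
Qed.

Lemma trT2_gap N x y : op_closure G x -> op_closure G y ->
  (trT2 theta tau (x \o gap N \o y) < +oo)%E.
Proof.
move=> xG yG; rewrite /trT2 asboolT; last exact: IT2_gap.
rewrite /tr1 lte_add_pinfty ?slicel_trT//.
by apply: lte_mul_pinfty; rewrite ?lee_fin ?ltW// slicer_trT.
Qed.

Local Notation A := (toeplitz_algebra (OmegaT2 theta tau) (@CT2 R)).

Lemma toeplitz_algebra_cstar : cstar_subalgebra A.
Proof. apply: cstar_generated_cstar; exact: toeplitz_generators_bounded. Qed.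

Lemma toeplitz_algebra_mem f : continuous f -> A (torus_toeplitz f).
Proof.
move=> cf; apply: sub_cstar_generated; exists (mulop f); last by rewrite torus_toeplitzE.
by exists f.
Qed.

Lemma gap_algebra N : A (gap N).
Proof.
have [_ AS AM _ _] := toeplitz_algebra_cstar.
apply: (lin_subspaceB AS); first by rewrite -(torus_toeplitz1 HP); apply: toeplitz_algebra_mem; exact: cst_continuous.
by apply: AM; apply: toeplitz_algebra_mem; exact: continuous_monomial.
Qed.

Lemma hnorm_monomial m n (u : H2) : hnorm (torus_toeplitz (monomial m n) u) <= hnorm (Q u).
Proof.
have QQ : Q (Q u) = Q u := congr1 (fun h => h u) (PT2_idem HP).
have -> : torus_toeplitz (monomial m n) u = torus_toeplitz (monomial m n) (Q u).
  by rewrite /torus_toeplitz /= QQ.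
rewrite -[leRHS]mul1r; apply: (torus_toeplitz_le HP (bounded_measurable_monomial R m n)) => // x.
by rewrite expr1n sqnormM !circle_sqnorm_expz mulr1.
Qed.

Lemma torus_toeplitz_adjoint f : bounded_measurable f ->
  is_adjoint (torus_toeplitz f) (torus_toeplitz (fun x => conjc (f x))).
Proof.
move=> bf; have QQ := PT2_adjoint HP.
have mf : is_adjoint (mulop f : op2) (mulop (fun x => conjc (f x))) by exact: mulop_adjoint.
exact: (adjoint_comp (adjoint_comp QQ mf) QQ).
Qed.

(** The form is |Q u|^2 - |b u|^2, where b is the Toeplitz operator of (z1 z2)^-N, a contraction
    that factors through Q. *)
Lemma gap_ge0 N (u : H2) : 0 <= inner (gap N u) u.
Proof.
pose a := torus_toeplitz (@monomial R N N); pose b := torus_toeplitz (@monomial R (- N%:Z) (- N%:Z)).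
have ab : is_adjoint a b.
  have -> : b = torus_toeplitz (fun x => conjc (monomial N N x)).
    congr torus_toeplitz; apply/funext => x.
    by rewrite /monomial rmorphM /= !conjc_expz.
  exact: torus_toeplitz_adjoint (bounded_measurable_monomial R N N).
have QQ : Q (Q u) = Q u := congr1 (fun h => h u) (PT2_idem HP).
have -> : inner (gap N u) u = inner (Q u) u - inner (a (b u)) u by exact: (innerBl (Q u) _ u).
rewrite ab inner_sqn -QQ (PT2_adjoint HP) inner_sqn -rmorphB lecE /= eqxx subr_ge0.
by rewrite -!hnorm2 ler_sqr ?nnegrE ?hnorm_ge0// hnorm_monomial.
Qed.

(** The span is generated by positive elements, so polarization with weight [gap N] reduces to y*
    gap y, positive and of finite trace by [trT2_gap]. *)
Lemma trace_span_gap N x y :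
  [set a | A a /\ exists2 a', A a' & is_adjoint a a'] x ->
  [set a | A a /\ exists2 a', A a' & is_adjoint a a'] y ->
  trace_span A (trT2 theta tau) (x \o gap N \o y).
Proof.
move=> Dx Dy; have [lg _] := gap_bounded HP N.
apply: (polarization (cstar_adjointable toeplitz_algebra_cstar) (lin_span_subspace _)
  lg _ Dx Dy) => {Dx Dy} {}y y' [Ay _] [Ay' _] yy'.
have [Ab _ AM _ _] := toeplitz_algebra_cstar.
have Ac : A (y' \o gap N \o y) by apply: (AM _ _ _ Ay); apply: (AM _ _ Ay'); exact: gap_algebra.
apply: sub_lin_span; split => //.
- split; first exact: (Ab _ Ac).
  move=> u; have -> : inner ((y' \o gap N \o y) u) u = inner (gap N (y u)) (y u).
    exact: (adjointC yy').
  exact: gap_ge0.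
- by apply: trT2_gap; exact: (toeplitz_algebra_elementary HP (theta := theta) (tau := tau)).
Qed.

End gap_trace.

(** * Invertible implies Fredholm *)

(** The inverse must have an adjoint in [A] for [polarization] to apply to it. The Neumann series
    for P - T' supplies one: with W = P - T and W' = P - T', <c u, v> = <c u, W' c' v> = <W c u, c'
    v> = <u, c' v>. *)
Lemma neumann_adjointable d (X : measurableType d) (R : realType) (mu : {measure set X -> \bar R})
    (A : set (L2 mu -> L2 mu)) (P T T' : L2 mu -> L2 mu) : cstar_subalgebra A ->
  A P -> is_adjoint P P -> P \o P = P -> A T -> A T' -> is_adjoint T T' ->
  P \o T = T -> T \o P = T -> (forall u, hnorm (T u) <= 2^-1 * hnorm u) ->
  exists c, [/\ A c, c \o (P - T) = P, (P - T) \o c = P &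
    exists2 c', A c' & is_adjoint c c'].
Proof.
move=> AA AP aP PP AT AT' aT PT TP T2.
have h0 : 0 <= 2^-1 :> R by rewrite invr_ge0.
have T'2 := adjoint_bound h0 aT T2.
have PT' : P \o T' = T' by exact: (op_eq_adjoint (adjoint_comp aT aP) aT TP).
have TP' : T' \o P = T' by exact: (op_eq_adjoint (adjoint_comp aP aT) aT PT).
have [c [Ac cW Wc Pc]] := neumann AA AP AT PP PT TP T2.
have [c' [Ac' _ Wc' Pc']] := neumann AA AP AT' PP PT' TP' T'2.
exists c; split => //; exists c' => // u v.
have aW : is_adjoint (P - T) (P - T').
  move=> x y; transitivity (inner (P x) y - inner (T x) y); first exact: innerBl.
  rewrite aP aT; symmetry; exact: innerBr.
have cE u0 : P (c u0) = c u0 := congr1 (fun h => h u0) Pc.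
have cE' v0 : P (c' v0) = c' v0 := congr1 (fun h => h v0) Pc'.
have WE : (P - T) (c u) = P u := congr1 (fun h => h u) Wc.
have WE' : (P - T') (c' v) = P v := congr1 (fun h => h v) Wc'.
by rewrite -[in LHS]cE aP -WE' -aW WE aP cE'.
Qed.

Section invertible_implies_fredholm.
Context (R : realType).
Local Notation T := (circle R).
Local Notation mu := (circle_measure R).
Local Notation mu2 := (torus_measure R).
Local Notation H := (L2 mu).
Local Notation H2 := (L2 mu2).
Local Notation op := (H -> H).
Local Notation op2 := (H2 -> H2).
Local Notation P := (@PT R).
Local Notation Q := (@PT2 R).
Local Notation LT := (@LT R).
Local Notation Tt := (@torus_toeplitz R).
Implicit Types (c d : op2) (k : Cx R) (f g q phi psi : T * T -> Cx R).
Context (HP : hardy_proj_spec P).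

Lemma continuous_lin k f g : continuous f -> continuous g ->
  continuous (fun x => k * f x + g x).
Proof.
move=> cf cg x.
have ck : continuous (fun _ : T * T => k) by exact: cst_continuous.
exact: (cvgD (cvgM (ck x) (cf x)) (cg x)).
Qed.

Lemma continuous_mul f g : continuous f -> continuous g -> continuous (fun x => f x * g x).
Proof. by move=> cf cg x; exact: (cvgM (cf x) (cg x)). Qed.

Lemma continuous_trig N q : trig_polynomial N q -> continuous q.
Proof.
move=> qN; refine (@lin_span_min _ _ _ [set q : T * T -> Cx R | continuous q] _ _ q qN).
  split; first exact: (@cst_continuous _ (Cx R) 0).
  by move=> k f g cf cg; exact: (@continuous_lin k f g cf cg).
by move=> _ [m [n [_ _ ->]]]; exact: continuous_monomial.
Qed.

(** The symbol maps the Hardy space into itself; [coanalytic] is the adjoint condition, for symbols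
    whose conjugate does so. *)
Definition analytic f := Tt f = mulop f \o Q.
Definition coanalytic f := Tt f = Q \o mulop f.

Lemma analytic_monomial (m n : nat) : analytic (monomial m n).
Proof.
have tP := tensorable_hardy_proj HP; have tS := tensorable_shift R m n.
rewrite /analytic torus_toeplitz_monomial// /toeplitz_shift !(hardy_shift HP).
by rewrite -op_tensor_shift /PT2 (op_tensor_comp tS tP).
Qed.

Lemma coanalytic_monomial (m n : nat) : coanalytic (monomial (- m%:Z) (- n%:Z)).
Proof.
have tP := tensorable_hardy_proj HP; have tS := tensorable_shift R (- m%:Z) (- n%:Z).
rewrite /coanalytic torus_toeplitz_monomial// /toeplitz_shift !(hardy_coshift HP).
by rewrite -op_tensor_shift /PT2 (op_tensor_comp tP tS).
Qed.

Lemma monomialM (m n m' n' : int) (x : T * T) :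
  monomial m n x * monomial m' n' x = monomial (m + m') (n + n') x.
Proof. rewrite /monomial mulrACA; congr (_ * _); symmetry; exact: (expfzDr _ _ (circle_neq0 _)). Qed.

(** Induction over the span, shared by the shifts s = N, towards analytic symbols, and s = - N,
    towards co-analytic ones. *)
Lemma trig_shift_ind (B : set (T * T -> Cx R)) N (s : int) q :
  (forall k f g, bounded_measurable f -> bounded_measurable g -> B f -> B g ->
     B (fun x => k * f x + g x)) ->
  B (fun=> 0) ->
  (forall m n : int, (`|m| <= N)%N -> (`|n| <= N)%N -> B (monomial (m + s) (n + s))) ->
  trig_polynomial N q -> B (fun x => q x * monomial s s x).
Proof.
move=> Blin B0 Bm qN; have bs := bounded_measurable_monomial R s s.
refine (@lin_span_min _ _ _ [set q : T * T -> Cx R | bounded_measurable q /\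
  B (fun x => q x * monomial s s x)] _ _ q qN).2.
  split.
    split; first exact: (@bounded_measurable_cst _ _ R 0).
    by rewrite (_ : (fun x => _) = fun=> 0)//; apply/funext => x; exact: mul0r.
  move=> k f g [bf Bf] [bg Bg]; split.
    exact: (bounded_measurableD (bounded_measurableM (@bounded_measurable_cst _ _ R k) bf) bg).
  rewrite (_ : (fun x => _) = fun x => k * (f x * monomial s s x) + g x * monomial s s x).
    by apply: Blin => //; exact: bounded_measurableM.
  by apply/funext => x; rewrite -[LHS]/((k * f x + g x) * monomial s s x); ring.
move=> _ [m [n [mN nN ->]]]; split; first exact: bounded_measurable_monomial.
rewrite (_ : (fun x => _) = monomial (m + s) (n + s)); first exact: Bm.
by apply/funext => x; exact: monomialM.
Qed.

Lemma torus_toeplitz0 : Tt (fun=> 0) = 0.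
Proof.
have b1 := @bounded_measurable_cst _ (T * T)%type R 1.
have := torus_toeplitz_lin (-1) b1 b1; rewrite mulN1r addNr => ->.
by rewrite scaleN1r addNr.
Qed.

Lemma mulop0 : mulop (fun=> 0) = (0 : op2).
Proof.
have b1 := @bounded_measurable_cst _ (T * T)%type R 1.
have := mulop_lin mu2 (-1) b1 b1; rewrite mulN1r addNr => ->.
by rewrite scaleN1r addNr.
Qed.

Lemma analytic_trig N q : trig_polynomial N q -> analytic (fun x => q x * monomial N N x).
Proof.
apply: trig_shift_ind; first move=> k f g bf bg fE gE.
- rewrite /analytic (torus_toeplitz_lin k bf bg) fE gE.
  by apply/funext => u; rewrite /= (mulop_lin _ k bf bg).
- by rewrite /analytic torus_toeplitz0 mulop0.
- move=> m n mN nN; have [m' ->] : exists m' : nat, m + N = m' by exists (absz (m + N%:Z)); lia.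
  have [n' ->] : exists n' : nat, n + N = n' by exists (absz (n + N%:Z)); lia.
  exact: analytic_monomial.
Qed.

Lemma coanalytic_trig N q : trig_polynomial N q ->
  coanalytic (fun x => q x * monomial (- N%:Z) (- N%:Z) x).
Proof.
have [lQ _] := PT2_bounded R.
apply: trig_shift_ind; first move=> k f g bf bg fE gE.
- rewrite /coanalytic (torus_toeplitz_lin k bf bg) fE gE.
  by apply/funext => u; rewrite /= (mulop_lin _ k bf bg); symmetry; exact: lQ.
- rewrite /coanalytic torus_toeplitz0 mulop0; apply/funext => u.
  by symmetry; exact: (linear_op0 lQ).
- move=> m n mN nN; have [m' ->] : exists m' : nat, m - N%:Z = - m'%:Z by exists (absz (m - N%:Z)); lia.
  have [n' ->] : exists n' : nat, n - N%:Z = - n'%:Z by exists (absz (n - N%:Z)); lia.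
  exact: coanalytic_monomial.
Qed.

Lemma op_pointwise (h k : op2) (x : H2) : h = k -> h x = k x. Proof. by move=> ->. Qed.

(** Let X = T_{phi q} - T_phi T_q. On the range of T_{(z1 z2)^N} the function q acts as an analytic
    symbol, so the inner projection in T_phi T_q disappears and X vanishes. Hence X gap = X Q =
    X. *)
Lemma semi_commutator_gap N phi q : bounded_measurable phi -> trig_polynomial N q ->
  (Tt (fun x => phi x * q x) - (Tt phi \o Tt q)) \o gap N =
  Tt (fun x => phi x * q x) - (Tt phi \o Tt q).
Proof.
move=> bphi qN; have bq := bounded_measurable_trig qN.
have bm := bounded_measurable_monomial R N N; have an := analytic_trig qN.
have anm : analytic (monomial N N) := analytic_monomial N N.
have bpq := bounded_measurableM bphi bq.
set W := Tt (fun x => phi x * q x); pose X := W - (Tt phi \o Tt q); rewrite -/X.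
have bX : bounded_op X.
  apply: bounded_opB; first exact: (torus_toeplitz_bounded bpq).
  exact: bounded_op_comp (torus_toeplitz_bounded bphi) (torus_toeplitz_bounded bq).
have [lX _] := bX.
have QQ w : Q (Q w) = Q w := congr1 (fun h => h w) (PT2_idem HP).
have mE w : Tt (monomial N N) w = mulop (monomial N N) (Q w) := op_pointwise w anm.
have qmE w : mulop q (mulop (monomial N N) w) = mulop (fun x => q x * monomial N N x) w :> H2.
  exact: op_pointwise (mulop_comp mu2 bq bm).
have anE w : Q (mulop (fun x => q x * monomial N N x) (Q w)) = mulop (fun x => q x * monomial N N x) (Q w).
  exact: op_pointwise an.
have Qm w : Q (mulop (monomial N N) (Q w)) = mulop (monomial N N) (Q w) := op_pointwise w anm.
have XM w : X (Tt (monomial N N) w) = 0.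
  rewrite -[LHS]/(Q (mulop (fun x => phi x * q x) (Q (Tt (monomial N N) w))) -
    Q (mulop phi (Q (Q (mulop q (Q (Tt (monomial N N) w))))))) mE Qm qmE anE anE -qmE.
  have -> : mulop (fun x => phi x * q x) (mulop (monomial N N) (Q w)) =
      mulop phi (mulop q (mulop (monomial N N) (Q w))) :> H2.
    by symmetry; exact: op_pointwise (mulop_comp mu2 bphi bq).
  exact: subrr.
have XQ w : X (Q w) = X w.
  rewrite -[LHS]/(Q (mulop (fun x => phi x * q x) (Q (Q w))) - Q (mulop phi (Q (Q (mulop q (Q (Q w))))))).
  by rewrite (QQ w).
apply/funext => w; rewrite -[LHS]/(X (Q w - Tt (monomial N N) (Tt (monomial (- N%:Z) (- N%:Z)) w))).
by rewrite (linear_opB _ _ lX) XM XQ subr0.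
Qed.

(** Dual to the preceding argument: T_{(z1 z2)^-N} annihilates T_{q phi} - T_q T_phi on the left, as
    q (z1 z2)^-N is co-analytic. *)
Lemma gap_semi_commutator N phi q : bounded_measurable phi -> trig_polynomial N q ->
  gap N \o (Tt (fun x => q x * phi x) - (Tt q \o Tt phi)) =
  Tt (fun x => q x * phi x) - (Tt q \o Tt phi).
Proof.
move=> bphi qN; have bq := bounded_measurable_trig qN.
pose M' := @monomial R (- N%:Z) (- N%:Z).
have bm : bounded_measurable M' := bounded_measurable_monomial R _ _.
have an : coanalytic (fun x => q x * M' x) := coanalytic_trig qN.
have anm : coanalytic M' := coanalytic_monomial N N.
have bpq := bounded_measurableM bq bphi.
have [lQ _] := PT2_bounded R.
have QQ w : Q (Q w) = Q w := congr1 (fun h => h w) (PT2_idem HP).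
have mE w : Q (mulop M' (Q w)) = Q (mulop M' w) := op_pointwise w anm.
have qmE w : mulop M' (mulop q w) = mulop (fun x => q x * M' x) w :> H2.
  rewrite (_ : (fun x => _) = fun x => M' x * q x); last by apply/funext => x; rewrite mulrC.
  exact: op_pointwise (mulop_comp mu2 bm bq).
have anE w : Q (mulop (fun x => q x * M' x) (Q w)) = Q (mulop (fun x => q x * M' x) w).
  exact: op_pointwise an.
have bM := torus_toeplitz_bounded bm; have [lTM _] := bM.
have MY w : Tt M' (Q (mulop (fun x => q x * phi x) (Q w)) - Q (mulop q (Q (Q (mulop phi (Q w)))))) = 0.
  rewrite (linear_opB _ _ lTM).
  have TE v : Tt M' (Q v) = Q (mulop M' v) by rewrite -[LHS]/(Q (mulop M' (Q (Q v)))) QQ mE.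
  rewrite !TE QQ !qmE anE -qmE.
  have -> : mulop (fun x => q x * phi x) (Q w) = mulop q (mulop phi (Q w)) :> H2.
    by symmetry; exact: op_pointwise (mulop_comp mu2 bq bphi).
  exact: subrr.
apply/funext => w; set Y := _ - _.
have QY : Q (Y w) = Y w.
  rewrite -[Y w]/(Q (mulop (fun x => q x * phi x) (Q w)) - Q (mulop q (Q (Q (mulop phi (Q w)))))).
  by rewrite (linear_opB _ _ lQ) !QQ.
rewrite -[LHS]/(Q (Y w) - Tt (monomial N N) (Tt M' (Y w))) QY MY.
have [lN _] := torus_toeplitz_bounded (bounded_measurable_monomial R N N).
by rewrite (linear_op0 lN) subr0.
Qed.

(** If c inverts T_{phi q} in the corner of Q, then T_q c is a right inverse and c T_q a left
    inverse of T_phi, up to products through the gap. The trace enters through the hypothesis that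
    such products lie in [M]. *)
Lemma parametrix (A M : set op2) phi : cstar_subalgebra A -> lin_subspace M ->
  (forall f, continuous f -> [set a | A a /\ exists2 a', A a' & is_adjoint a a'] (Tt f)) ->
  (forall N x y, [set a | A a /\ exists2 a', A a' & is_adjoint a a'] x ->
     [set a | A a /\ exists2 a', A a' & is_adjoint a a'] y -> M (x \o gap N \o y)) ->
  continuous phi -> invertible_CT2 phi ->
  exists b, [/\ A b, M (Q - (Tt phi \o b)) & M (Q - (b \o Tt phi))].
Proof.
move=> AC MS DT tg cphi [psi cpsi phipsi].
have [K K0 phiK] := continuous_sqnorm_bound cphi.
have K1 : 0 < K + 1 by rewrite ltr_wpDl.
(* Chosen so that |phi (psi - q)|^2 is at most 1/4; [K + 1] because [K] may be 0. *)
have e0 : 0 < 4^-1 / (K + 1) by rewrite divr_gt0// invr_gt0.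
have [N [q qN psiq]] := trig_approximation cpsi e0.
have cq := continuous_trig qN; have bq := bounded_measurable_continuous cq.
have bphi := bounded_measurable_continuous cphi.
have cpq := continuous_mul cphi cq; have bpq := bounded_measurable_continuous cpq.
have c1 : continuous (fun _ : T * T => 1 : Cx R) by exact: cst_continuous.
have b1 := bounded_measurable_continuous c1.
(* Then T_{phi q} = Q - T_f, where f = 1 - phi q has modulus at most 1/2. *)
pose f x := -1 * (phi x * q x) + 1.
have cf : continuous f := @continuous_lin (-1) _ _ cpq c1.
have bf := bounded_measurable_continuous cf.
have f4 x : sqnorm (f x) <= 2^-1 ^+ 2.
  have -> : f x = phi x * (psi x - q x) by rewrite /f mulrBr phipsi mulN1r addrC.
  rewrite sqnormM; apply: (@le_trans _ _ (K * (4^-1 / (K + 1)))).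
    by apply: ler_pM; rewrite ?sqnorm_ge0.
  rewrite mulrCA; have -> : 2^-1 ^+ 2 = 4^-1 * 1 :> R by rewrite mulr1 expr2 -invfM -natrM.
  by apply: ler_wpM2l; rewrite ?invr_ge0// ler_pdivrMr// mul1r lerDl.
have [Ab AS AM AJ _] := AC.
have AQ : A Q by rewrite -(torus_toeplitz1 HP); exact: (DT _ c1).1.
have [Af [f' Af' aff]] := DT _ cf.
have QQ := PT2_idem HP; have QQ' w : Q (Q w) = Q w := op_pointwise w QQ.
have Qf : Q \o Tt f = Tt f by apply/funext => w; exact: QQ'.
have fQ : Tt f \o Q = Tt f by apply/funext => w; rewrite /torus_toeplitz /= QQ'.
have h0 : 0 <= 2^-1 :> R by rewrite invr_ge0.
have [c [Ac cW Wc aDc]] := neumann_adjointable AC AQ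
  (PT2_adjoint HP) QQ Af Af' aff Qf fQ (torus_toeplitz_le HP bf h0 f4).
have WE : Q - Tt f = Tt (fun x => phi x * q x).
  rewrite (torus_toeplitz_lin (-1) bpq b1) (torus_toeplitz1 HP) scaleN1r.
  by rewrite opprD opprK addrCA subrr addr0.
have WE' : Tt (fun x => q x * phi x) = Tt (fun x => phi x * q x).
  by congr torus_toeplitz; apply/funext => x; rewrite mulrC.
rewrite WE in cW Wc.
set W := Tt (fun x => phi x * q x) in cW Wc WE'; set a := Tt phi; set s := Tt q.
have [Dbd DS DM _] := cstar_adjointable AC.
have Da : [set a | A a /\ exists2 a', A a' & is_adjoint a a'] a := DT _ cphi.
have Ds : [set a | A a /\ exists2 a', A a' & is_adjoint a a'] s := DT _ cq.
have Dc : [set a | A a /\ exists2 a', A a' & is_adjoint a a'] c := conj Ac aDc.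
have DW : [set a | A a /\ exists2 a', A a' & is_adjoint a a'] W := DT _ cpq.
have DX : [set a | A a /\ exists2 a', A a' & is_adjoint a a'] (W - (a \o s)) := lin_subspaceB DS DW (DM _ _ Da Ds).
have DY : [set a | A a /\ exists2 a', A a' & is_adjoint a a'] (W - (s \o a)) := lin_subspaceB DS DW (DM _ _ Ds Da).
have XR := semi_commutator_gap bphi qN; have RY := gap_semi_commutator bphi qN.
rewrite WE' -/W -/a -/s in XR RY.
have [lc _] := Ab _ Ac; have [ls _] := Ab _ Ds.1.
have cWE w : c (W w) = Q w := op_pointwise w cW.
have WcE w : W (c w) = Q w := op_pointwise w Wc.
(* As W c = Q, this error is (W - a s) c, and the gap can be inserted. *)
have vE : Q - (a \o (s \o c)) = (W - (a \o s)) \o gap N \o c.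
  transitivity ((W - (a \o s)) \o c); last exact: (esym (congr1 (fun h : op2 => h \o c) XR)).
  by apply/funext => w; exact: (esym (congr1 (fun v : H2 => v - a (s (c w))) (WcE w))).
have uE : Q - ((c \o s) \o a) = c \o gap N \o (W - (s \o a)).
  transitivity (c \o (W - (s \o a))); last first.
    by apply/funext => w; exact: (esym (congr1 c (op_pointwise w RY))).
  apply/funext => w; symmetry.
  apply: (etrans (linear_opB (W w) (s (a w)) lc)).
  exact: (congr1 (fun v : H2 => v - c (s (a w))) (cWE w)).
exists (s \o c); split; first exact: (AM _ _ Ds.1 Ac).
  by rewrite vE; exact: tg.
(* [c \o s] is a left inverse of [a] up to [M] and [s \o c] a right inverse, so they agree up to [M]. *)
have -> : Q - ((s \o c) \o a) = (c \o gap N \o (W - (s \o a))) +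
    ((c \o s \o (W - (a \o s))) \o gap N \o (c \o a)) -
    (c \o gap N \o ((W - (s \o a)) \o (s \o c) \o a)).
  apply/funext => w; have E3 (x x' y y' z z' : H2) : x = x' -> y = y' -> z = z' ->
      x + y - z = x' + y' - z' by move=> -> -> ->.
  (* With u = Q - c s a and v = Q - a s c, the identity is Q - s c a = u + c s v a - u s c a. *)
  transitivity ((Q w - c (s (a w))) + c (s (Q (a w) - a (s (c (a w))))) -
    (Q (s (c (a w))) - c (s (a (s (c (a w))))))); last first.
    exact: E3 (op_pointwise w uE) (congr1 (fun v => c (s v)) (op_pointwise (a w) vE))
      (op_pointwise (s (c (a w))) uE).
  have Qs v : Q (s v) = s v by exact: QQ'.
  have sQ v : s (Q v) = s v by rewrite /s /torus_toeplitz /= QQ'.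
  rewrite [s (_ - _)](linear_opB _ _ ls) sQ Qs (linear_opB _ _ lc).
  have arith (x y z t : H2) : x - z = x - y + (y - t) - (z - t).
    by rewrite opprB !addrA !subrK.
  exact: arith.
apply: (lin_subspaceB MS); last exact: (tg N c _ Dc (DM _ _ (DM _ _ DY (DM _ _ Ds Dc)) Da)).
apply: (lin_subspaceD MS); first exact: (tg N c _ Dc DY).
exact: (tg N _ _ (DM _ _ (DM _ _ Dc Ds) DX) (DM _ _ Dc Da)).
Qed.


Context (theta : R) (theta0 : 0 < theta).
Context (tau : op -> Cx R) (tauP : is_character LT tau) (tauP0 : tau P != 0).
Local Notation A := (toeplitz_algebra (OmegaT2 theta tau) (@CT2 R)).
Local Notation DA := [set a | A a /\ exists2 a', A a' & is_adjoint a a'].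

Lemma toeplitz_adjointable f : continuous f -> DA (Tt f).
Proof.
move=> cf; have bf := bounded_measurable_continuous cf; have Af : A (Tt f) by exact: toeplitz_algebra_mem.
have [_ _ _ AJ _] : cstar_subalgebra A by exact: toeplitz_algebra_cstar.
split => //; exists (Tt (fun x => conjc (f x))); last exact: torus_toeplitz_adjoint.
by apply: (AJ _ _ Af _ (torus_toeplitz_adjoint HP bf)); exact: torus_toeplitz_bounded (bounded_measurableJ bf).
Qed.

Lemma invertible_fredholm phi : continuous phi -> invertible_CT2 phi ->
  fredholm (OmegaT2 theta tau) (@CT2 R) (toeplitz (OmegaT2 theta tau) (mulop phi)).
Proof.
move=> cphi phiV; rewrite /fredholm torus_toeplitzE ind_proj_OmegaT2.
split; first exact: (@toeplitz_algebra_mem R theta tau phi cphi).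
apply: (parametrix (A := A) (M := trace_span A (trT2 theta tau))) => //.
- exact: toeplitz_algebra_cstar.
- exact: lin_span_subspace.
- exact: toeplitz_adjointable.
- by move=> N x y; exact: (trace_span_gap HP theta0 tauP tauP0).
Qed.

End invertible_implies_fredholm.

(** * The equivalence *)

Theorem theorem3p5 (R : realType) (theta : R)
    (tau : (L2 (circle_measure R) -> L2 (circle_measure R)) -> Cx R)
    (phi : circle R * circle R -> Cx R) :
  0 < theta -> irrational theta ->
  is_character (@LT R) tau -> tau (@PT R) != 0 ->
  continuous phi ->
  fredholm (OmegaT2 theta tau) (@CT2 R)
      (toeplitz (OmegaT2 theta tau) (mulop phi)) <->
  invertible_CT2 phi.
Proof.
move=> theta0 _ tauP tauP0 cphi.
(* A character vanishes at 0, so tau([PT]) != 0 rules out the default value of [PT]. *)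
have HP : hardy_proj_spec (@PT R).
  apply: PT_spec; apply: contraNneq tauP0 => ->.
  have [tauL _ _] := tauP; have L0 : LT (0 : L2 (circle_measure R) -> L2 (circle_measure R)).
    by move=> B [[_ [B0 _] _ _ _] _].
  by have := tauL (-1) 0 0 L0 L0; rewrite scaler0 addr0 mulN1r addNr => ->.
split; first exact: fredholm_invertible.
exact: invertible_fredholm.
Qed.
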